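(* Let $0<p<\infty$, let $w$ be a weight on the unit disc $\mathbb{D}$ which is a Bekoll\'e-Bonami weight for some exponent $q\in(1,\infty)$, and let $\|\cdot\|=\|\cdot\|_{L^p(w\,dA)}$. Suppose that there is $\eta_0\in(0,1)$ such that for every $0<\eta<\eta_0$ the operators $$u(z)\mapsto u\bigl(z+e^{i\arg z}\,\eta\,\delta_b(z)\bigr)\qquad\text{and}\qquad u(z)\mapsto u\bigl(z+i\,e^{i\arg z}\,\eta\,\delta_b(z)\bigr),$$ acting on real-valued harmonic functions $u$ on $\mathbb{D}$, are bounded with respect to $\|\cdot\|$ (with bounds allowed to depend on $\eta$). Then the operator taking a real-valued harmonic function $u$ on $\mathbb{D}$ to its harmonic conjugate $v$ (normalized by $v(0)=0$) is bounded with respect to $\|\cdot\|$.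
   Context: $\mathbb{D}=\{z\in\mathbb{C}:|z|<1\}$, $dA$ is area measure, and $\delta_b(z)=1-|z|$. A weight is a measurable function $w:\mathbb{D}\to[0,\infty)$ that is positive a.e. For $1<q<\infty$, $w$ is a Bekoll\'e-Bonami weight for the exponent $q$ if there is a constant $0<C<\infty$ such that for every disc $B\subset\mathbb{C}$ whose closure intersects the unit circle, $$\left(\frac1{|B|}\int_{B\cap\mathbb{D}} w\,dA\right)\left(\frac1{|B|}\int_{B\cap\mathbb{D}} w^{-1/(q-1)}\,dA\right)^{q-1}\le C ,$$ where $|B|$ is the area of $B$. For measurable $f$ on $\mathbb{D}$, $\|f\|_{L^p(w\,dA)}=\left(\int_{\mathbb{D}}|f|^p\,w\,dA\right)^{1/p}\in[0,\infty]$. An operator $T$ (defined on a given class of functions) is bounded with respect to $\|\cdot\|$ if for each $D>0$ there is a constant $D'>0$ such that $\|Tf\|\le D$ whenever $f$ is in the class and $\|f\|\le D'$; for operators commuting with positive scalar multiplication and $\|\cdot\|=\|\cdot\|_{L^p(w\,dA)}$ this is equivalent to the existence of a constant $C$ with $\|Tf\|\le C\|f\|$ for all $f$ in the class with $\|f\|<\infty$. The harmonic conjugate $v$ of $u$ is the real harmonic function with $v(0)=0$ such that $u+iv$ is analytic in $\mathbb{D}$. The value of $\arg z$ at $z=0$ is irrelevant. *)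

(* Defs.v *)
From HB Require Import structures.
From mathcomp Require Import all_boot all_order all_algebra.
From mathcomp Require Import complex.
From mathcomp Require Import all_classical all_reals all_analysis.
From mathcomp Require Import measurable_realfun.

Set Implicit Arguments.
Unset Strict Implicit.
Unset Printing Implicit Defensive.

Import Order.TTheory GRing.Theory Num.Theory.
Import numFieldNormedType.Exports.

Local Open Scope classical_set_scope.
Local Open Scope ring_scope.

Section Plane.
Variable R : realType.

(* The plane is [R * R], the point [(x, y)] standing for [x + iy]: this type
   carries both the product measure and the real partial derivatives.
   [R[i]] is used only for complex differentiability.  Functions on the disc
   are total functions on the plane whose values off the disc are never used. *)

(* [`|z|] on [R * R] is the sup norm, hence a separate modulus. *)
Definition modulus (z : R * R) : R := Num.sqrt (z.1 ^+ 2 + z.2 ^+ 2).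

Definition open_disc (c : R * R) (r : R) : set (R * R) :=
  [set z | modulus (z - c) < r].

Definition unit_disc : set (R * R) := [set z | modulus z < 1].

Definition unit_circle : set (R * R) := [set z | modulus z = 1].

Definition delta_b (z : R * R) : R := 1 - modulus z.

(* [exp (i arg z) = z / |z|], with the convention [arg 0 = 0]. *)
Definition exp_i_arg (z : R * R) : R * R :=
  if z == 0 then (1, 0) else (modulus z)^-1 *: z.

Definition mul_i (z : R * R) : R * R := (- z.2, z.1).

Definition radial_shift (eta : R) (u : R * R -> R) : R * R -> R :=
  fun z => u (z + (eta * delta_b z) *: exp_i_arg z).

Definition angular_shift (eta : R) (u : R * R -> R) : R * R -> R :=
  fun z => u (z + (eta * delta_b z) *: mul_i (exp_i_arg z)).

Definition partial_x (u : R * R -> R) : R * R -> R := fun z => 'D_(1, 0) u z.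

Definition partial_y (u : R * R -> R) : R * R -> R := fun z => 'D_(0, 1) u z.

Definition C1_on (A : set (R * R)) (u : R * R -> R) : Prop :=
  forall z, A z ->
    [/\ derivable u z (1, 0), derivable u z (0, 1),
        {for z, continuous (partial_x u)} &
        {for z, continuous (partial_y u)}].

Definition harmonic_on (A : set (R * R)) (u : R * R -> R) : Prop :=
  [/\ C1_on A u, C1_on A (partial_x u), C1_on A (partial_y u) &
      forall z, A z ->
        partial_x (partial_x u) z + partial_y (partial_y u) z = 0].

Definition analytic_on (A : set (R * R)) (f : R[i]^o -> R[i]^o) : Prop :=
  forall z : R[i], A (complex.Re z, complex.Im z) -> derivable f z 1.

Definition harmonic_conjugate (u v : R * R -> R) : Prop :=
  [/\ harmonic_on unit_disc v, v (0, 0) = 0 &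
      analytic_on unit_disc (fun z =>
        Complex (u (complex.Re z, complex.Im z))
                (v (complex.Re z, complex.Im z)))].

Definition area :
    {measure set (measurableTypeR R * measurableTypeR R)%type -> \bar R} :=
  (@lebesgue_measure R \x @lebesgue_measure R)%E.

(* Lebesgue measurability on [A]: preimages of Borel sets lie in the
   completion of the Borel sigma-algebra with respect to [area].  For a
   nonnegative function of this kind the library's integral with respect to
   [area] (a supremum over Borel simple functions) is its Lebesgue integral. *)
Definition lebesgue_measurable_on (A : set (R * R)) (w : R * R -> R) : Prop :=
  forall Y : set (measurableTypeR R), measurable Y ->
    completed_algebra_gen area (A `&` w @^-1` Y).

Definition weight (w : R * R -> R) : Prop :=
  [/\ lebesgue_measurable_on unit_disc w,
      (forall z, unit_disc z -> 0 <= w z) &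
      {ae area, forall z, unit_disc z -> 0 < w z}].

Local Open Scope ereal_scope.

Definition disc_average (B : set (R * R)) (f : R * R -> R) : \bar R :=
  ((fine (area B))^-1)%:E * \int[area]_(z in B `&` unit_disc) (f z)%:E.

(* [0 `^ a = 0] for [a != 0], so the negative power of [w] is finite where
   [w] vanishes; for a weight this happens only on a null set. *)
Definition bekolle_bonami (q : R) (w : R * R -> R) : Prop :=
  exists2 C : R, (0 < C)%R &
    forall (c : R * R) (r : R), (0 < r)%R ->
      closure (open_disc c r) `&` unit_circle !=set0 ->
      disc_average (open_disc c r) w *
        disc_average (open_disc c r) (fun z => w z `^ (- (q - 1)^-1))%R
          `^ (q - 1) <= C%:E.

Definition weighted_norm (p : R) (w : R * R -> R) (f : R * R -> R) : \bar R :=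
  (\int[area]_(z in unit_disc) (`|f z| `^ p * w z)%R%:E) `^ p^-1.

(* The operator is given by its graph: [T f g] means [T f = g]. *)
Definition bounded_operator (nrm : (R * R -> R) -> \bar R)
    (X : set (R * R -> R)) (T : (R * R -> R) -> (R * R -> R) -> Prop) : Prop :=
  forall D : R, (0 < D)%R -> exists2 D' : R, (0 < D')%R &
    forall f g, X f -> T f g -> nrm f <= D'%:E -> nrm g <= D%:E.

End Plane.

(* Main.v *)
(* Put s = p / q.  By Hardy and Littlewood the supremum of |u|^s over a disc is
   bounded by its mean over a larger one, also when s < 1; so is the gradient
   of u, hence that of v.  Hoelder's inequality and the Bekolle-Bonami
   condition turn the mean of |u|^s into a weighted integral: the p-th power of
   the oscillation of v over the top half of a Carleson box, times the mass
   w(B) of a disc B containing the box, is at most a constant times the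
   integral of |u|^p w over a nearby Whitney region, and these regions have
   bounded overlap.  The same condition shows that the top half of a Carleson
   box carries a fixed proportion of its mass.  Therefore, up to oscillation
   terms, the contributions of successive generations of dyadic boxes to the
   integral of |v|^p w decay geometrically, and summing over the generations,
   starting from v(0) = 0, gives the bound.

   The mean value property behind the first step comes from the kernel
   k = (s - |z - c|^2)_+: a divergence computation with the Cauchy-Riemann
   equations shows that the integral of k^2 u is proportional to s^3. *)

Require Import Defs.
From mathcomp Require Import all_boot all_order all_algebra.
From mathcomp Require Import complex.
From mathcomp Require Import all_classical all_reals all_analysis.
From mathcomp Require Import measurable_realfun.
From mathcomp Require Import ring lra.

Set Implicit Arguments.
Unset Strict Implicit.
Unset Printing Implicit Defensive.

Import Order.TTheory GRing.Theory Num.Theory.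
Import numFieldNormedType.Exports.

Local Open Scope classical_set_scope.
Local Open Scope ring_scope.

(** * Borel versions of Lebesgue measurable weights *)

(** The exponent [s = p / q] is dictated by the weight: the Bekolle-Bonami condition bounds the q-th
    power of the mean of [f], times [w(B)], by the integral of [f^q w], and [f = |u|^s] makes [f^q]
    equal to [|u|^p]. The norm of [v] may be infinite a priori, so nothing can be absorbed into it.
    Instead the values of [v] at box centres are summed over finitely many generations, with a bound
    independent of their number, and monotone convergence concludes. If the top half carries the
    proportion [1 / C1] of the mass, the children keep at most [1 - 1 / C1]; allowing a loss
    [1 + 1 / C1] when [v] is compared at parent and child still leaves the ratio [1 - 1 / C1^2 < 1].
    No angles occur: the region near the circle is covered from four frames along the half-axes,
    with boxes cut out by the modulus and a Cartesian height. Squares replace pi in all area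
    estimates. The weight is only Lebesgue measurable and may vanish on a null set; a positive Borel
    function giving the same integrals takes its place. *)

Section NullModification.
Local Open Scope ereal_scope.
Context d (T : measurableType d) (R : realType).
Variable mu : {measure set T -> \bar R}.
Import HBNNSimple.

(* No measurability is assumed: the library's integral of a nonnegative
   function is a supremum over simple functions, so it is monotone anyway. *)
Lemma le_integral_off_null (D N : set T) (f g : T -> \bar R) :
  measurable N -> mu N = 0 ->
  (forall x, D x -> 0 <= f x) -> (forall x, D x -> 0 <= g x) ->
  (forall x, D x -> ~ N x -> f x <= g x) ->
  \int[mu]_(x in D) f x <= \int[mu]_(x in D) g x.
Proof.
move=> mN N0 f0 g0 fg; rewrite !ge0_integralE//.
apply: ge_ereal_sup => _ [h/= hf] <-.
have mNC := measurableC mN.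
(* Cutting a simple function below [f] down to the complement of [N] puts it below [g] everywhere
   and, [N] being null, keeps its integral. *)
apply: le_ereal_sup_tmp; exists (sintegral mu (proj_nnsfun h mNC)).
  exists (proj_nnsfun h mNC) => // x.
  rewrite -(mrestrict h mNC) /patch; case: ifPn => [|_]; last first.
    by case: ifPn => // /set_mem; exact: g0.
  move=> /set_mem Nx; apply: (le_trans (hf x)); rewrite /patch.
  by case: ifPn => // /set_mem Dx; exact: fg.
rewrite -!integralT_nnsfun; apply: ae_ge0_le_integral => //.
- by move=> x _; rewrite lee_fin.
- exact/measurable_EFinP.
- by move=> x _; rewrite lee_fin.
- exact/measurable_EFinP.
- exists N; split => // x /= /not_implyP[_] H; apply: contrapT => Nx; apply: H.
  have := mrestrict h mNC; move/(congr1 (fun k => k x)) => /= <-.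
  by rewrite /patch mem_set.
Qed.

Lemma eq_integral_off_null (D N : set T) (f g : T -> \bar R) :
  measurable N -> mu N = 0 ->
  (forall x, D x -> 0 <= f x) -> (forall x, D x -> 0 <= g x) ->
  (forall x, D x -> ~ N x -> f x = g x) ->
  \int[mu]_(x in D) f x = \int[mu]_(x in D) g x.
Proof.
move=> mN N0 f0 g0 fg; apply/eqP; rewrite eq_le.
by apply/andP; split; apply: (le_integral_off_null mN) => // x Dx Nx; rewrite fg.
Qed.

End NullModification.

Section BorelVersion.
Context d (T : measurableType d) (R : realType).
Variable mu : {measure set T -> \bar R}.

(** Superlevel sets at rational levels suffice: each is Borel up to a null set, and [N] collects
    these countably many null sets and the one where [w] fails to be positive. Outside [D] and on
    [N] the new function is 1, so that it is positive everywhere. *)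
Lemma borel_version (D : set T) (w : T -> R) :
  measurable D ->
  (forall Y : set (measurableTypeR R), measurable Y ->
    completed_algebra_gen mu (D `&` w @^-1` Y)) ->
  {ae mu, forall z, D z -> 0 < w z} ->
  exists N (w' : T -> R), [/\ measurable N, mu N = 0%E,
    measurable_fun setT w', forall z, 0 < w' z &
    forall z, D z -> ~ N z -> w z = w' z].
Proof.
move=> mD mw [M0 [mM0 M00 w0]].
have H (r : rat) : exists BN : set T * set T, [/\ measurable BN.1,
    measurable BN.2, mu BN.2 = 0%E &
    forall z, ~ BN.2 z -> (D z /\ ratr r < w z) <-> BN.1 z].
  have [B mB [N [M [mM M00' NM]] BN]] := mw [set` `]ratr r, +oo[ ] (measurable_itv _).
  exists (B, M); split => //= z Mz.
  have -> : (D z /\ ratr r < w z) = (D `&` w @^-1` [set` `]ratr r, +oo[ ]) z.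
    by rewrite /= in_itv /= andbT.
  by rewrite -BN; split => [[//|/NM]//|]; left.
have {H} [F HF] := choice H.
(* Pickling the rationals turns the null sets into a sequence; a code of no rational contributes the
   empty set. *)
pose G n := odflt set0 (omap (fun r : rat => (F r).2) (unpickle n)).
have mG n : measurable (G n).
  by rewrite /G; case: unpickle => //= r; have [] := HF r.
have G0 n : mu (G n) = 0%E.
  by rewrite /G; case: unpickle => [r|]/=; [have [] := HF r | exact: measure0].
have GE r z : (F r).2 z -> (\bigcup_n G n) z.
  move=> rz; exists (pickle r); first exact: I.
  rewrite /G pickleK; exact: rz.
pose N := M0 `|` \bigcup_n G n.
have mN : measurable N by apply: measurableU => //; exact: bigcupT_measurable.
have N0 : mu N = 0%E.
  have mUG : measurable (\bigcup_n G n) by exact: bigcupT_measurable.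
  rewrite measureU0//; apply: measure_negligible => //.
  apply: negligible_bigcup => n; have [mB mB0] := (mG n, G0 n).
  by apply/negligibleP.
have mDN := measurableD mD mN.
pose w' z := if z \in D `\` N then w z else 1.
exists N, w'; split => //.
- have -> : w' = fun z => if z \in D `\` N then w z else cst 1 z by [].
  apply: measurable_fun_if => //.
  - by apply: (measurable_fun_bool true) => //; rewrite setTI preimage_mem_true.
  - rewrite preimage_mem_true setTI.
    move=> _; apply: (measurability _ (RGenOInfty.measurableE R)) => //.
    move=> _ [_ [x ->] <-].
    (* A real level [x] is reached through the rational levels [r >= x], since a rational lies
       strictly between [x] and [w z]. *)
    have -> : (D `\` N) `&` w @^-1` `]x, +oo[%classic =
        (\bigcup_(r in [set r : rat | x <= ratr r]) (F r).1) `\` N.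
      apply/seteqP; split => z /=.
        rewrite in_itv /= andbT => -[[Dz Nz] xw].
        have [r] := rat_in_itvoo xw; rewrite in_itv /= => /andP[xr rw].
        split => //; exists r; first exact: ltW.
        have [_ _ _ /(_ z)] := HF r; case.
          by move=> /GE Gz; apply: Nz; right.
        by move=> + _; apply.
      move=> [[r /= xr Fz] Nz].
      have [_ _ _ /(_ z)] := HF r; case.
        by move=> /GE Gz; apply: Nz; right.
      move=> _ /(_ Fz)[Dz rw]; split => //.
      by rewrite in_itv /= andbT (le_lt_trans xr).
    apply: measurableD => //; rewrite bigcup_mkcond.
    apply: bigcupT_measurable_rat => r; case: ifPn => // _.
    by have [] := HF r.


- move=> z; rewrite /w'; case: ifPn => // /set_mem [Dz Nz].
  by apply: contrapT => wz; apply: Nz; left; apply: w0 => /(_ Dz).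
- by move=> z Dz Nz; rewrite /w' mem_set.
Qed.

End BorelVersion.

(** * The Euclidean plane *)

Section Plane.
Variable R : realType.
Implicit Types z c : R * R.

Lemma modulus_ge0 z : 0 <= modulus z. Proof. exact: sqrtr_ge0. Qed.

Lemma sqr_modulus z : modulus z ^+ 2 = z.1 ^+ 2 + z.2 ^+ 2.
Proof. by rewrite sqr_sqrtr// addr_ge0// sqr_ge0. Qed.

Lemma modulus0 : modulus (0 : R * R) = 0.
Proof. by rewrite /modulus/= expr0n/= addr0 sqrtr0. Qed.

Lemma modulusN z : modulus (- z) = modulus z.
Proof. by rewrite /modulus/= !sqrrN. Qed.

Lemma modulusB z c : modulus (z - c) = modulus (c - z).
Proof. by rewrite -modulusN opprB. Qed.

Lemma modulusZ (k : R) z : modulus (k *: z) = `|k| * modulus z.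
Proof.
rewrite /modulus/= /GRing.scale/= !exprMn -mulrDr sqrtrM ?sqr_ge0//.
by rewrite sqrtr_sqr.
Qed.

Lemma modulus_le (z : R * R) r : 0 <= r ->
  (modulus z <= r) = (z.1 ^+ 2 + z.2 ^+ 2 <= r ^+ 2).
Proof. by move=> r0; rewrite -sqr_modulus ler_pXn2r ?nnegrE ?modulus_ge0. Qed.

Lemma modulus_lt (z : R * R) r : 0 <= r ->
  (modulus z < r) = (z.1 ^+ 2 + z.2 ^+ 2 < r ^+ 2).
Proof. by move=> r0; rewrite -sqr_modulus ltr_pXn2r ?nnegrE ?modulus_ge0. Qed.

(** Cauchy-Schwarz by Lagrange's identity: the defect is the square of the determinant of [z] and
    [c]. *)
Lemma dot_le_modulus z c : z.1 * c.1 + z.2 * c.2 <= modulus z * modulus c.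
Proof.
have [h|/ltW h] := leP (z.1 * c.1 + z.2 * c.2) 0.
  by rewrite (le_trans h)// mulr_ge0// modulus_ge0.
rewrite -(@ler_pXn2r _ 2)// ?nnegrE ?mulr_ge0 ?modulus_ge0//.
rewrite exprMn !sqr_modulus -subr_ge0.
have -> : (z.1 ^+ 2 + z.2 ^+ 2) * (c.1 ^+ 2 + c.2 ^+ 2) -
  (z.1 * c.1 + z.2 * c.2) ^+ 2 = (z.1 * c.2 - z.2 * c.1) ^+ 2 by ring.
exact: sqr_ge0.
Qed.

Lemma modulusD z c : modulus (z + c) <= modulus z + modulus c.
Proof.
rewrite modulus_le ?addr_ge0 ?modulus_ge0//= !sqrrD !sqr_modulus.
by have := dot_le_modulus z c; lra.
Qed.

Lemma modulus_dist (a b c : R * R) :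
  modulus (a - b) <= modulus (a - c) + modulus (c - b).
Proof. by have := modulusD (a - c) (c - b); rewrite addrA subrK. Qed.

Lemma modulus_diff z c : `|modulus z - modulus c| <= modulus (z - c).
Proof.
rewrite ler_norml; apply/andP; split.
  by have := modulusD (c - z) z; rewrite subrK (modulusB z); lra.
by have := modulusD (z - c) c; rewrite subrK; lra.
Qed.

Lemma abs1_le_modulus z : `|z.1| <= modulus z.
Proof. by rewrite -sqrtr_sqr ler_wsqrtr// lerDl sqr_ge0. Qed.

Lemma abs2_le_modulus z : `|z.2| <= modulus z.
Proof. by rewrite -sqrtr_sqr ler_wsqrtr// lerDr sqr_ge0. Qed.

Lemma modulus_le_abs z : modulus z <= `|z.1| + `|z.2|.
Proof.
rewrite modulus_le ?addr_ge0// sqrrD !real_normK ?num_real//.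
by rewrite lerD2r lerDl mulrn_wge0// mulr_ge0.
Qed.

Lemma modulus_le_norm z : modulus z <= `|z| *+ 2.
Proof.
apply: (le_trans (modulus_le_abs z)); rewrite mulr2n.
by rewrite prod_normE lerD// le_max lexx ?orbT.
Qed.

Lemma norm_le_modulus z : `|z| <= modulus z.
Proof. by rewrite prod_normE ge_max abs1_le_modulus abs2_le_modulus. Qed.

Lemma continuous_modulus : continuous (@modulus R).
Proof.
move=> z; apply/cvgrPdist_le => e e0; near=> c.
apply: (le_trans (modulus_diff z c)); apply: (le_trans (modulus_le_norm _)).
rewrite -mulr_natr -ler_pdivlMr//.
near: c; have e2 : 0 < e / 2 by rewrite divr_gt0.
by apply: filterS (nbhsx_ballx z _ e2) => c; rewrite -ball_normE /= => /ltW.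
Unshelve. all: by end_near. Qed.

Lemma open_open_disc c r : open (open_disc c r).
Proof.
have -> : open_disc c r = (fun z => modulus (z - c)) @^-1` [set x | x < r] by [].
apply: open_comp; last exact: open_lt.
move=> z _; apply: continuous_comp; last exact: continuous_modulus.
by apply: cvgB; [exact: cvg_id|exact: cvg_cst].
Qed.

Lemma unit_discE : @unit_disc R = open_disc 0 1.
Proof. by apply/seteqP; split => z; rewrite /unit_disc /open_disc/= subr0. Qed.

Lemma open_unit_disc : open (@unit_disc R).
Proof. by rewrite unit_discE; exact: open_open_disc. Qed.

Lemma measurable_box (A B : set (measurableTypeR R)) :
  measurable A -> measurable B ->
  measurable (A `*` B : set (measurableTypeR R * measurableTypeR R)).
Proof. exact: measurableX. Qed.

(** The product sigma-algebra is generated by rectangles, so an open set is written as the union of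
    the countably many rational squares that it contains. *)
Lemma measurable_open_plane (U : set (R * R)) : open U ->
  measurable (U : set (measurableTypeR R * measurableTypeR R)).
Proof.
move=> oU.
pose box (a b r : rat) : set (measurableTypeR R * measurableTypeR R) :=
  (ball (ratr a : R) (ratr r) `*` ball (ratr b : R) (ratr r)).
have -> : U = \bigcup_(a in [set: rat]) \bigcup_(b in [set: rat])
    \bigcup_(r in [set: rat]) (if pselect (box a b r `<=` U) then box a b r else set0).
  apply/seteqP; split => [[x y] Uz|z [a _ [b _ [r _]]]]; last first.
    by case: pselect => // h /h.
  have /nbhs_ballP[e /= e0 eU] := open_nbhs_nbhs (conj oU Uz).
  have e4 : 0 < e / 4 by rewrite divr_gt0.
  (* A radius above [e / 4] and a centre within [e / 4] in each coordinate make the square contain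
     the point; its reach stays below [e / 4 + e / 2 < e]. *)
  have [r] := @rat_in_itvoo R (e / 4) (e / 2) ltac:(lra).
  rewrite in_itv/= => /andP[er re].
  have [a] := @rat_in_itvoo R (x - e / 4) x ltac:(lra).
  have [b] := @rat_in_itvoo R (y - e / 4) y ltac:(lra).
  rewrite !in_itv/= => /andP[yb by_] /andP[xa ax].
  exists a => //; exists b => //; exists r => //; case: pselect => [sU|].
    by split => /=; rewrite /ball/= ltr_norml; apply/andP; split; lra.
  case=> -[x' y'] [/= xx yy]; apply: eU; split => /=; move: xx yy;
    rewrite /ball/= !ltr_norml => /andP[? ?] /andP[? ?]; apply/andP; split; lra.
apply: bigcupT_measurable_rat => a; apply: bigcupT_measurable_rat => b.
apply: bigcupT_measurable_rat => r; case: pselect => [sU|nU]; last first.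
  exact: measurable0.
by apply: measurable_box; exact: measurable_ball.
Qed.

Lemma continuous_on_measurable (D : set (R * R)) (f : R * R -> R) : open D ->
  {in D, continuous f} ->
  measurable_fun (D : set (measurableTypeR R * measurableTypeR R)) f.
Proof.
move=> oD cf mD; apply: (measurability _ (RGenOpens.measurableE R)).
move=> _ [_ [a [b ->] <-]]; apply: measurable_open_plane.
rewrite openE => z -[Dz abz]; apply: filterI.
  exact: open_nbhs_nbhs.
apply: (cf _ (mem_set Dz)).
by apply: open_nbhs_nbhs; split => //; exact: interval_open.
exact: measurable_open_plane.
Qed.

Lemma area_box (a b c d : R) : a <= b -> c <= d ->
  area R (`[a, b] `*` `[c, d]) = ((b - a) * (d - c))%:E.
Proof.
move=> ab cd.
have -> : area R (`[a, b] `*` `[c, d]) =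
    (lebesgue_measure `[a, b]%classic * lebesgue_measure `[c, d]%classic)%E.
  exact: product_measure1E.
have itv (x y : R) : x <= y -> lebesgue_measure `[x, y]%classic = (y - x)%:E.
  rewrite lebesgue_measure_itv/= lte_fin -EFinB.
  by case: ltgtP => // ->; rewrite subrr.
by rewrite !itv// EFinM.
Qed.

End Plane.

(** * Calculus in the plane *)

Section Calculus1.
Variable R : realType.

(** Caratheodory's criterion, with the difference quotient extended by [l] at [x], yields
    derivability and the value of the derivative at once. *)
Lemma is_derive_eps (f : R -> R) (x l : R) :
  (forall e, 0 < e -> exists2 d, 0 < d &
     forall y, `|y - x| < d -> `|f y - f x - l * (y - x)| <= e * `|y - x|) ->
  is_derive x 1 f l.
Proof.
move=> H; apply/is_derive1_caratheodory.
exists (fun y => if y == x then l else (f y - f x) / (y - x)); split.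
- move=> y; case: eqP => [->|/eqP]; first by rewrite !subrr mulr0.
  by rewrite -subr_eq0 => /divfK->.
- apply/cvgrPdist_le => /= e e0; have [d d0 Hd] := H e e0.
  have := nbhsx_ballx x d d0; apply: filterS => y.
  rewrite -ball_normE/= eqxx distrC => xyd; case: eqP => [_|/eqP yx].
    by rewrite subrr normr0 ltW.
  have yx0 : y - x != 0 by rewrite subr_eq0.
  rewrite -(ler_pM2r (_ : 0 < `|y - x|)) ?normr_gt0// -normrM mulrBl divfK//.
  by rewrite distrC; exact: Hd.
- by rewrite eqxx.
Qed.

Lemma is_derive_continuous (f : R -> R) (x l : R) :
  is_derive x 1 f l -> {for x, continuous f}.
Proof. by case=> + _ => /derivable1_diffP/differentiable_continuous. Qed.

(** The mean value theorem measured against a reference slope [m]. The minimum and maximum allow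
    either order of [a] and [b], so increments of any sign are covered. *)
Lemma derive_dist_le (f df : R -> R) (a b m e : R) :
  (forall t, Num.min a b <= t <= Num.max a b ->
     is_derive t 1 f (df t) /\ `|df t - m| <= e) ->
  `|f b - f a - m * (b - a)| <= e * `|b - a|.
Proof.
wlog ab : a b / a <= b => [hw|].
  have /orP[ab|ba] := le_total a b; first exact: hw.
  move=> H; have := hw b a ba; rewrite minC maxC => /(_ H).
  rewrite (distrC a b) (_ : f a - f b - _ = - (f b - f a - m * (b - a))).
    by rewrite normrN.
  by ring.
rewrite (min_idPl ab) (max_idPr ab) => H.
have [||c cab ->] := @MVT_segment R f df a b ab.
- by move=> t /itvP tab; have [] := H t; rewrite ?tab.
- apply: continuous_in_subspaceT => t /set_mem/= /itvP tab.
  by have [|/is_derive_continuous] := H t; rewrite ?tab.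
by rewrite -mulrBl normrM ler_wpM2r//; have [] := H c; rewrite ?(itvP cab).
Qed.

Lemma eq_of_derive0 (f : R -> R) (a b : R) : a <= b ->
  (forall t, a <= t <= b -> is_derive t 1 f 0) -> f a = f b.
Proof.
move=> ab H; apply/esym/eqP; rewrite -subr_eq0 -normr_le0.
have := @derive_dist_le f (fun=> 0) a b 0 0; rewrite !mul0r !subr0 normr0; apply => t.
by rewrite (min_idPl ab) (max_idPr ab) => /H.
Qed.

End Calculus1.

Section Calculus2.
Variable R : realType.
Implicit Types (u v : R * R -> R) (D : set (R * R)).

Lemma is_derive_slice1 u (x y : R) : derivable u (x, y) (1, 0) ->
  is_derive x 1 (fun t => u (t, y)) (partial_x u (x, y)).
Proof.
rewrite /partial_x /derivable /derive.
have -> : (fun h : R => h^-1 *: ((u \o shift (x, y)) (h *: ((1, 0) : R * R)) - u (x, y))) =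
  (fun h : R => h^-1 *: (((fun t => u (t, y)) \o shift x) (h *: 1) - u (x, y))).
  apply/funext => h /=; congr (_ *: (u _ - _)).
  by rewrite /shift/=; congr pair => /=; rewrite scaler0 add0r.
by move=> H; split.
Qed.

Lemma is_derive_slice2 u (x y : R) : derivable u (x, y) (0, 1) ->
  is_derive y 1 (fun t => u (x, t)) (partial_y u (x, y)).
Proof.
rewrite /partial_y /derivable /derive.
have -> : (fun h : R => h^-1 *: ((u \o shift (x, y)) (h *: ((0, 1) : R * R)) - u (x, y))) =
  (fun h : R => h^-1 *: (((fun t => u (x, t)) \o shift y) (h *: 1) - u (x, y))).
  apply/funext => h /=; congr (_ *: (u _ - _)).
  by rewrite /shift/=; congr pair => /=; rewrite scaler0 add0r.
by move=> H; split.
Qed.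

(** From [z] to [z'] in one vertical and one horizontal step, each a one-variable mean value
    estimate; the corner stays in the neighbourhood because balls of the plane are squares. *)
Lemma C1_frechet D u z e : open D -> C1_on D u -> D z -> 0 < e ->
  exists2 d, 0 < d & forall z', `|z'.1 - z.1| < d -> `|z'.2 - z.2| < d ->
   `|u z' - u z - (partial_x u z * (z'.1 - z.1) + partial_y u z * (z'.2 - z.2))|
     <= e * (`|z'.1 - z.1| + `|z'.2 - z.2|).
Proof.
move=> oD Cu Dz e0; have [_ _ cx cy] := Cu _ Dz.
have : \forall z' \near z, [/\ D z', `|partial_x u z' - partial_x u z| <= e &
    `|partial_y u z' - partial_y u z| <= e].
  have nD : \forall z' \near z, D z' by apply: open_nbhs_nbhs.
  have /cvgrPdist_le/(_ e e0) nx := cx.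
  have /cvgrPdist_le/(_ e e0) ny := cy.
  apply: filterS3 nD nx ny => z' Dz' px py.
  by split; [exact: Dz'| rewrite distrC; exact: px| rewrite distrC; exact: py].
move=> /nbhs_ballP[d /= d0 H]; exists d => // -[x' y'] /=.
case: z Dz cx cy H => x y Dz cx cy H /= xd yd.
have box s t : `|s - x| < d -> `|t - y| < d -> ball (x, y) d (s, t).
  by move=> sx ty; split; rewrite -ball_normE /= distrC.
have between (a b t : R) : Num.min a b <= t <= Num.max a b -> `|t - a| <= `|b - a|.
  case: (leP a b) => ab /andP[? ?].
    by rewrite !ger0_norm ?subr_ge0 ?lerB.
  by rewrite !ler0_norm ?subr_le0 ?(ltW ab)// !opprB lerB.
have step1 : `|u (x', y') - u (x, y') - partial_x u (x, y) * (x' - x)| <= e * `|x' - x|.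
  apply: (@derive_dist_le R (fun t => u (t, y')) (fun t => partial_x u (t, y'))).
  move=> t /between tx; have [|Dt px _] := H (t, y').
    by apply: box => //; exact: le_lt_trans xd.
  have [du _ _ _] := Cu _ Dt; split; last exact: px.
  exact: (@is_derive_slice1 u t y' du).
have step2 : `|u (x, y') - u (x, y) - partial_y u (x, y) * (y' - y)| <= e * `|y' - y|.
  apply: (@derive_dist_le R (fun t => u (x, t)) (fun t => partial_y u (x, t))).
  move=> t /between ty; have [|Dt _ py] := H (x, t).
    by apply: box; [rewrite subrr normr0|exact: le_lt_trans yd].
  have [_ du _ _] := Cu _ Dt; split; last exact: py.
  exact: (@is_derive_slice2 u x t du).
rewrite [leRHS]mulrDr; apply: le_trans (lerD step1 step2).
set A := (X in `|X| + _); set B := (X in _ + `|X|).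
rewrite [X in `|X| <= _](_ : _ = A + B); first exact: ler_normD.
by rewrite /A /B; ring.
Qed.

Lemma C1_continuous D u z : open D -> C1_on D u -> D z -> {for z, continuous u}.
Proof.
move=> oD Cu Dz; apply/cvgrPdist_le => /= e e0.
have [d d0 H] := C1_frechet oD Cu Dz ltr01.
pose M := 1 + `|partial_x u z| + `|partial_y u z|.
have M0 : 0 < M by rewrite /M -addrA ltr_wpDr// addr_ge0.
have d'0 : 0 < Num.min d (e / (M *+ 2)) by rewrite lt_min d0 divr_gt0// mulrn_wgt0.
have := nbhsx_ballx z _ d'0; apply: filterS => z' [].
rewrite -!ball_normE /= !lt_min distrC (distrC z.2) => /andP[x1 x2] /andP[y1 y2].
rewrite distrC; have := H _ x1 y1; rewrite mul1r => h.
set a := z'.1 - z.1 in x1 x2 h *; set b := z'.2 - z.2 in y1 y2 h *.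
have ma : `|partial_x u z * a| <= `|partial_x u z| * (`|a| + `|b|).
  by rewrite normrM ler_wpM2l// lerDl.
have mb : `|partial_y u z * b| <= `|partial_y u z| * (`|a| + `|b|).
  by rewrite normrM ler_wpM2l// lerDr.
have : `|u z' - u z| <= M * (`|a| + `|b|).
  rewrite -[u z' - u z](subrK (partial_x u z * a + partial_y u z * b)).
  apply: (le_trans (ler_normD _ _)); apply: le_trans (lerD h (ler_normD _ _)) _.
  have -> : M * (`|a| + `|b|) = `|a| + `|b| + (`|partial_x u z| * (`|a| + `|b|)
      + `|partial_y u z| * (`|a| + `|b|)).
    by rewrite /M -addrA [LHS]mulrDl mul1r [X in _ + X = _]mulrDl.
  rewrite lerD2l; exact: (lerD ma mb).
move=> /le_trans; apply; rewrite -ler_pdivlMl//.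
have -> : M^-1 * e = e / (M *+ 2) + e / (M *+ 2).
  rewrite -mulr2n -mulr_natr; field; exact: lt0r_neq0.
by rewrite lerD// ltW.
Qed.

Lemma C1_is_derive_line D u (z h : R * R) (t : R) : open D -> C1_on D u ->
  D (z + t *: h) ->
  is_derive t 1 (fun s => u (z + s *: h))
    (partial_x u (z + t *: h) * h.1 + partial_y u (z + t *: h) * h.2).
Proof.
move=> oD Cu Dz; apply: is_derive_eps => e e0.
(* The summand 1 keeps [N] positive when [h = 0]. *)
pose N := 1 + `|h.1| + `|h.2|.
have N0 : 0 < N by rewrite /N -addrA ltr_wpDr// addr_ge0.
have N1 : `|h.1| <= N by rewrite /N addrAC lerDr addr_ge0.
have N2 : `|h.2| <= N by rewrite /N lerDr addr_ge0.
have [d d0 H] := C1_frechet oD Cu Dz (divr_gt0 e0 N0).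
exists (d / N); first exact: divr_gt0.
move=> s st; rewrite ltr_pdivlMr// in st.
have E1 : (z + s *: h).1 - (z + t *: h).1 = (s - t) * h.1.
  by rewrite /= opprD addrACA subrr add0r mulrBl.
have E2 : (z + s *: h).2 - (z + t *: h).2 = (s - t) * h.2.
  by rewrite /= opprD addrACA subrr add0r mulrBl.
have := H (z + s *: h); rewrite E1 E2 !normrM.
have k1 : `|s - t| * `|h.1| < d by apply: le_lt_trans st; rewrite ler_wpM2l.
have k2 : `|s - t| * `|h.2| < d by apply: le_lt_trans st; rewrite ler_wpM2l.
move=> /(_ k1 k2) h1.
rewrite [X in `| _ - X|](_ : _ = partial_x u (z + t *: h) * ((s - t) * h.1) +
   partial_y u (z + t *: h) * ((s - t) * h.2)); last by ring.
apply: (le_trans h1); rewrite -mulrDr mulrCA mulrC ler_wpM2r//.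
rewrite mulrAC ler_pdivrMr// ler_wpM2l ?(ltW e0)//.
by rewrite /N -addrA lerDr.
Qed.

Lemma C1_dist_le D u (z z' : R * R) L : open D -> C1_on D u ->
  (forall t, 0 <= t <= 1 -> let y := z + t *: (z' - z) in
     [/\ D y, `|partial_x u y| <= L & `|partial_y u y| <= L]) ->
  `|u z' - u z| <= L * (`|z'.1 - z.1| + `|z'.2 - z.2|).
Proof.
move=> oD Cu H.
have := @derive_dist_le R (fun s => u (z + s *: (z' - z)))
  (fun t => partial_x u (z + t *: (z' - z)) * (z' - z).1 +
    partial_y u (z + t *: (z' - z)) * (z' - z).2) 0 1 0
  (L * (`|z'.1 - z.1| + `|z'.2 - z.2|)).
have -> : z + 1 *: (z' - z) = z' by rewrite scale1r addrC subrK.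
rewrite scale0r addr0 mul0r !subr0 normr1 mulr1; apply.
move=> t; rewrite (min_idPl ler01) (max_idPr ler01) => /H[Dt px py]; split.
  exact: (C1_is_derive_line oD Cu Dt).
rewrite subr0 [leRHS]mulrDr; apply: (le_trans (ler_normD _ _)).
by apply: lerD; rewrite normrM; exact: ler_wpM2r.
Qed.

End Calculus2.

(** * The Cauchy-Riemann equations from complex differentiability *)

Section CauchyRiemann.
Variable R : realType.
Implicit Types (u v : R * R -> R) (D : set (R * R)).

(** Norm and order of [R[i]] take values in [R[i]]; this is the translation into real terms. The
    derivative is [a + i b], and [(a s - b t, a t + b s)] is its product with the increment
    [s + i t]. *)
Lemma complex_diff_eps (f : R[i]^o -> R[i]^o) (z : R[i]) : derivable f z 1 ->
  exists a b : R, forall e, 0 < e -> exists2 d, 0 < d & forall s t : R,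
    modulus (s, t) < d ->
    modulus (complex.Re (f (Complex s t + z) - f z) - (a * s - b * t),
             complex.Im (f (Complex s t + z) - f z) - (a * t + b * s))
      <= e * modulus (s, t).
Proof.
case/cvg_ex => -[a b] /cvgrPdist_lt L; exists a, b => e e0.
have e0' : 0 < (e%:C)%C :> R[i] by rewrite ltcR.
case/nbhs_ballP: (L _ e0') => -[d d'] /= dd H.
(* A positive element of [R[i]] is real. *)
have [d0 d'0] : 0 < d /\ d' = 0.
  by move: dd; rewrite ltcE/= => /andP[/eqP].
exists d => // s t std; rewrite {}d'0 in dd H.
have normE (w : R[i]) : `|w| = (modulus (complex.Re w, complex.Im w))%:C%C.
  exact: normc_def.
have [st0|st0] := eqVneq (Complex s t) 0.
  rewrite st0 add0r subrr/=; case: st0 => -> ->.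
  by rewrite !mulr0 !subrr addr0 subrr; rewrite /modulus/= expr0n/= addr0 sqrtr0 mulr0.
have := H (Complex s t); rewrite -ball_normE/= sub0r normrN normE/=.
rewrite ltcR => /(_ std st0) h.
set W := f (Complex s t + z) - f z.
have E : W - Complex a b * Complex s t =
    - (Complex s t * (Complex a b - (Complex s t)^-1 * W)).
  by rewrite mulrBr mulVKf// opprB mulrC.
have -> : (complex.Re W - (a * s - b * t), complex.Im W - (a * t + b * s)) =
   (complex.Re (W - Complex a b * Complex s t), complex.Im (W - Complex a b * Complex s t)).
  by case: W {E}.
rewrite -lecR -normE E normrN normrM rmorphM/= mulrC -(normE (Complex s t)).
rewrite ler_wpM2r// ltW//.
move: h; rewrite [(Complex s t)%:A](mulr1 (Complex s t)); exact.
Qed.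

(** Increments along the two axes in [complex_diff_eps] express all four partial derivatives through
    [a] and [b]. *)
Lemma cauchy_riemann D u v (x y : R) : C1_on D u -> C1_on D v ->
  analytic_on D (fun z =>
        Complex (u (complex.Re z, complex.Im z))
                (v (complex.Re z, complex.Im z))) ->
  D (x, y) ->
  partial_x u (x, y) = partial_y v (x, y) /\
  partial_y u (x, y) = - partial_x v (x, y).
Proof.
move=> Cu Cv Aw Dxy; have [ux uy _ _] := Cu _ Dxy; have [vx vy _ _] := Cv _ Dxy.
have [a [b H]] := complex_diff_eps (Aw (Complex x y) Dxy).
have sub1 e d : 0 < e -> (forall s t : R, modulus (s, t) < d ->
    modulus (u (s + x, t + y) - u (x, y) - (a * s - b * t),
             v (s + x, t + y) - v (x, y) - (a * t + b * s)) <= e * modulus (s, t)) ->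
    forall s t : R, modulus (s, t) < d ->
    `|u (s + x, t + y) - u (x, y) - (a * s - b * t)| <= e * modulus (s, t) /\
    `|v (s + x, t + y) - v (x, y) - (a * t + b * s)| <= e * modulus (s, t).
  move=> e0 h s t std; have := h s t std => h1; split.
    by apply: le_trans h1; exact: (abs1_le_modulus (_, _)).
  by apply: le_trans h1; exact: (abs2_le_modulus (_, _)).
have m1 (s : R) : modulus (s, 0) = `|s|.
  by rewrite /modulus/= expr0n/= addr0 sqrtr_sqr.
have m2 (s : R) : modulus (0, s) = `|s|.
  by rewrite /modulus/= expr0n/= add0r sqrtr_sqr.
have Dux : is_derive x 1 (fun t => u (t, y)) a.
  apply: is_derive_eps => e e0; have [d d0 /(sub1 _ _ e0) h] := H e e0.
  exists d => // t td; have [|h1 _] := h (t - x) 0; first by rewrite m1.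
  by move: h1; rewrite m1 subrK add0r mulr0 subr0.
have Dvx : is_derive x 1 (fun t => v (t, y)) b.
  apply: is_derive_eps => e e0; have [d d0 /(sub1 _ _ e0) h] := H e e0.
  exists d => // t td; have [|_ h1] := h (t - x) 0; first by rewrite m1.
  by move: h1; rewrite m1 subrK add0r mulr0 add0r.
have Duy : is_derive y 1 (fun t => u (x, t)) (- b).
  apply: is_derive_eps => e e0; have [d d0 /(sub1 _ _ e0) h] := H e e0.
  exists d => // t td; have [|h1 _] := h 0 (t - y); first by rewrite m2.
  by move: h1; rewrite m2 subrK add0r mulr0 sub0r mulNr.
have Dvy : is_derive y 1 (fun t => v (x, t)) a.
  apply: is_derive_eps => e e0; have [d d0 /(sub1 _ _ e0) h] := H e e0.
  exists d => // t td; have [|_ h1] := h 0 (t - y); first by rewrite m2.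
  by move: h1; rewrite m2 subrK add0r mulr0 addr0.
have [_ <-] := is_derive_slice1 ux; have [_ <-] := is_derive_slice2 uy.
have [_ <-] := is_derive_slice1 vx; have [_ <-] := is_derive_slice2 vy.
by have [_ ->] := Dux; have [_ ->] := Duy; have [_ ->] := Dvx; have [_ ->] := Dvy.
Qed.

End CauchyRiemann.

(** * The mean value property *)

Section Rectangle.
Variable R : realType.
Implicit Types (f g u v : R * R -> R) (D : set (R * R)).

Lemma FTC_segment (F f : R -> R) (a b : R) : a < b ->
  (forall t, a <= t <= b -> is_derive t 1 F (f t)) ->
  (forall t, a <= t <= b -> {for t, continuous f}) ->
  (\int[@lebesgue_measure R]_(t in `[a, b]) (f t)%:E)%E = (F b - F a)%:E.
Proof.
move=> ab dF cf; rewrite EFinB; apply: continuous_FTC2 => //.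
- apply: continuous_in_subspaceT => t /set_mem/= /itvP tab.
  by apply: cf; rewrite !tab.
- split.
  + by move=> t /itvP tab; have [|+ _] := dF t; first by rewrite !tab.
  + apply: cvg_at_right_filter.
    by apply: (is_derive_continuous (dF a _)); rewrite lexx (ltW ab).
  + apply: cvg_at_left_filter.
    by apply: (is_derive_continuous (dF b _)); rewrite lexx (ltW ab).
- move=> t /itvP tab; have [|_ <-] := dF t; first by rewrite !tab.
  by rewrite derive1E.
Qed.

Definition rect (a b c d : R) : set (measurableTypeR R * measurableTypeR R) :=
  `[a, b] `*` `[c, d].

Lemma rectP (a b c d : R) z :
  rect a b c d z <-> a <= z.1 <= b /\ c <= z.2 <= d.
Proof. by rewrite /rect/= !in_itv. Qed.

Lemma measurable_rect a b c d : measurable (rect a b c d).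
Proof. exact: measurable_box. Qed.

Lemma area_rect_lty (a b c d : R) : (area R (rect a b c d) < +oo)%E.
Proof.
have -> : area R (rect a b c d) =
    (lebesgue_measure `[a, b]%classic * lebesgue_measure `[c, d]%classic)%E.
  exact: product_measure1E.
rewrite lte_mul_pinfty//; last by rewrite lebesgue_measure_itv/=; case: ifP; rewrite -?EFinB ltry.
by rewrite lebesgue_measure_itv/=; case: ifP.
Qed.

Lemma compact_rect a b c d : compact (rect a b c d : set (R * R)).
Proof. by apply: compact_setX; exact: segment_compact. Qed.

Lemma compact_continuous_bounded D (K : set (R * R)) f : {in D, continuous f} ->
  K `<=` D -> compact K -> exists2 M, 0 <= M & forall z, K z -> `|f z| <= M.
Proof.
move=> cf KD cK.
have cfK : {within K, continuous f}.
  by apply: continuous_in_subspaceT => z /set_mem/KD/mem_set; exact: cf.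
have /compact_bounded[M [_ mrt]] := continuous_compact cfK cK.
exists (`|M| + 1) => [|z Kz]; first by rewrite addr_ge0.
by apply: mrt; [exact: ltr_pwDr (ler_norm _)|exists z].
Qed.

Lemma compact_continuous_integrable D (K : set (measurableTypeR R * measurableTypeR R)) f :
  open D -> {in D, continuous f} ->
  K `<=` D -> compact (K : set (R * R)) -> measurable K -> (area R K < +oo)%E ->
  (area R).-integrable K (EFin \o f).
Proof.
move=> oD cf KD cK mK fK; apply: measurable_bounded_integrable => //.
  apply: measurable_funS (continuous_on_measurable oD cf) => //.
  exact: measurable_open_plane.
have [M _ HM] := compact_continuous_bounded cf KD cK.
exists M; split; first exact: num_real.
by move=> x Mx z Kz; apply: (le_trans (HM z Kz)); exact: ltW.
Qed.

Lemma rect_integrable D a b c d f : open D -> {in D, continuous f} ->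
  rect a b c d `<=` D -> (area R).-integrable (rect a b c d) (EFin \o f).
Proof.
move=> oD cf SD; apply: (compact_continuous_integrable oD) => //.
- exact: compact_rect.
- exact: measurable_rect.
- exact: area_rect_lty.
Qed.

Lemma continuous_slice1 f (x y : R) : {for (x, y), continuous f} ->
  {for x, continuous (fun t => f (t, y))}.
Proof.
move=> cf A /cf [[P Q] /= [Px Qy] PQ]; apply: filterS Px => t Pt.
by apply: PQ; split => //=; exact: nbhs_singleton.
Qed.

Lemma continuous_slice2 f (x y : R) : {for (x, y), continuous f} ->
  {for y, continuous (fun t => f (x, t))}.
Proof.
move=> cf A /cf [[P Q] /= [Px Qy] PQ]; apply: filterS Qy => t Pt.
by apply: PQ; split => //=; exact: nbhs_singleton.
Qed.

(** One half of the divergence theorem on a rectangle: Fubini puts the integral in [x] inside, where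
    the fundamental theorem of calculus leaves only the boundary values of [P], which cancel. *)
Lemma integral_rect_dx D a b c d (P p : R * R -> R) : open D -> a < b ->
  rect a b c d `<=` D -> {in D, continuous p} ->
  (forall x y, a <= x <= b -> c <= y <= d ->
     is_derive x 1 (fun t => P (t, y)) (p (x, y))) ->
  (forall y, c <= y <= d -> P (a, y) = P (b, y)) ->
  Rintegral (area R) (rect a b c d) p = 0.
Proof.
move=> oD ab SD cp dP P0.
have ip := rect_integrable oD cp SD.
have ip' : (area R).-integrable setT ((EFin \o p) \_ (rect a b c d)).
  by apply/(integrable_mkcond _ (measurable_rect a b c d)).
rewrite /Rintegral integral_mkcond /area -(integral21_prod_meas1 ip').
rewrite (_ : (fun y => _) = cst 0%E) ?integral0//.
apply/funext => y /=; rewrite /fubini_G/=.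
have [cyd|cyd] := boolP (c <= y <= d); last first.
  rewrite (_ : (fun x => _) = cst 0%E) ?integral0//.
  apply/funext => x; rewrite patchE memNset// => /rectP[_ /=].
  by apply/negP.
rewrite (_ : (fun x => _) = ((fun x => (p (x, y))%:E) \_ `[a, b])).
  rewrite -integral_mkcond.
  have h1 t : a <= t <= b -> is_derive t 1 (fun x => P (x, y)) (p (t, y)).
    by move=> tab; exact: dP.
  have h2 t : a <= t <= b -> {for t, continuous (fun x => p (x, y))}.
    move=> tab; apply: continuous_slice1; apply: cp; apply/mem_set/SD.
    by apply/rectP.
  by rewrite (FTC_segment ab h1 h2) P0// subrr.
apply/funext => x; rewrite !patchE; congr (if _ then _ else _).
by apply/idP/idP => /set_mem H; apply/mem_set;
  [have/rectP[] := H|apply/rectP; split]; rewrite /= ?in_itv.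
Qed.

Lemma integral_rect_dy D a b c d (P p : R * R -> R) : open D -> c < d ->
  rect a b c d `<=` D -> {in D, continuous p} ->
  (forall x y, a <= x <= b -> c <= y <= d ->
     is_derive y 1 (fun t => P (x, t)) (p (x, y))) ->
  (forall x, a <= x <= b -> P (x, c) = P (x, d)) ->
  Rintegral (area R) (rect a b c d) p = 0.
Proof.
move=> oD cd SD cp dP P0.
have ip := rect_integrable oD cp SD.
have ip' : (area R).-integrable setT ((EFin \o p) \_ (rect a b c d)).
  by apply/(integrable_mkcond _ (measurable_rect a b c d)).
rewrite /Rintegral integral_mkcond /area -(integral12_prod_meas1 ip').
rewrite (_ : (fun y => _) = cst 0%E) ?integral0//.
apply/funext => x /=; rewrite /fubini_F/=.
have [axb|axb] := boolP (a <= x <= b); last first.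
  rewrite (_ : (fun x => _) = cst 0%E) ?integral0//.
  apply/funext => y; rewrite patchE memNset// => /rectP[/= + _].
  by apply/negP.
rewrite (_ : (fun y => _) = ((fun y => (p (x, y))%:E) \_ `[c, d])).
  rewrite -integral_mkcond.
  have h1 t : c <= t <= d -> is_derive t 1 (fun y => P (x, y)) (p (x, t)).
    by move=> tcd; exact: dP.
  have h2 t : c <= t <= d -> {for t, continuous (fun y => p (x, y))}.
    move=> tcd; apply: continuous_slice2; apply: cp; apply/mem_set/SD.
    by apply/rectP.
  by rewrite (FTC_segment cd h1 h2) P0// subrr.
apply/funext => y; rewrite !patchE; congr (if _ then _ else _).
by apply/idP/idP => /set_mem H; apply/mem_set;
  [have/rectP[] := H|apply/rectP; split]; rewrite /= ?in_itv.
Qed.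

End Rectangle.

(** * The kernel and its divergence identity *)

Section MeanValue.
Variable R : realType.
Implicit Types (f g u v : R * R -> R) (D : set (R * R)) (c z : R * R).

(** Analyticity of [u + i v] in real form, so that calculus on horizontal and vertical slices
    applies. *)
Definition cr_on D u v := [/\ C1_on D u, C1_on D v &
  forall z, D z -> partial_x u z = partial_y v z /\ partial_y u z = - partial_x v z].

(** The parameter [s] is the squared radius: inside the support the kernel is affine in [s], so that
    its square has [s]-derivative twice the kernel. Only the square is C^1 across the circle. *)
Definition kernel (s : R) c z : R :=
  Num.max 0 (s - ((z.1 - c.1) ^+ 2 + (z.2 - c.2) ^+ 2)).

Lemma kernel_ge0 s c z : 0 <= kernel s c z.
Proof. by rewrite /kernel le_max lexx. Qed.

Lemma kernel_le s c z : 0 <= s -> kernel s c z <= s.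
Proof.
by move=> s0; rewrite /kernel ge_max s0/= gerBl addr_ge0// sqr_ge0.
Qed.

Lemma kernel_mul s c z :
  kernel s c z * (s - ((z.1 - c.1) ^+ 2 + (z.2 - c.2) ^+ 2)) = kernel s c z ^+ 2.
Proof. by rewrite /kernel; case: leP => _; rewrite ?mul0r ?expr0n ?expr2. Qed.

Lemma kernel_out s c z : s <= (z.1 - c.1) ^+ 2 + (z.2 - c.2) ^+ 2 ->
  kernel s c z = 0.
Proof. by move=> h; rewrite /kernel; apply/max_idPl; rewrite subr_le0. Qed.

(** The squared positive part has a 2-Lipschitz derivative, hence a quadratic Taylor remainder. As
    the bound is uniform, it serves both for derivatives at a point and for differentiating under
    the integral sign. *)
Lemma max0_sqr_taylor (a b : R) :
  `|Num.max 0 b ^+ 2 - Num.max 0 a ^+ 2 - 2 * Num.max 0 a * (b - a)| <= (b - a) ^+ 2.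
Proof.
have [a2 b2 ab2] : [/\ 0 <= a ^+ 2, 0 <= b ^+ 2 & 0 <= (b - a) ^+ 2].
  by rewrite !sqr_ge0.
case: (leP 0 a) => a0; case: (leP 0 b) => b0; rewrite ler_norml;
  rewrite ?expr0n/= ?mulr0 ?mul0r ?subr0 ?sub0r.
- by apply/andP; split; lra.
- have ab : a * b <= 0 by rewrite mulr_ge0_le0// ltW.
  by apply/andP; split; lra.
- have ab : a * b <= 0 by rewrite mulr_le0_ge0// ltW.
  by apply/andP; split; lra.
- by apply/andP; split; lra.
Qed.

Lemma max0_lip (a b : R) : `|Num.max 0 b - Num.max 0 a| <= `|b - a|.
Proof.
case: (leP 0 a) => a0; case: (leP 0 b) => b0; rewrite ?subrr ?normr0//.
  by rewrite sub0r normrN (ger0_norm a0) ltr0_norm; lra.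
by rewrite subr0 (ger0_norm b0) ger0_norm; lra.
Qed.

Lemma is_derive_max0_sqr (a : R) :
  is_derive a 1 (fun t => Num.max 0 t ^+ 2) (2 * Num.max 0 a).
Proof.
apply: is_derive_eps => e e0; exists e => // y ya.
apply: (le_trans (max0_sqr_taylor a y)); rewrite -real_normK ?num_real// expr2.
by rewrite ler_wpM2r// ltW.
Qed.

Lemma continuous_kernel s c : continuous (kernel s c).
Proof.
move=> z; apply: (@continuous_comp _ _ _
  (fun z => s - ((z.1 - c.1) ^+ 2 + (z.2 - c.2) ^+ 2)) (fun t => Num.max 0 t)).
  have c1 : (fst z' @[z' --> z] --> z.1) by exact: cvg_fst.
  have c2 : (snd z' @[z' --> z] --> z.2) by exact: cvg_snd.
  apply: cvgB; first exact: cvg_cst.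
  by apply: cvgD; rewrite expr2; apply: cvgM; apply: cvgB => //; exact: cvg_cst.
apply/cvgrPdist_le => /= e e0; have := nbhsx_ballx (s - ((z.1 - c.1) ^+ 2 + (z.2 - c.2) ^+ 2)) _ e0.
by apply: filterS => t; rewrite -ball_normE/= => /ltW; apply: le_trans; exact: max0_lip.
Qed.

Lemma is_derive_kernel1 s c (x y : R) :
  is_derive x 1 (fun t => kernel s c (t, y) ^+ 2)
    (- 4 * (x - c.1) * kernel s c (x, y)).
Proof.
pose h (t : R) := s - ((t - c.1) ^+ 2 + (y - c.2) ^+ 2).
have dh : is_derive x 1 h (- 2 * (x - c.1)).
  rewrite /h; apply: is_derive_eps => e e0; exists e => // t te.
  have -> : s - ((t - c.1) ^+ 2 + (y - c.2) ^+ 2) -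
   (s - ((x - c.1) ^+ 2 + (y - c.2) ^+ 2)) - - 2 * (x - c.1) * (t - x) = - ((t - x) ^+ 2).
    by ring.
  by rewrite normrN normrX expr2 ler_wpM2r// ltW.
have := @is_derive1_comp R (fun t => Num.max 0 t ^+ 2) h x _ _ (is_derive_max0_sqr (h x)) dh.
by congr is_derive; rewrite /kernel/=; rewrite /h; ring.
Qed.

Lemma is_derive_kernel2 s c (x y : R) :
  is_derive y 1 (fun t => kernel s c (x, t) ^+ 2)
    (- 4 * (y - c.2) * kernel s c (x, y)).
Proof.
have := is_derive_kernel1 s (c.2, c.1) y x.
have E t : kernel s (c.2, c.1) (t, x) = kernel s c (x, t).
  by rewrite /kernel /= (addrC ((t - _) ^+ 2)).
by rewrite E; under eq_fun do rewrite E.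
Qed.

Lemma is_derive_mul (f g : R -> R) (x df dg : R) :
  is_derive x 1 f df -> is_derive x 1 g dg ->
  is_derive x 1 (fun t => f t * g t) (f x * dg + g x * df).
Proof. by move=> hf hg; have := is_deriveM hf hg; exact. Qed.

Lemma is_derive_add (f g : R -> R) (x df dg : R) :
  is_derive x 1 f df -> is_derive x 1 g dg ->
  is_derive x 1 (fun t => f t + g t) (df + dg).
Proof. by move=> hf hg; have := is_deriveD hf hg; exact. Qed.

Lemma is_derive_sub (f g : R -> R) (x df dg : R) :
  is_derive x 1 f df -> is_derive x 1 g dg ->
  is_derive x 1 (fun t => f t - g t) (df - dg).
Proof. by move=> hf hg; have := is_deriveB hf hg; exact. Qed.

Lemma is_derive_sub_cst (x k : R) : is_derive x 1 (fun t => t - k) 1.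
Proof.
have := is_derive_sub (is_derive_id x 1) (is_derive_cst k x 1).
by rewrite subr0; exact.
Qed.

Lemma cr_continuous D u v : open D -> cr_on D u v ->
  {in D, continuous u} /\ {in D, continuous v}.
Proof.
move=> oD [Cu Cv _]; split=> z /set_mem Dz; [exact: C1_continuous Cu Dz|].
exact: C1_continuous Cv Dz.
Qed.

Lemma Rintegral_rect_lin D a b a' b' f g (k l : R) : open D ->
  rect a b a' b' `<=` D -> {in D, continuous f} -> {in D, continuous g} ->
  Rintegral (area R) (rect a b a' b') (fun z => k * f z + l * g z) =
  k * Rintegral (area R) (rect a b a' b') f + l * Rintegral (area R) (rect a b a' b') g.
Proof.
move=> oD SD cf cg.
have mS := @measurable_rect R a b a' b'.
have jf := rect_integrable oD cf SD; have jg := rect_integrable oD cg SD.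
rewrite RintegralD//; first by rewrite !RintegralZl.
- by have := integrableZl mS k jf.
- by have := integrableZl mS l jg.
Qed.

Lemma continuous_in_mul D f g : {in D, continuous f} -> {in D, continuous g} ->
  {in D, continuous (fun z => f z * g z)}.
Proof. by move=> cf cg z Dz; apply: cvgM; [exact: cf|exact: cg]. Qed.

Lemma continuous_in_add D f g : {in D, continuous f} -> {in D, continuous g} ->
  {in D, continuous (fun z => f z + g z)}.
Proof. by move=> cf cg z Dz; apply: cvgD; [exact: cf|exact: cg]. Qed.

Lemma continuous_in_sub D f g : {in D, continuous f} -> {in D, continuous g} ->
  {in D, continuous (fun z => f z - g z)}.
Proof. by move=> cf cg z Dz; apply: cvgB; [exact: cf|exact: cg]. Qed.

Lemma continuous_in_cst D (k : R) : {in D, continuous (fun _ : R * R => k)}.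
Proof. by move=> z _; exact: cvg_cst. Qed.

Lemma continuous_in_kernel D s c : {in D, continuous (kernel s c)}.
Proof. by move=> z _; exact: continuous_kernel. Qed.

Lemma continuous_in_fst D (k : R) : {in D, continuous (fun z : R * R => z.1 - k)}.
Proof. by move=> z _; apply: cvgB; [exact: cvg_fst|exact: cvg_cst]. Qed.

Lemma continuous_in_snd D (k : R) : {in D, continuous (fun z : R * R => z.2 - k)}.
Proof. by move=> z _; apply: cvgB; [exact: cvg_snd|exact: cvg_cst]. Qed.

(* Divergence theorem for the field [((u a + v b) k^2, (u b - v a) k^2)],
   where [(a, b) = z - c]: by the Cauchy-Riemann equations its divergence is
   [6 u k^2 - 4 s u k]. *)
Lemma kernel_green D a b a' b' u v c (r s : R) : open D ->
  rect a b a' b' `<=` D -> cr_on D u v -> 0 < r -> s <= r ^+ 2 ->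
  a <= c.1 - r -> c.1 + r <= b -> a' <= c.2 - r -> c.2 + r <= b' ->
  3 * Rintegral (area R) (rect a b a' b') (fun z => kernel s c z ^+ 2 * u z) =
  2 * s * Rintegral (area R) (rect a b a' b') (fun z => kernel s c z * u z).
Proof.
move=> oD SD uv r0 sr ha hb ha' hb'.
have [cu cv] := cr_continuous oD uv; have [Cu Cv CR] := uv.
have cx1 : {in D, continuous (partial_x u)}.
  by move=> z /set_mem Dz; have [_ _ h _] := Cu _ Dz; exact: h.
have cy1 : {in D, continuous (partial_y u)}.
  by move=> z /set_mem Dz; have [_ _ _ h] := Cu _ Dz; exact: h.
have cx2 : {in D, continuous (partial_x v)}.
  by move=> z /set_mem Dz; have [_ _ h _] := Cv _ Dz; exact: h.
have cy2 : {in D, continuous (partial_y v)}.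
  by move=> z /set_mem Dz; have [_ _ _ h] := Cv _ Dz; exact: h.
have ck := @continuous_in_kernel D s c.
have ck2 : {in D, continuous (fun z => kernel s c z ^+ 2)}.
  by have := continuous_in_mul ck ck; exact.
have c1 := @continuous_in_fst D c.1; have c2 := @continuous_in_snd D c.2.
(* On each side of the rectangle one coordinate differs from that of [c] by at least [r], so the
   field vanishes there and both boundary terms drop out. *)
have out z : (z.1 - c.1) ^+ 2 >= r ^+ 2 \/ (z.2 - c.2) ^+ 2 >= r ^+ 2 -> kernel s c z = 0.
  move=> h; apply: kernel_out; apply: (le_trans sr).
  by case: h => h; apply: (le_trans h); rewrite ?lerDl ?lerDr sqr_ge0.
pose P z := (u z * (z.1 - c.1) + v z * (z.2 - c.2)) * kernel s c z ^+ 2.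
pose Q z := (u z * (z.2 - c.2) - v z * (z.1 - c.1)) * kernel s c z ^+ 2.
pose px z := (u z * (z.1 - c.1) + v z * (z.2 - c.2)) * (- 4 * (z.1 - c.1) * kernel s c z)
  + (partial_x u z * (z.1 - c.1) + u z + partial_x v z * (z.2 - c.2)) * kernel s c z ^+ 2.
pose qy z := (u z * (z.2 - c.2) - v z * (z.1 - c.1)) * (- 4 * (z.2 - c.2) * kernel s c z)
  + (partial_y u z * (z.2 - c.2) + u z - partial_y v z * (z.1 - c.1)) * kernel s c z ^+ 2.
have cpx : {in D, continuous px}.
  apply: continuous_in_add; apply: continuous_in_mul => //.
  - by apply: continuous_in_add; exact: continuous_in_mul.
  - apply: continuous_in_mul => //; apply: continuous_in_mul => //; exact: continuous_in_cst.
  - apply: continuous_in_add; last exact: continuous_in_mul.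
    by apply: continuous_in_add => //; exact: continuous_in_mul.
have cqy : {in D, continuous qy}.
  apply: continuous_in_add; apply: continuous_in_mul => //.
  - by apply: continuous_in_sub; exact: continuous_in_mul.
  - apply: continuous_in_mul => //; apply: continuous_in_mul => //; exact: continuous_in_cst.
  - apply: continuous_in_sub; last exact: continuous_in_mul.
    by apply: continuous_in_add => //; exact: continuous_in_mul.
have ab : a < b by lra.
have ab' : a' < b' by lra.
have Ix : Rintegral (area R) (rect a b a' b') px = 0.
  apply: (integral_rect_dx (P := P) oD ab SD cpx).
    move=> x y xab yab; have Dxy : D (x, y) by apply: SD; apply/rectP.
    have [ux _ _ _] := Cu _ Dxy; have [vx _ _ _] := Cv _ Dxy.
    have dux := is_derive_slice1 ux; have dvx := is_derive_slice1 vx.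
    have dk := is_derive_kernel1 s c x y.
    have did := is_derive_sub_cst x c.1.
    have dcst : is_derive x 1 (fun=> y - c.2) 0 := is_derive_cst _ _ _.
    apply: (is_derive_eq (is_derive_mul (is_derive_add (is_derive_mul dux did)
      (is_derive_mul dvx dcst)) dk)).
    by rewrite /px /=; ring.
  by move=> y yab; rewrite /P !out ?expr0n/= ?mulr0//; left => /=; nra.
have Iy : Rintegral (area R) (rect a b a' b') qy = 0.
  apply: (integral_rect_dy (P := Q) oD ab' SD cqy).
    move=> x y xab yab; have Dxy : D (x, y) by apply: SD; apply/rectP.
    have [_ uy _ _] := Cu _ Dxy; have [_ vy _ _] := Cv _ Dxy.
    have duy := is_derive_slice2 uy; have dvy := is_derive_slice2 vy.
    have dk := is_derive_kernel2 s c x y.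
    have did := is_derive_sub_cst y c.2.
    have dcst : is_derive y 1 (fun=> x - c.1) 0 := is_derive_cst _ _ _.
    apply: (is_derive_eq (is_derive_mul (is_derive_sub (is_derive_mul duy did)
      (is_derive_mul dvy dcst)) dk)).
    by rewrite /qy /=; ring.
  by move=> y yab; rewrite /Q !out ?expr0n/= ?mulr0//; right => /=; nra.
have := Rintegral_rect_lin 1 1 oD SD cpx cqy; rewrite Ix Iy !mulr0 addr0.
have -> : Rintegral (area R) (rect a b a' b') (fun z => 1 * px z + 1 * qy z) =
  Rintegral (area R) (rect a b a' b')
   (fun z => 6 * (kernel s c z ^+ 2 * u z) + (- (4 * s)) * (kernel s c z * u z)).
  (* The partial derivatives cancel by Cauchy-Riemann; the remaining [|z - c|^2 k] equals
     [s k - k^2]. *)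
  apply: eq_Rintegral => z /set_mem/SD Dz; have [e1 e2] := CR _ Dz.
  rewrite !mul1r /px /qy e1 e2.
  have := kernel_mul s c z; set k := kernel s c z => kk.
  have k2 : k * ((z.1 - c.1) ^+ 2 + (z.2 - c.2) ^+ 2) = s * k - k ^+ 2.
    by rewrite -kk; ring.
  transitivity (2 * u z * k ^+ 2 - 4 * u z * (k * ((z.1 - c.1) ^+ 2 + (z.2 - c.2) ^+ 2))).
    by ring.
  by rewrite k2; ring.
rewrite (Rintegral_rect_lin 6 (- (4 * s)) oD SD)//.
- by lra.
- exact: continuous_in_mul.
- exact: continuous_in_mul.
Qed.

End MeanValue.

Section MeanValue2.
Variable R : realType.
Implicit Types (f g u v : R * R -> R) (D : set (R * R)) (c z : R * R).

Lemma le_Rintegral_rect D a b a' b' f g : open D ->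
  rect a b a' b' `<=` D -> {in D, continuous f} -> {in D, continuous g} ->
  (forall z, rect a b a' b' z -> f z <= g z) ->
  Rintegral (area R) (rect a b a' b') f <= Rintegral (area R) (rect a b a' b') g.
Proof.
move=> oD SD cf cg fg; apply: le_Rintegral => //.
- exact: measurable_rect.
- exact: rect_integrable cf SD.
- exact: rect_integrable cg SD.
Qed.

Lemma continuous_in_norm D f : {in D, continuous f} ->
  {in D, continuous (fun z => `|f z|)}.
Proof. by move=> cf z Dz; apply: cvg_norm; exact: cf. Qed.

Lemma continuous_in_lin D f g (k l : R) : {in D, continuous f} ->
  {in D, continuous g} -> {in D, continuous (fun z => k * f z + l * g z)}.
Proof.
move=> cf cg; have ck := @continuous_in_cst R D k; have cl := @continuous_in_cst R D l.
exact: (continuous_in_add (continuous_in_mul ck cf) (continuous_in_mul cl cg)).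
Qed.

Lemma continuous_in_kernel2 D s c : {in D, continuous (fun z => kernel s c z ^+ 2)}.
Proof.
have ck := @continuous_in_kernel R D s c.
by have := continuous_in_mul ck ck; exact.
Qed.

Lemma norm_Rintegral_rect D a b a' b' f g : open D ->
  rect a b a' b' `<=` D -> {in D, continuous f} -> {in D, continuous g} ->
  (forall z, rect a b a' b' z -> `|f z| <= g z) ->
  `|Rintegral (area R) (rect a b a' b') f| <= Rintegral (area R) (rect a b a' b') g.
Proof.
move=> oD SD cf cg fg; apply: (@le_trans _ _
    (Rintegral (area R) (rect a b a' b') (fun z => `|f z|))).
  apply: le_normr_Rintegral; first exact: measurable_rect.
  exact: rect_integrable cf SD.
by apply: (le_Rintegral_rect oD) => //; exact: continuous_in_norm.
Qed.

(** Differentiation under the integral sign without a convergence theorem: by [max0_sqr_taylor] the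
    remainder is at most [(t - s)^2] times the integral [M] of [|u|]. *)
Lemma is_derive_kernel_integral D a b a' b' u c (s : R) : open D ->
  rect a b a' b' `<=` D -> {in D, continuous u} ->
  is_derive s 1
    (fun s => Rintegral (area R) (rect a b a' b') (fun z => kernel s c z ^+ 2 * u z))
    (2 * Rintegral (area R) (rect a b a' b') (fun z => kernel s c z * u z)).
Proof.
move=> oD SD cu.
have nu := continuous_in_norm cu.
have ck s' : {in D, continuous (fun z => kernel s' c z * u z)}.
  by apply: continuous_in_mul => //; exact: continuous_in_kernel.
have ck2 s' : {in D, continuous (fun z => kernel s' c z ^+ 2 * u z)}.
  by apply: continuous_in_mul => //; exact: continuous_in_kernel2.
have lin := Rintegral_rect_lin.
pose M := Rintegral (area R) (rect a b a' b') (fun z => `|u z|).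
have M0 : 0 <= M by apply: Rintegral_ge0.
apply: is_derive_eps => e e0; exists (e / (M + 1)); first by rewrite divr_gt0// ltr_wpDl.
move=> t ts.
have -> : Rintegral (area R) (rect a b a' b') (fun z => kernel t c z ^+ 2 * u z) -
   Rintegral (area R) (rect a b a' b') (fun z => kernel s c z ^+ 2 * u z) -
   2 * Rintegral (area R) (rect a b a' b') (fun z => kernel s c z * u z) * (t - s) =
   Rintegral (area R) (rect a b a' b') (fun z => 1 * (1 * (kernel t c z ^+ 2 * u z) +
     (- 1) * (kernel s c z ^+ 2 * u z)) + (- 2 * (t - s)) * (kernel s c z * u z)).
  rewrite (lin _ D)// ?(lin _ D)//; first by ring.
  exact: (continuous_in_lin (ck2 t) (ck2 s)).
apply: (@le_trans _ _ (Rintegral (area R) (rect a b a' b')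
     (fun z => (t - s) ^+ 2 * `|u z| + 0 * `|u z|))).
  apply: (norm_Rintegral_rect oD SD).
  - exact: (continuous_in_lin
      (continuous_in_lin (ck2 t) (ck2 s)) (ck s)).
  - exact: (continuous_in_lin nu nu).
  move=> z _; rewrite mul0r addr0.
  have := max0_sqr_taylor (s - ((z.1 - c.1) ^+ 2 + (z.2 - c.2) ^+ 2))
    (t - ((z.1 - c.1) ^+ 2 + (z.2 - c.2) ^+ 2)).
  rewrite -/(kernel s c z) -/(kernel t c z) opprB addrA subrK => h.
  apply: le_trans (ler_wpM2r (normr_ge0 (u z)) h).
  rewrite -normrM le_eqVlt; apply/orP; left; apply/eqP; congr (`| _ |); ring.
rewrite (lin _ D)// mul0r addr0 -/M.
rewrite -real_normK ?num_real// expr2 mulrAC ler_wpM2r//.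
apply: (@le_trans _ _ (`|t - s| * (M + 1))); first by rewrite ler_wpM2l// lerDl.
by rewrite -ler_pdivlMr ?ltr_wpDl// ltW.
Qed.

(* Since [d/ds k^2 = 2 k], [kernel_green] is the equation [s J' = 3 J] for
   [J s], the integral of [k^2 u]. *)
Lemma kernel_integral_scale D a b a' b' u v c (r s : R) : open D ->
  rect a b a' b' `<=` D -> cr_on D u v -> 0 < r -> 0 < s <= r ^+ 2 ->
  a <= c.1 - r -> c.1 + r <= b -> a' <= c.2 - r -> c.2 + r <= b' ->
  Rintegral (area R) (rect a b a' b') (fun z => kernel s c z ^+ 2 * u z) / s ^+ 3 =
  Rintegral (area R) (rect a b a' b') (fun z => kernel (r ^+ 2) c z ^+ 2 * u z) / (r ^+ 2) ^+ 3.
Proof.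
move=> oD SD uv r0 /andP[s0 sr] ha hb ha' hb'; have [cu cv] := cr_continuous oD uv.
apply: (@eq_of_derive0 R (fun s => Rintegral (area R) (rect a b a' b')
   (fun z => kernel s c z ^+ 2 * u z) / s ^+ 3)) => // t /andP[st tr].
have t0 : 0 < t := lt_le_trans s0 st.
have dJ := @is_derive_kernel_integral D a b a' b' u c t oD SD cu.
have dX : is_derive t 1 (fun t : R => t ^+ 3) (3 * t ^+ 2).
  by have := is_deriveX 3 (is_derive_id t 1); rewrite /GRing.scale/= mulr1; exact.
have dV := @is_deriveV R (fun t : R => t ^+ 3) t _ 1 (lt0r_neq0 (exprn_gt0 3 t0)) dX.
apply: (is_derive_eq (is_derive_mul dJ dV)).
have := kernel_green oD SD uv r0 tr ha hb ha' hb'.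
set J := Rintegral _ _ _; set J1 := Rintegral _ _ _ => h.
have -> : J = 2 * t * J1 / 3 by rewrite -h; field.
by rewrite /GRing.scale/=; field; rewrite lt0r_neq0.
Qed.

(** With the pair [(1, 0)] the scaling law also covers the normalising integral of [k^2]. *)
Lemma cr_on_cst D : cr_on D (fun=> 1) (fun=> 0 : R).
Proof.
have dx k : partial_x (fun _ : R * R => k : R) = fun=> 0.
  by apply/funext => z; exact: derive_cst.
have dy k : partial_y (fun _ : R * R => k : R) = fun=> 0.
  by apply/funext => z; exact: derive_cst.
have C1 k : C1_on D (fun _ : R * R => k : R).
  by move=> z _; rewrite dx dy; split; try exact: derivable_cst; exact: cst_continuous.
by split => // z _; rewrite !dx !dy oppr0.
Qed.

(** On the concentric square of side [r] one has [|z - c|^2 <= s / 2], so [k^2 >= s^2 / 4], and the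
    area of that square is [r^2 = s]. *)
Lemma kernel_integral_ge D a b a' b' c (r s : R) : open D ->
  rect a b a' b' `<=` D -> 0 < r -> s = r ^+ 2 ->
  a <= c.1 - r -> c.1 + r <= b -> a' <= c.2 - r -> c.2 + r <= b' ->
  s ^+ 3 / 4 <= Rintegral (area R) (rect a b a' b') (fun z => kernel s c z ^+ 2 * 1).
Proof.
move=> oD SD r0 sE ha hb ha' hb'.
have r2 : 0 < r / 2 by rewrite divr_gt0.
pose S' := rect (c.1 - r / 2) (c.1 + r / 2) (c.2 - r / 2) (c.2 + r / 2).
have ck2 : {in D, continuous (fun z => kernel s c z ^+ 2 * 1)}.
  by apply: continuous_in_mul; [exact: continuous_in_kernel2|exact: continuous_in_cst].
have S'S : S' `<=` rect a b a' b'.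
  by move=> z /rectP[/andP[? ?] /andP[? ?]]; apply/rectP; split; apply/andP; split; lra.
have iS := rect_integrable oD ck2 SD.
rewrite -lee_fin /Rintegral fineK; last first.
  by apply: (integrable_fin_num (measurable_rect a b a' b')); exact: iS.
apply: (@le_trans _ _ (\int[area R]_(z in S') (s ^+ 2 / 4)%:E)%E).
  rewrite (integral_cst _ (measurable_rect _ _ _ _)) (area_box (a := c.1 - r / 2)); [|lra|lra].
  by rewrite -EFinM lee_fin sE le_eqVlt; apply/orP; left; apply/eqP; field.
apply: (@le_trans _ _ (\int[area R]_(z in S') (kernel s c z ^+ 2 * 1)%:E)%E).
  apply: ge0_le_integral => //.
  - exact: measurable_rect.
  - by move=> z _; rewrite lee_fin divr_ge0// exprn_ge0// sE sqr_ge0.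
  - apply/measurable_EFinP.
    apply: measurable_funS (continuous_on_measurable oD ck2); last exact: subset_trans SD.
    exact: measurable_open_plane.
  - move=> z /rectP[/andP[h1 h2] /andP[h3 h4]]; rewrite lee_fin mulr1.
    have -> : s ^+ 2 / 4 = (s / 2) ^+ 2 by field.
    rewrite ler_pXn2r ?nnegrE ?kernel_ge0 ?divr_ge0 ?sE ?sqr_ge0//.
    rewrite /kernel le_max; apply/orP; right.
    have k1 : (z.1 - c.1) ^+ 2 <= (r / 2) ^+ 2.
      rewrite -real_normK ?num_real// ler_pXn2r ?nnegrE ?(ltW r2)//.
      by rewrite ler_norml; apply/andP; split; lra.
    have k2 : (z.2 - c.2) ^+ 2 <= (r / 2) ^+ 2.
      rewrite -real_normK ?num_real// ler_pXn2r ?nnegrE ?(ltW r2)//.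
      by rewrite ler_norml; apply/andP; split; lra.
    by move: k1 k2; rewrite expr_div_n; lra.
apply: ge0_subset_integral => //.
- exact: measurable_rect.
- exact: measurable_rect.
- by have /integrableP[] := iS.
- by move=> z _; rewrite lee_fin mulr1 sqr_ge0.
Qed.

(* By [kernel_integral_scale] both sides are multiples of [s ^+ 3]; compare
   them as [s] tends to 0. *)
Lemma mean_value_kernel D a b a' b' u v c (r : R) : open D ->
  rect a b a' b' `<=` D -> cr_on D u v -> 0 < r ->
  a <= c.1 - r -> c.1 + r <= b -> a' <= c.2 - r -> c.2 + r <= b' ->
  Rintegral (area R) (rect a b a' b') (fun z => kernel (r ^+ 2) c z ^+ 2 * u z) =
  u c * Rintegral (area R) (rect a b a' b') (fun z => kernel (r ^+ 2) c z ^+ 2 * 1).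
Proof.
move=> oD SD uv r0 ha hb ha' hb'; have [cu cv] := cr_continuous oD uv.
have Dc : D c by apply: SD; apply/rectP; split; apply/andP; split; lra.
have k2 s := @continuous_in_kernel2 D s c.
have k2u s : {in D, continuous (fun z => kernel s c z ^+ 2 * u z)}.
  exact: continuous_in_mul.
have k21 s : {in D, continuous (fun z => kernel s c z ^+ 2 * 1)}.
  by apply: continuous_in_mul => //; exact: continuous_in_cst.
have rr : 0 < (r ^+ 2) ^+ 3 by rewrite !exprn_gt0.
pose J s := Rintegral (area R) (rect a b a' b') (fun z => kernel s c z ^+ 2 * u z).
pose I s := Rintegral (area R) (rect a b a' b') (fun z => kernel s c z ^+ 2 * 1).
rewrite -/(J (r ^+ 2)) -/(I (r ^+ 2)).
suff H e : 0 < e -> `|J (r ^+ 2) - u c * I (r ^+ 2)| <= e * I (r ^+ 2).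
  have I0 : 0 <= I (r ^+ 2) by apply: Rintegral_ge0 => z _; rewrite mulr1 sqr_ge0.
  apply/eqP; rewrite -subr_eq0 -normr_le0; apply/ler_addgt0Pl => e e0; rewrite addr0.
  have e1 : 0 < e / (I (r ^+ 2) + 1) by rewrite divr_gt0// ltr_wpDl.
  apply: (le_trans (H _ e1)); rewrite mulrAC ler_pdivrMr ?ltr_wpDl//.
  by rewrite ler_wpM2l ?(ltW e0)// lerDl.
move=> e0.
have := cu _ (mem_set Dc) => /cvgrPdist_le/(_ e e0)/nbhs_ballP[d /= d0 Hd].
(* The kernel of squared radius [t^2] lives where [u] is within [e] of [u c]. *)
pose t := Num.min (d / 2) r; have t0 : 0 < t by rewrite lt_min r0 divr_gt0.
have td : t < d by rewrite gt_min; apply/orP; left; lra.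
have tr : t ^+ 2 <= r ^+ 2.
  by rewrite ler_pXn2r ?nnegrE ?(ltW t0) ?(ltW r0)// ge_min lexx orbT.
have t2 : 0 < t ^+ 2 <= r ^+ 2 by rewrite exprn_gt0.
have hJ := kernel_integral_scale oD SD uv r0 t2 ha hb ha' hb'.
have hI := kernel_integral_scale oD SD (@cr_on_cst D) r0 t2 ha hb ha' hb'.
have tt : 0 < (t ^+ 2) ^+ 3 by rewrite !exprn_gt0.
have step : `|J (t ^+ 2) - u c * I (t ^+ 2)| <= e * I (t ^+ 2).
  have -> : J (t ^+ 2) - u c * I (t ^+ 2) = Rintegral (area R) (rect a b a' b')
     (fun z => 1 * (kernel (t ^+ 2) c z ^+ 2 * u z) + (- u c) * (kernel (t ^+ 2) c z ^+ 2 * 1)).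
    by rewrite (Rintegral_rect_lin _ _ oD)// mul1r mulNr.
  have -> : e * I (t ^+ 2) = Rintegral (area R) (rect a b a' b')
     (fun z => e * (kernel (t ^+ 2) c z ^+ 2 * 1) + 0 * (kernel (t ^+ 2) c z ^+ 2 * 1)).
    by rewrite (Rintegral_rect_lin _ _ oD)// mul0r addr0.
  apply: (norm_Rintegral_rect oD SD).
  - exact: (continuous_in_lin (k2u (t ^+ 2)) (k21 (t ^+ 2))).
  - exact: (continuous_in_lin (k21 (t ^+ 2)) (k21 (t ^+ 2))).
  move=> z _; rewrite mul0r addr0 !mulr1 mul1r.
  have -> : kernel (t ^+ 2) c z ^+ 2 * u z + - u c * kernel (t ^+ 2) c z ^+ 2 =
     kernel (t ^+ 2) c z ^+ 2 * (u z - u c) by ring.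
  rewrite normrM ger0_norm ?sqr_ge0// mulrC.
  have [zc|zc] := leP (t ^+ 2) ((z.1 - c.1) ^+ 2 + (z.2 - c.2) ^+ 2).
    by rewrite kernel_out// expr0n/= !mulr0.
  rewrite ler_wpM2r ?sqr_ge0// distrC; apply: Hd.
  have := zc; rewrite -(modulus_lt (z - c)) ?(ltW t0)// => h.
  rewrite -ball_normE /= distrC; apply: le_lt_trans (norm_le_modulus _) _.
  exact: lt_trans td.
(* Going back from [t] to [r] multiplies both integrals by the same factor, so the relative error
   [e] is preserved. *)
have EJ : J (r ^+ 2) = J (t ^+ 2) / (t ^+ 2) ^+ 3 * (r ^+ 2) ^+ 3.
  by rewrite hJ divfK// lt0r_neq0.
have EI : I (r ^+ 2) = I (t ^+ 2) / (t ^+ 2) ^+ 3 * (r ^+ 2) ^+ 3.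
  by rewrite hI divfK// lt0r_neq0.
rewrite EJ EI.
have q0 : 0 <= ((t ^+ 2) ^+ 3)^-1 * (r ^+ 2) ^+ 3.
  by rewrite mulr_ge0 ?invr_ge0 ?ltW.
have := ler_wpM2r q0 step; rewrite -{1}(ger0_norm q0) -normrM.
by congr (`| _ | <= _); ring.
Qed.

End MeanValue2.

(** * Mean value inequality and gradient bound *)

Section Estimates.
Variable R : realType.
Implicit Types (f g u v : R * R -> R) (D : set (R * R)) (c z : R * R).

Lemma measurable_open_disc c r :
  measurable (open_disc c r : set (measurableTypeR R * measurableTypeR R)).
Proof. by apply: measurable_open_plane; exact: open_open_disc. Qed.

Lemma open_disc_box c r z : open_disc c r z ->
  rect (c.1 - r) (c.1 + r) (c.2 - r) (c.2 + r) z.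
Proof.
move=> zr; apply/rectP.
have h1 := le_lt_trans (abs1_le_modulus (z - c)) zr.
have h2 := le_lt_trans (abs2_le_modulus (z - c)) zr.
move: h1 h2; rewrite !ltr_norml /= => /andP[? ?] /andP[? ?].
by split; apply/andP; split; lra.
Qed.

(** In [mean_value_kernel] the kernel is at most [r^2] and supported in the disc, while its
    normalising integral is at least [(r^2)^3 / 4]; dividing by [(r^2)^2] leaves [r^2 / 4]. *)
Lemma mean_value_ineq D u v c (r : R) : open D -> cr_on D u v -> 0 < r ->
  rect (c.1 - r) (c.1 + r) (c.2 - r) (c.2 + r) `<=` D ->
  ((r ^+ 2 / 4 * `|u c|)%:E <= \int[area R]_(z in open_disc c r) (`|u z|)%:E)%E.
Proof.
move=> oD uv r0 SD; have [cu cv] := cr_continuous oD uv.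
have nu := continuous_in_norm cu.
have r2 : 0 < r ^+ 2 by rewrite exprn_gt0.
have r4 : 0 < (r ^+ 2) ^+ 2 by rewrite exprn_gt0.
have k2 := @continuous_in_kernel2 R D (r ^+ 2) c.
have J := mean_value_kernel oD SD uv r0 (lexx _) (lexx _) (lexx _) (lexx _).
have I := kernel_integral_ge oD SD r0 erefl (lexx _) (lexx _) (lexx _) (lexx _).
set S := rect _ _ _ _ in SD J I; set I1 := Rintegral _ _ _ in I J.
have cku := continuous_in_mul k2 cu; have cknu := continuous_in_mul k2 nu.
have iS := rect_integrable oD cknu SD.
have h1 : (r ^+ 2) ^+ 3 / 4 * `|u c| <= Rintegral (area R) S
    (fun z => kernel (r ^+ 2) c z ^+ 2 * `|u z|).
  apply: (@le_trans _ _ (`|u c * I1|)).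
    by rewrite normrM mulrC ler_wpM2l// (le_trans I)// ler_norm.
  rewrite -J; apply: (norm_Rintegral_rect oD SD cku cknu) => z _.
  by rewrite normrM ger0_norm// sqr_ge0.
have h2 : (((r ^+ 2) ^+ 3 / 4 * `|u c|)%:E <=
    \int[area R]_(z in S) (kernel (r ^+ 2) c z ^+ 2 * `|u z|)%:E)%E.
  rewrite -lee_fin in h1; apply: (le_trans h1); rewrite /Rintegral fineK//.
  exact: (integrable_fin_num (measurable_rect _ _ _ _) iS).
have oDD : open_disc c r `<=` D by move=> z /open_disc_box/SD.
have h3 : (((r ^+ 2) ^+ 3 / 4 * `|u c|)%:E <=
    \int[area R]_(z in open_disc c r) ((r ^+ 2) ^+ 2 * `|u z|)%:E)%E.
  apply: (le_trans h2); rewrite integral_mkcond [leRHS]integral_mkcond.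
  have mu1 := continuous_on_measurable oD cknu.
  have mu2 := continuous_on_measurable oD nu.
  apply: ge0_le_integral => //.
  - by move=> z _; rewrite patchE; case: ifPn => // _; rewrite lee_fin mulr_ge0// sqr_ge0.
  - apply/(measurable_restrictT _ (measurable_rect _ _ _ _)).
    apply/measurable_EFinP; apply: measurable_funS mu1 => //.
    exact: measurable_open_plane.
  - apply/(measurable_restrictT _ (measurable_open_disc _ _)).
    apply/measurable_EFinP; apply: measurable_funM; first exact: measurable_cst.
    apply: measurable_funS mu2 => //; exact: measurable_open_plane.
  - move=> z _; rewrite !patchE; have [zd|zd] := boolP (z \in open_disc c r).
      rewrite mem_set; last by apply: open_disc_box; exact/set_mem.
      rewrite lee_fin ler_wpM2r// ler_pXn2r ?nnegrE ?kernel_ge0 ?(ltW r2)//.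
      by rewrite kernel_le// ltW.
    case: ifPn => // _; rewrite kernel_out ?expr0n/= ?mul0r//.
    move: zd; rewrite notin_setE /open_disc/= => /negP; rewrite -leNgt.
    by move=> h; rewrite -(sqr_modulus (z - c)) ler_pXn2r ?nnegrE ?modulus_ge0 ?(ltW r0).
have h4 : (\int[area R]_(z in open_disc c r) ((r ^+ 2) ^+ 2 * `|u z|)%:E =
   ((r ^+ 2) ^+ 2)%:E * \int[area R]_(z in open_disc c r) (`|u z|)%:E)%E.
  under eq_integral do rewrite EFinM.
  apply: ge0_integralZl_EFin => //; first exact: measurable_open_disc.
    apply/measurable_EFinP; apply: measurable_funS (continuous_on_measurable oD nu) => //.
    exact: measurable_open_plane.
  exact: ltW.
move: h3; rewrite h4.
have -> : (r ^+ 2) ^+ 3 / 4 * `|u c| = (r ^+ 2) ^+ 2 * (r ^+ 2 / 4 * `|u c|) by ring.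
by rewrite EFinM lee_pmul2l ?lte_fin ?fin_numE.
Qed.

(** Difference of squares: [k' - k] contributes [5 r = 2 (2 r) + r], and [k' + k] contributes
    [2 r^2]. *)
Lemma kernel_sqr_diff (r : R) c c' z : 0 < r ->
  `|c'.1 - c.1| <= r -> `|c'.2 - c.2| <= r -> `|z.1 - c.1| <= 2 * r -> `|z.2 - c.2| <= 2 * r ->
  `|kernel (r ^+ 2) c' z ^+ 2 - kernel (r ^+ 2) c z ^+ 2|
    <= 10 * r ^+ 3 * (`|c'.1 - c.1| + `|c'.2 - c.2|).
Proof.
move=> r0 h1 h2 h3 h4; have r2 : 0 <= r ^+ 2 by rewrite exprn_ge0// ltW.
set k' := kernel _ c' z; set k := kernel _ c z.
have kk : `|k' - k| <= 5 * r * (`|c'.1 - c.1| + `|c'.2 - c.2|).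
  apply: (le_trans (max0_lip _ _)).
  rewrite (_ : _ - _ = (c'.1 - c.1) * (2 * (z.1 - c.1) - (c'.1 - c.1)) +
     (c'.2 - c.2) * (2 * (z.2 - c.2) - (c'.2 - c.2))); last by ring.
  rewrite [leRHS]mulrDr; apply: (le_trans (ler_normD _ _)).
  apply: lerD; rewrite normrM mulrC ler_wpM2r//; apply: (le_trans (ler_normB _ _));
    rewrite normrM (@ger0_norm _ 2)//; lra.
have ks : `|k' + k| <= 2 * r ^+ 2.
  rewrite ger0_norm ?addr_ge0 ?kernel_ge0//.
  by have := kernel_le c' z r2; have := kernel_le c z r2; rewrite -/k -/k'; lra.
rewrite subr_sqr normrM.
apply: (le_trans (ler_pM (normr_ge0 _) (normr_ge0 _) kk ks)).
rewrite le_eqVlt; apply/orP; left; apply/eqP; ring.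
Qed.

(** The mean value formula at [c] and [c'], over one common square, moves the increment from [u] to
    the kernel. The bound [10 r^3] of [kernel_sqr_diff] times the area [16 r^2] gives [160 r^5]; it
    occurs twice and is divided by [r^6 / 4], whence [1280 / r]. *)
Lemma harmonic_lipschitz D u v c c' (r U : R) : open D -> cr_on D u v -> 0 < r ->
  rect (c.1 - 2 * r) (c.1 + 2 * r) (c.2 - 2 * r) (c.2 + 2 * r) `<=` D ->
  (forall z, rect (c.1 - 2 * r) (c.1 + 2 * r) (c.2 - 2 * r) (c.2 + 2 * r) z -> `|u z| <= U) ->
  `|c'.1 - c.1| <= r -> `|c'.2 - c.2| <= r ->
  `|u c' - u c| <= 1280 * U / r * (`|c'.1 - c.1| + `|c'.2 - c.2|).
Proof.
move=> oD uv r0 SD uU h1 h2; have [cu cv] := cr_continuous oD uv.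
have r2 : 0 < r ^+ 2 by rewrite exprn_gt0.
have Sc : rect (c.1 - 2 * r) (c.1 + 2 * r) (c.2 - 2 * r) (c.2 + 2 * r) c.
  by apply/rectP; split; apply/andP; split; lra.
have l1 : c.1 - 2 * r <= c.1 + 2 * r by lra.
have l2 : c.2 - 2 * r <= c.2 + 2 * r by lra.
have k2 c0 := @continuous_in_kernel2 R D (r ^+ 2) c0.
have one := @continuous_in_cst R D 1.
have /andP[a1 a2] : - r <= c'.1 - c.1 <= r by rewrite -ler_norml.
have /andP[a3 a4] : - r <= c'.2 - c.2 <= r by rewrite -ler_norml.
have i1 : c.1 - 2 * r <= c.1 - r by lra.
have i2 : c.1 + r <= c.1 + 2 * r by lra.
have i3 : c.2 - 2 * r <= c.2 - r by lra.
have i4 : c.2 + r <= c.2 + 2 * r by lra.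
have j1 : c.1 - 2 * r <= c'.1 - r by lra.
have j2 : c'.1 + r <= c.1 + 2 * r by lra.
have j3 : c.2 - 2 * r <= c'.2 - r by lra.
have j4 : c'.2 + r <= c.2 + 2 * r by lra.
have J := mean_value_kernel oD SD uv r0 i1 i2 i3 i4.
have J' := mean_value_kernel oD SD uv r0 j1 j2 j3 j4.
have I' := kernel_integral_ge oD SD r0 erefl j1 j2 j3 j4.
set S := rect _ _ _ _ in SD uU J J' I' Sc.
pose A := Rintegral (area R) S (fun z => kernel (r ^+ 2) c z ^+ 2 * u z).
pose B := Rintegral (area R) S (fun z => kernel (r ^+ 2) c z ^+ 2 * 1).
pose A' := Rintegral (area R) S (fun z => kernel (r ^+ 2) c' z ^+ 2 * u z).
pose B' := Rintegral (area R) S (fun z => kernel (r ^+ 2) c' z ^+ 2 * 1).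
rewrite -/A -/B in J; rewrite -/A' -/B' in J'; rewrite -/B' in I'.
set d := `|c'.1 - c.1| + `|c'.2 - c.2|.
have d0 : 0 <= d by rewrite addr_ge0.
have U0 : 0 <= U by apply: le_trans (uU c Sc).
have areaS : Rintegral (area R) S (fun=> 1) = 16 * r ^+ 2.
  have := Rintegral_cst (area R) (measurable_rect (c.1 - 2 * r) (c.1 + 2 * r) (c.2 - 2 * r) (c.2 + 2 * r)) 1.
  rewrite -/S => ->; rewrite /S (area_box l1 l2)/=; ring.
have key f (F : R) : {in D, continuous f} -> 0 <= F -> (forall z, S z -> `|f z| <= F) ->
    `|Rintegral (area R) S (fun z => kernel (r ^+ 2) c' z ^+ 2 * f z) -
      Rintegral (area R) S (fun z => kernel (r ^+ 2) c z ^+ 2 * f z)|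
      <= 160 * r ^+ 5 * d * F.
  move=> cf F0 fF.
  have E : Rintegral (area R) S (fun z => kernel (r ^+ 2) c' z ^+ 2 * f z) -
      Rintegral (area R) S (fun z => kernel (r ^+ 2) c z ^+ 2 * f z) =
     Rintegral (area R) S (fun z => 1 * (kernel (r ^+ 2) c' z ^+ 2 * f z) +
       (- 1) * (kernel (r ^+ 2) c z ^+ 2 * f z)).
    rewrite (Rintegral_rect_lin _ _ oD SD (continuous_in_mul (k2 c') cf)
      (continuous_in_mul (k2 c) cf)).
    by rewrite mul1r mulN1r.
  have E2 : 160 * r ^+ 5 * d * F = Rintegral (area R) S
      (fun z => (10 * r ^+ 3 * d * F) * 1 + 0 * 1).
    rewrite (Rintegral_rect_lin _ _ oD SD one one) areaS; ring.
  rewrite E E2; apply: (norm_Rintegral_rect oD SD).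
  - exact: (continuous_in_lin (continuous_in_mul (k2 c') cf) (continuous_in_mul (k2 c) cf)).
  - exact: (continuous_in_lin one one).
  move=> z Sz; rewrite mul0r addr0 mulr1.
  have -> : 1 * (kernel (r ^+ 2) c' z ^+ 2 * f z) + -1 * (kernel (r ^+ 2) c z ^+ 2 * f z) =
    (kernel (r ^+ 2) c' z ^+ 2 - kernel (r ^+ 2) c z ^+ 2) * f z by ring.
  rewrite normrM ler_pM//; last exact: fF.
  have /rectP[/andP[b1 b2] /andP[b3 b4]] := Sz.
  have z1 : `|z.1 - c.1| <= 2 * r.
    by clear -b1 b2; rewrite ler_norml; apply/andP; split; lra.
  have z2 : `|z.2 - c.2| <= 2 * r.
    by clear -b3 b4; rewrite ler_norml; apply/andP; split; lra.
  exact: kernel_sqr_diff.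
have kA := key u U cu U0 uU.
have kB : `|B' - B| <= 160 * r ^+ 5 * d * 1.
  by apply: (key (fun=> 1) 1 one) => // z _; rewrite normr1.
rewrite -/A -/A' in kA.
have uc := uU c Sc.
(* The normalising integrals [B] and [B'] are compared by the same estimate, with 1 in the role of
   [u]. *)
have E : (u c' - u c) * B' = (A' - A) - u c * (B' - B) by rewrite J J'; ring.
have le1 : `|u c' - u c| * B' <= 320 * r ^+ 5 * d * U.
  have B'0 : 0 <= B' by apply: Rintegral_ge0 => z _; rewrite mulr1 sqr_ge0.
  rewrite -{1}(ger0_norm B'0) -normrM E; apply: (le_trans (ler_normB _ _)).
  have : `|u c * (B' - B)| <= U * (160 * r ^+ 5 * d * 1) by rewrite normrM ler_pM.
  by move: kA; lra.
have le2 : `|u c' - u c| * ((r ^+ 2) ^+ 3 / 4) <= 320 * r ^+ 5 * d * U.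
  by apply: le_trans le1; rewrite ler_wpM2l.
have p0 : 0 < (r ^+ 2) ^+ 3 / 4 by rewrite divr_gt0// exprn_gt0.
have r_neq0 : r != 0 by rewrite lt0r_neq0.
move: le2; rewrite -ler_pdivlMr// => /le_trans; apply.
by rewrite le_eqVlt; apply/orP; left; apply/eqP; field.
Qed.

Lemma is_derive_norm_le (f : R -> R) (x l L r : R) : 0 < r -> is_derive x 1 f l ->
  (forall y, `|y - x| <= r -> `|f y - f x| <= L * `|y - x|) -> `|l| <= L.
Proof.
move=> r0 /is_derive1_caratheodory[g [fg cg <-]] H.
apply/ler_addgt0Pl => e e0.
have /nbhs_ballP[d /= d0 Hd] := cg _ (nbhsx_ballx (g x) _ e0).
pose y := x + Num.min (d / 2) r.
have m0 : 0 < Num.min (d / 2) r by rewrite lt_min r0 divr_gt0.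
have yx : `|y - x| = Num.min (d / 2) r by rewrite /y addrC addKr gtr0_norm.
have h1 : `|g y| <= L.
  have := H y; rewrite fg normrM yx ler_pM2r//.
  apply.
  by rewrite ge_min lexx orbT.
have := Hd y; rewrite -!ball_normE/= distrC yx gt_min => -/(_ _) h2.
have {}h2 : `|g x - g y| < e by apply: h2; apply/orP; left; lra.
rewrite -[g x](subrK (g y)); apply: (le_trans (ler_normD _ _)).
by rewrite lerD// ltW.
Qed.

Lemma harmonic_gradient D u v c (r U : R) : open D -> cr_on D u v -> 0 < r ->
  rect (c.1 - 2 * r) (c.1 + 2 * r) (c.2 - 2 * r) (c.2 + 2 * r) `<=` D ->
  (forall z, rect (c.1 - 2 * r) (c.1 + 2 * r) (c.2 - 2 * r) (c.2 + 2 * r) z -> `|u z| <= U) ->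
  `|partial_x u c| <= 1280 * U / r /\ `|partial_y u c| <= 1280 * U / r.
Proof.
move=> oD uv r0 SD uU.
have L c' := harmonic_lipschitz (c' := c') oD uv r0 SD uU.
have Dc : D c by apply: SD; apply/rectP; split; apply/andP; split; lra.
have [Cu _ _] := uv; have [ux uy _ _] := Cu _ Dc.
case: c L {SD uU Dc} ux uy => x y L ux uy; split.
  apply: (is_derive_norm_le r0 (is_derive_slice1 ux)) => t tx.
  by have := L (t, y); rewrite /= subrr normr0 addr0; apply => //; exact: ltW.
apply: (is_derive_norm_le r0 (is_derive_slice2 uy)) => t tx.
by have := L (x, t); rewrite /= subrr normr0 add0r; apply => //; exact: ltW.
Qed.

End Estimates.

(** * Powers of harmonic functions *)

Section HardyLittlewood.
Variable R : realType.
Implicit Types (f g u v : R * R -> R) (D : set (R * R)) (c z : R * R).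

(** If [y > X / 32], then [y] and [X] are comparable, so [y] is at most a multiple of
    [X^(1 - s) y^s] whatever the sign of [1 - s]. The 32 is chosen for absorption: over a disc of
    area at most [4 r^2] the term [X / 32] integrates to at most half of the [r^2 X / 4] of
    [mean_value_ineq]. *)
Lemma powR_split (s : R) : 0 < s -> exists2 C, 0 < C & forall X y : R, 0 < X -> 0 <= y ->
  y `^ s <= 8 * X `^ s -> y <= X / 32 + C * X `^ (1 - s) * y `^ s.
Proof.
move=> s0; have h32 : 0 < 32 `^ s :> R by rewrite powR_gt0.
have h8 : 0 < 8 `^ s^-1 :> R by rewrite powR_gt0.
exists (8 `^ s^-1 * 32 `^ s); first exact: mulr_gt0.
move=> X y X0 y0 yX.
have [yX'|yX'] := leP y (X / 32).
  by rewrite (le_trans yX')// lerDl !mulr_ge0 ?powR_ge0.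
have t1 : y <= 8 `^ s^-1 * X.
  have : (y `^ s) `^ s^-1 <= (8 * X `^ s) `^ s^-1.
    apply: ge0_ler_powR; rewrite ?invr_ge0 ?(ltW s0) ?nnegrE ?powR_ge0//.
    by rewrite mulr_ge0// powR_ge0.
  rewrite powRM// ?powR_ge0// -!powRrM divff ?gt_eqF// !powRr1//; exact: ltW.
have t2 : X `^ s <= 32 `^ s * y `^ s.
  rewrite -powRM//; apply: ge0_ler_powR; rewrite ?nnegrE ?(ltW s0) ?(ltW X0)//.
    by rewrite mulr_ge0.
  by move: yX'; rewrite ltr_pdivrMr// mulrC => /ltW.
apply: (@le_trans _ _ (8 `^ s^-1 * 32 `^ s * X `^ (1 - s) * y `^ s)); last first.
  by rewrite lerDr divr_ge0// ltW.
apply: (le_trans t1); rewrite -!mulrA ler_pM2l// mulrCA.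
apply: (@le_trans _ _ (X `^ (1 - s) * X `^ s)); last by rewrite ler_wpM2l// powR_ge0.
by rewrite -powRD ?subrK ?powRr1 ?(ltW X0)// gt_eqF// implybT.
Qed.

(** The circumscribed square gives 4 in place of pi; in the companion lower bound an inner square of
    side [r] gives 1. *)
Lemma area_disc_le c r : 0 < r -> (area R (open_disc c r) <= (4 * r ^+ 2)%:E)%E.
Proof.
move=> r0; apply: (@le_trans _ _ (area R (rect (c.1 - r) (c.1 + r) (c.2 - r) (c.2 + r)))).
  apply: le_measure; rewrite ?inE; last exact: open_disc_box.
    exact: measurable_open_disc.
  exact: measurable_rect.
by rewrite area_box ?lee_fin; [rewrite le_eqVlt; apply/orP; left; apply/eqP; ring|lra|lra].
Qed.

Lemma area_disc_ge c r : 0 < r -> ((r ^+ 2)%:E <= area R (open_disc c r))%E.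
Proof.
move=> r0; apply: (@le_trans _ _ (area R
   (rect (c.1 - r / 2) (c.1 + r / 2) (c.2 - r / 2) (c.2 + r / 2)))).
  by rewrite area_box ?lee_fin; [rewrite le_eqVlt; apply/orP; left; apply/eqP; field|lra|lra].
apply: le_measure; rewrite ?inE; [exact: measurable_rect|exact: measurable_open_disc|].
move=> z /rectP[/andP[h1 h2] /andP[h3 h4]].
rewrite /open_disc/= modulus_lt ?(ltW r0)//=.
have r2 : 0 < r ^+ 2 by rewrite exprn_gt0.
have k1 : (z.1 - c.1) ^+ 2 <= (r / 2) ^+ 2.
  rewrite -real_normK ?num_real// ler_pXn2r ?nnegrE ?divr_ge0 ?(ltW r0)//.
  by rewrite ler_norml; apply/andP; split; lra.
have k2 : (z.2 - c.2) ^+ 2 <= (r / 2) ^+ 2.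
  rewrite -real_normK ?num_real// ler_pXn2r ?nnegrE ?divr_ge0 ?(ltW r0)//.
  by rewrite ler_norml; apply/andP; split; lra.
by move: k1 k2; rewrite expr_div_n; lra.
Qed.

Lemma measurable_norm_powR D u (s : R) : open D -> {in D, continuous u} ->
  measurable_fun (D : set (measurableTypeR R * measurableTypeR R))
    (fun z => `|u z| `^ s).
Proof.
move=> oD cu; apply: (measurableT_comp (measurable_powR s)).
by apply: measurableT_comp; [exact: normr_measurable|exact: continuous_on_measurable].
Qed.

Lemma box_in_disc c r z : rect (c.1 - r) (c.1 + r) (c.2 - r) (c.2 + r) z ->
  modulus (z - c) <= 2 * r.
Proof.
move=> /rectP[h1 h2]; apply: (le_trans (modulus_le_abs _)) => /=.
have -> : 2 * r = r + r by ring.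
by rewrite lerD// ler_norml; apply/andP; split; lra.
Qed.

Lemma compact_disc c (r : R) : compact [set z : R * R | modulus (z - c) <= r].
Proof.
apply: (@subclosed_compact _ _ (rect (c.1 - r) (c.1 + r) (c.2 - r) (c.2 + r))).
- have -> : [set z : R * R | modulus (z - c) <= r] =
      (fun z => modulus (z - c)) @^-1` [set x | x <= r] by [].
  apply: closed_comp; last exact: closed_le.
  move=> z _; apply: continuous_comp; last exact: continuous_modulus.
  by apply: cvgB; [exact: cvg_id|exact: cvg_cst].
- exact: compact_rect.
- move=> z /= zc; apply/rectP.
  have h1 := le_trans (abs1_le_modulus (z - c)) zc.
  have h2 := le_trans (abs2_le_modulus (z - c)) zc.
  move: h1 h2; rewrite !ler_norml /= => /andP[? ?] /andP[? ?].
  by split; apply/andP; split; lra.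
Qed.

(* Hardy and Littlewood: at a near-maximum [z'] of
   [(rho - |z - c|)^2 |u z|^s] the values of [|u|] on a disc of radius
   comparable to [rho - |z' - c|] are controlled by [|u z'|], so the mean
   value inequality for [|u|] gives the one for [|u|^s], even if [s < 1]. *)
Lemma local_sup_bound (s : R) : 0 < s -> exists2 C, 0 < C &
  forall D u v c (rho : R) z0, open D -> cr_on D u v -> 0 < rho ->
   (forall z, modulus (z - c) <= rho -> D z) -> modulus (z0 - c) <= rho / 2 ->
   ((rho ^+ 2 * `|u z0| `^ s)%:E <=
     C%:E * \int[area R]_(z in open_disc c rho) (`|u z| `^ s)%:E)%E.
Proof.
move=> s0; have [C C0 HC] := powR_split s0.
have N0 : 0 < 8 * (8 * 16) :> R by rewrite !mulr_gt0.
set N := 8 * (8 * 16) in N0; exists (N * C); first exact: mulr_gt0.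
move=> D u v c rho z0 oD uv rho0 KD z0c; have [cu cv] := cr_continuous oD uv.
have a1 : rho / 2 <= rho - modulus (z0 - c) by lra.
have a2 : 0 <= rho / 2 by lra.
have dz0 : open_disc c rho z0 by rewrite /open_disc/=; lra.
have int0 : (0 <= \int[area R]_(z in open_disc c rho) (`|u z| `^ s)%:E)%E.
  by apply: integral_ge0 => z _; rewrite lee_fin powR_ge0.
have [uz0|uz0] := eqVneq (u z0) 0.
  rewrite uz0 normr0 powR0 ?gt_eqF// mulr0 mule_ge0// lee_fin.
  by rewrite mulr_ge0// ltW.
have uz0s : 0 < `|u z0| `^ s by rewrite powR_gt0// normr_gt0.
have discD : open_disc c rho `<=` D by move=> z /ltW/KD.
have cK := @compact_disc c rho.
have [M M0 HM] := compact_continuous_bounded cu (KD : _ `<=` _) cK.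
pose Th z := (rho - modulus (z - c)) ^+ 2 * `|u z| `^ s.
pose E := [set Th z | z in open_disc c rho].
have Ez0 : E (Th z0) by exists z0.
have hasE : has_sup E.
  split; first by exists (Th z0).
  exists (rho ^+ 2 * M `^ s) => _ [z zc <-]; rewrite /Th.
  have zc' := ltW (zc : modulus (z - c) < rho).
  apply: ler_pM; rewrite ?sqr_ge0 ?powR_ge0//.
    have m0 := modulus_ge0 (z - c).
    by rewrite ler_pXn2r ?nnegrE ?subr_ge0 ?(ltW rho0)// gerBl.
  by apply: ge0_ler_powR; rewrite ?nnegrE ?(ltW s0)//; exact: HM.
have Th0 : 0 < Th z0.
  by rewrite mulr_gt0// exprn_gt0// subr_gt0; apply: (le_lt_trans z0c); lra.
have supE0 : 0 < sup E.
  exact: lt_le_trans Th0 (sup_upper_bound hasE Ez0).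
have sup2 : 0 < sup E / 2 by rewrite divr_gt0.
(* The supremum over the open disc need not be attained, but [z1] exceeds half of it, which is
   positive because [u z0] is not 0. *)
have [_ [z1 z1c <-] hz1] := sup_adherent sup2 hasE.
have {}hz1 : forall z, open_disc c rho z -> Th z <= 2 * Th z1.
  move=> z zc; have : Th z <= sup E by apply: (sup_upper_bound hasE); exists z.
  by move: hz1; lra.
set X := `|u z1|.
pose d := rho - modulus (z1 - c).
have d0 : 0 < d by rewrite subr_gt0.
have X0 : 0 < X.
  rewrite lt_neqAle normr_ge0 andbT eq_sym; apply/eqP => X0.
  have := hz1 z0; rewrite /Th -/X X0 powR0 ?gt_eqF// !mulr0 -/(Th z0) leNgt Th0.
  by move=> /(_ dz0).
have XsE : Th z1 = d ^+ 2 * X `^ s by [].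
(* Within [2 r = d / 2] of [z1] the distance to the rim is at least [d / 2], so near-maximality
   gives [|u|^s <= 8 X^s], with 8 from the factor 2 and the squared 2. Radius [2 r] rather than [r]
   leaves room for the square of half-side [r]. *)
pose r := d / 4.
have r0 : 0 < r by rewrite divr_gt0.
have near z : modulus (z - z1) <= 2 * r -> modulus (z - c) <= rho - d / 2.
  move=> h; apply: (le_trans (modulus_dist z c z1)).
  have dE : modulus (z1 - c) = rho - d by rewrite /d; ring.
  have rE : r = d / 4 by [].
  by rewrite dE; rewrite rE in h; lra.
have Xu z : modulus (z - z1) <= 2 * r -> `|u z| `^ s <= 8 * X `^ s.
  move=> /near h; have zc : open_disc c rho z.
    by rewrite /open_disc/=; lra.
  have := hz1 z zc; rewrite XsE /Th => h1.
  have h2 : (d / 2) ^+ 2 * `|u z| `^ s <= 2 * (d ^+ 2 * X `^ s).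
    apply: le_trans h1; rewrite ler_wpM2r ?powR_ge0//.
    have b1 : d / 2 <= rho - modulus (z - c) by lra.
    have b2 : 0 <= d / 2 by lra.
    by rewrite ler_pXn2r ?nnegrE// (le_trans b2).
  have d2 : 0 < d ^+ 2 by rewrite exprn_gt0.
  rewrite -(ler_pM2l d2); move: h2; rewrite expr_div_n; lra.
have sub1 : open_disc z1 r `<=` open_disc c rho.
  move=> z zz; have : modulus (z - z1) <= 2 * r.
    by apply: (le_trans (ltW zz)); lra.
  by move=> /near; rewrite /open_disc/=; lra.
have boxD : rect (z1.1 - r) (z1.1 + r) (z1.2 - r) (z1.2 + r) `<=` D.
  by move=> z /box_in_disc/near h; apply: KD; lra.
have mus := measurable_norm_powR s oD cu.
have mu1 := continuous_on_measurable oD (continuous_in_norm cu).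
have mD := measurable_open_plane oD.
have sub1D : open_disc z1 r `<=` D by apply: subset_trans discD.
have mus1 : measurable_fun (open_disc z1 r) (fun z => (`|u z| `^ s)%:E).
  by apply/measurable_EFinP; exact: measurable_funS mus.
have q0 : 0 <= C * X `^ (1 - s) by rewrite mulr_ge0 ?powR_ge0// ltW.
have step1 : ((r ^+ 2 / 4 * X)%:E <= (X / 32 * (4 * r ^+ 2))%:E +
    (C * X `^ (1 - s))%:E * \int[area R]_(z in open_disc z1 r) (`|u z| `^ s)%:E)%E.
  apply: (le_trans (mean_value_ineq oD uv r0 boxD)).
  apply: (@le_trans _ _ (\int[area R]_(z in open_disc z1 r)
    ((X / 32)%:E + (C * X `^ (1 - s))%:E * (`|u z| `^ s)%:E))%E).
    apply: ge0_le_integral => //.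
    - exact: measurable_open_disc.
    - by apply/measurable_EFinP; exact: measurable_funS mu1.
    - apply: emeasurable_funD; first exact: measurable_cst.
      by apply: measurable_funeM.
    - move=> z zz; rewrite -EFinM -EFinD lee_fin; apply: HC => //; apply: Xu.
      by apply: (le_trans (ltW zz)); lra.
  have mdisc := measurable_open_disc z1 r.
  have f1 z : open_disc z1 r z -> (0 <= (X / 32)%:E)%E.
    by move=> _; rewrite lee_fin divr_ge0// ltW.
  have f2 z : open_disc z1 r z -> (0 <= (`|u z| `^ s)%:E)%E.
    by move=> _; rewrite lee_fin powR_ge0.
  have f3 z : open_disc z1 r z -> (0 <= (C * X `^ (1 - s))%:E * (`|u z| `^ s)%:E)%E.
    by move=> /f2 h; rewrite mule_ge0.
  have m1 : measurable_fun (open_disc z1 r) (fun=> (X / 32)%:E) by exact: measurable_cst.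
  have m3 : measurable_fun (open_disc z1 r)
      (fun z => (C * X `^ (1 - s))%:E * (`|u z| `^ s)%:E)%E by apply: measurable_funeM.
  rewrite (ge0_integralD _ mdisc f1 m1 f3 m3); apply: leeD.
    rewrite (integral_cst _ mdisc) [leRHS]EFinM.
    by apply: lee_wpmul2l; [rewrite lee_fin divr_ge0// ltW|exact: area_disc_le].
  by rewrite (ge0_integralZl_EFin _ mdisc f2 mus1 q0).
(* The term with [X / 32] is at most [r^2 X / 8] and is absorbed into the left side. *)
have step2 : ((r ^+ 2 / 8 * X)%:E <=
    (C * X `^ (1 - s))%:E * \int[area R]_(z in open_disc z1 r) (`|u z| `^ s)%:E)%E.
  rewrite (_ : r ^+ 2 / 8 * X = r ^+ 2 / 4 * X - X / 32 * (4 * r ^+ 2)); last by field.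
  by rewrite EFinB leeBlDl.
have step3 : ((r ^+ 2 / 8 * X `^ s)%:E <=
    C%:E * \int[area R]_(z in open_disc z1 r) (`|u z| `^ s)%:E)%E.
  rewrite -(@lee_pmul2l _ (X `^ (1 - s))%:E)// ?lte_fin ?powR_gt0//.
  rewrite [leRHS]muleA -[X in (_ <= X * _)%E]EFinM [X `^ (1 - s) * C]mulrC.
  apply: le_trans step2.
  rewrite -EFinM lee_fin mulrCA -powRD; first by rewrite subrK powRr1// ltW.
  by apply/implyP => _; rewrite gt_eqF.
have step4 : (\int[area R]_(z in open_disc z1 r) (`|u z| `^ s)%:E <=
   \int[area R]_(z in open_disc c rho) (`|u z| `^ s)%:E)%E.
  have mus2 : measurable_fun (open_disc c rho) (fun z => (`|u z| `^ s)%:E).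
    by apply/measurable_EFinP; exact: measurable_funS mus.
  apply: (ge0_subset_integral _ (measurable_open_disc _ _) (measurable_open_disc _ _) mus2) => //.
(* Since [z0] is at least [rho / 2] away from the rim, [rho^2 |u z0|^s] is at most [8 d^2 X^s]; the
   value of [N] compensates [r^2 / 8 = d^2 / 128]. *)
have step5 : rho ^+ 2 * `|u z0| `^ s <= N * (r ^+ 2 / 8 * X `^ s).
  have h := hz1 z0 dz0.
  rewrite XsE in h.
  have h2 : (rho / 2) ^+ 2 * `|u z0| `^ s <= Th z0.
    by rewrite ler_wpM2r ?powR_ge0// ler_pXn2r ?nnegrE// (le_trans a2).
  have -> : N * (r ^+ 2 / 8 * X `^ s) = 8 * (d ^+ 2 * X `^ s) by rewrite /N /r; field.
  by move: h h2; clear; rewrite expr_div_n; lra.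
apply: (@le_trans _ _ (N * (r ^+ 2 / 8 * X `^ s))%:E); first by rewrite lee_fin.
rewrite EFinM (EFinM N C) -muleA lee_pmul2l ?lte_fin//.
by apply: (le_trans step3); rewrite lee_pmul2l ?lte_fin.
Qed.

End HardyLittlewood.

(** * Bekolle-Bonami weights *)

Section BekolleBonami.
Variable R : realType.
Implicit Types (f g u v w : R * R -> R) (c z : R * R).

Definition touches_circle c (r : R) :=
  0 < r /\ closure (open_disc c r) `&` @unit_circle R !=set0.

Lemma measurable_unit_disc :
  measurable (@unit_disc R : set (measurableTypeR R * measurableTypeR R)).
Proof. by apply: measurable_open_plane; exact: open_unit_disc. Qed.

Lemma integral_pos_gt0 d (T : measurableType d) (mu : {measure set T -> \bar R})
    (E : set T) (f : T -> R) : measurable E -> measurable_fun E f ->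
  (forall t, E t -> 0 < f t) -> (0 < mu E)%E -> (0 < \int[mu]_(t in E) (f t)%:E)%E.
Proof.
move=> mE mf f0 E0; rewrite lt0e integral_ge0 ?andbT; last first.
  by move=> t /f0 /ltW; rewrite lee_fin.
apply/eqP => I0.
have : (\int[mu]_(t in E) `|(f t)%:E| = 0)%E.
  rewrite -I0; apply: eq_integral => t /set_mem/f0 h.
  by rewrite gee0_abs// lee_fin ltW.
have mfE : measurable_fun E (fun t => (f t)%:E) by apply/measurable_EFinP.
move/(ae_eq_integral_abs _ mE mfE) => [N [mN N0 EN]].
have : (mu E <= mu N)%E.
  apply: le_measure; rewrite ?inE// => t Et; apply: EN => /= /(_ Et) /eqP.
  by rewrite eqe gt_eqF// f0.
by rewrite N0 leNgt E0.
Qed.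

(** Young's inequality by cases: either the first term already dominates, or
    [x^(q - 1) <= 1 / (l y)], whose power [1 / (q - 1)] is the second term. With [l] free, it
    integrates to Hoelder's inequality up to a constant. *)
Lemma young_weight (q l x y : R) : 1 < q -> 0 < l -> 0 <= x -> 0 < y ->
  x <= l * (x `^ q * y) + l `^ (- (q - 1)^-1) * y `^ (- (q - 1)^-1).
Proof.
move=> q1 l0 x0 y0; have q10 : 0 < q - 1 by lra.
have [h|h] := leP x (l * (x `^ q * y)).
  by rewrite (le_trans h)// lerDl mulr_ge0// powR_ge0.
have {}x0 : 0 < x.
  rewrite lt_neqAle x0 andbT; apply: contraTneq h => <-.
  by rewrite powR0 ?mul0r ?mulr0 ?ltxx// gt_eqF//; lra.
have h2 : x `^ (q - 1) <= (l * y)^-1.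
  rewrite -[leRHS]mul1r ler_pdivlMr ?mulr_gt0//.
  have : l * (x `^ q * y) < x by [].
  rewrite -{1}(mulr_powRB1 (ltW x0) (_ : 0 < q)); last by lra.
  move=> h3; rewrite -(ler_pM2l x0) mulr1; apply: ltW; apply: le_lt_trans h3.
  by rewrite le_eqVlt; apply/orP; left; apply/eqP; ring.
have : (x `^ (q - 1)) `^ (q - 1)^-1 <= ((l * y)^-1) `^ (q - 1)^-1.
  apply: ge0_ler_powR; rewrite ?nnegrE ?powR_ge0 ?invr_ge0 ?(ltW q10)//.
  by rewrite mulr_ge0// ltW.
rewrite -powRrM divff ?gt_eqF// powRr1 ?(ltW x0)// => h3.
apply: (@le_trans _ _ (l `^ (- (q - 1)^-1) * y `^ (- (q - 1)^-1))).
  apply: (le_trans h3); rewrite -powRM ?(ltW l0) ?(ltW y0)//.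
  by rewrite powRN -powR_inv1 ?mulr_ge0 ?(ltW l0) ?(ltW y0)// -powRrM mulN1r powRN.
by rewrite lerDr !mulr_ge0 ?powR_ge0 ?(ltW l0) ?(ltW y0).
Qed.

Variables (q C : R) (w : R * R -> R).
Hypothesis q1 : 1 < q.
Hypothesis C0 : 0 < C.
Hypothesis mw : measurable_fun
  ([set: measurableTypeR R * measurableTypeR R]) w.
Hypothesis w0 : forall z, 0 < w z.
Hypothesis BB : forall c r, touches_circle c r ->
  (disc_average (open_disc c r) w *
    disc_average (open_disc c r) (fun z => w z `^ (- (q - 1)^-1))%R `^ (q - 1) <= C%:E)%E.

Let w' z := w z `^ (- (q - 1)^-1).

Let mw' : measurable_fun ([set: measurableTypeR R * measurableTypeR R]) w'.
Proof. exact: (measurableT_comp (measurable_powR _)). Qed.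

Let w'0 z : 0 < w' z. Proof. exact: powR_gt0. Qed.

Lemma measurable_discI c r : measurable (open_disc c r `&` @unit_disc R
  : set (measurableTypeR R * measurableTypeR R)).
Proof. by apply: measurableI; [exact: measurable_open_disc|exact: measurable_unit_disc]. Qed.

Lemma fine_area_disc c (r : R) : 0 < r ->
  r ^+ 2 <= fine (area R (open_disc c r)) <= 4 * r ^+ 2.
Proof.
move=> r0; have h1 := area_disc_le c r0; have h2 := area_disc_ge c r0.
have hf : area R (open_disc c r) \is a fin_num.
  by rewrite ge0_fin_numE// (le_lt_trans h1)// ltry.
by rewrite -!lee_fin fineK// h1 h2.
Qed.

(** Both integrals are positive since the intersection has positive area; were one infinite, the
    product would be infinite and exceed [C]. Finiteness is thus part of the Bekolle-Bonami
    condition. *)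
Lemma BB_dual c r : touches_circle c r ->
  (0 < area R (open_disc c r `&` @unit_disc R))%E ->
  exists M S : R, [/\ 0 < M, 0 < S,
    (\int[area R]_(z in open_disc c r `&` @unit_disc R) (w z)%:E = M%:E)%E,
    (\int[area R]_(z in open_disc c r `&` @unit_disc R) (w' z)%:E = S%:E)%E &
    M * S `^ (q - 1) <= C * fine (area R (open_disc c r)) `^ q].
Proof.
move=> tc aB; have [r0 _] := tc; have q10 : 0 < q - 1 by rewrite subr_gt0.
have mB := measurable_discI c r.
have M0 : (0 < \int[area R]_(z in open_disc c r `&` @unit_disc R) (w z)%:E)%E.
  by apply: integral_pos_gt0 => //; exact: measurable_funTS.
have S0 : (0 < \int[area R]_(z in open_disc c r `&` @unit_disc R) (w' z)%:E)%E.
  by apply: integral_pos_gt0 => //; exact: measurable_funTS.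
have := BB tc; rewrite /disc_average -/w'.
have /andP[b0' _] := fine_area_disc c r0.
have b0 : 0 < fine (area R (open_disc c r)) by apply: lt_le_trans b0'; rewrite exprn_gt0.
set b := fine _ in b0 *; have bi : 0 < b^-1 by rewrite invr_gt0.
have bie : (0 < b^-1%:E)%E by rewrite lte_fin.
move: M0 S0; case: (\int[area R]_(z in _) (w z)%:E)%E => [M||]//;
  case: (\int[area R]_(z in _) (w' z)%:E)%E => [S||]//; rewrite ?lte_fin => M0 S0.
- move=> h; exists M, S; split => //; move: h.
  rewrite -!EFinM lee_fin powRM ?(ltW bi) ?(ltW S0)// => h.
  have bq : 0 < b `^ q by rewrite powR_gt0.
  rewrite -ler_pdivrMr//; apply: le_trans h; rewrite le_eqVlt; apply/orP; left; apply/eqP.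
  rewrite -(powR_inv1 (ltW b0)) -powRrM mulN1r opprB -(powRN b q).
  have -> : b `^ (- q) = b `^ (-1) * b `^ (1 - q).
    rewrite -powRD; last by rewrite (gt_eqF b0) implybT.
    by congr (_ `^ _); ring.
  by ring.
- rewrite (gt0_muley bie) poweRyr ?gt_eqF// gt0_muley ?leye_eq//.
  by rewrite -EFinM lte_fin mulr_gt0.
- rewrite (gt0_muley bie) gt0_mulye ?leye_eq//.
  by rewrite -EFinM poweR_EFin lte_fin powR_gt0// mulr_gt0.
- by rewrite (gt0_muley bie) poweRyr ?gt_eqF// gt0_muley ?leye_eq.
Qed.

(** Integrating [young_weight] splits [a] into a multiple of the integral of [f^q w] and a dual
    term; the latter is tuned to [a / 2] and absorbed, at the price of [2^q]. It is applied with
    [f = |u|^s] for the oscillation and with [f = 1] for the mass of a top half. *)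
Lemma BB_hoelder c r (E : set (measurableTypeR R * measurableTypeR R)) (f : R * R -> R) (a : R) :
  touches_circle c r -> measurable E -> E `<=` open_disc c r `&` @unit_disc R ->
  measurable_fun E f -> (forall z, E z -> 0 <= f z) -> 0 <= a ->
  (a%:E <= \int[area R]_(z in E) (f z)%:E)%E ->
  (((a / fine (area R (open_disc c r))) `^ q)%:E *
     \int[area R]_(z in open_disc c r `&` @unit_disc R) (w z)%:E <=
   (2 `^ q * C)%:E * \int[area R]_(z in E) (f z `^ q * w z)%:E)%E.
Proof.
move=> tc mE EB mf f0; rewrite le_eqVlt => /predU1P[<- _|a0 af].
  rewrite mul0r powR0 ?mul0e; last by rewrite gt_eqF// (lt_trans ltr01 q1).
  rewrite mule_ge0 ?lee_fin ?mulr_ge0 ?powR_ge0 ?(ltW C0)//.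
  apply: integral_ge0 => z Ez; rewrite lee_fin mulr_ge0 ?powR_ge0//; exact: ltW.
have q10 : 0 < q - 1 by rewrite subr_gt0.
have [r0 _] := tc.
have mB := measurable_discI c r.
have aE : (0 < area R E)%E.
  rewrite lt0e measure_ge0 andbT; apply/eqP => E0.
  move: af; rewrite null_set_integral//; first by rewrite lee_fin leNgt a0.
  exact/measurable_EFinP.
have aB : (0 < area R (open_disc c r `&` @unit_disc R))%E.
  by apply: (lt_le_trans aE); apply: le_measure; rewrite ?inE.
have [M [S [M0 S0 -> ES MS]]] := BB_dual tc aB.
have /andP[b0' _] := fine_area_disc c r0.
have b0 : 0 < fine (area R (open_disc c r)) by apply: lt_le_trans b0'; rewrite exprn_gt0.
set b := fine _ in b0 MS *.
have mfq : measurable_fun E (fun z => (f z `^ q * w z)%:E).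
  apply/measurable_EFinP/measurable_funM; last exact: measurable_funTS.
  exact: (measurableT_comp (measurable_powR _)).
have fq0 z : E z -> (0 <= (f z `^ q * w z)%:E)%E.
  by move=> _; rewrite lee_fin mulr_ge0 ?powR_ge0// ltW.
have C2 : 0 < 2 `^ q * C by rewrite mulr_gt0 ?powR_gt0.
have I0 : (0 <= \int[area R]_(z in E) (f z `^ q * w z)%:E)%E by exact: integral_ge0.
case EI : (\int[area R]_(z in E) (f z `^ q * w z)%:E)%E I0 => [I||]// I0; last first.
  by rewrite gt0_muley ?leey// lte_fin.
rewrite lee_fin in I0.
(* The choice that makes the dual term exactly [a / 2]. *)
pose l := (2 * S / a) `^ (q - 1).
have Sa : 0 < 2 * S / a by rewrite divr_gt0// mulr_gt0.
have l0 : 0 < l by exact: powR_gt0.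
have lE : l `^ (- (q - 1)^-1) * S = a / 2.
  rewrite /l -powRrM mulrN divff ?gt_eqF// powR_inv1 ?(ltW Sa)//.
  by field; rewrite !gt_eqF.
have le1 : a <= l * I + a / 2.
  rewrite -lE -lee_fin; apply: (le_trans af).
  apply: (@le_trans _ _ (\int[area R]_(z in E) (l%:E * (f z `^ q * w z)%:E +
     (l `^ (- (q - 1)^-1))%:E * (w' z)%:E))%E).
    apply: ge0_le_integral => //.
    - exact/measurable_EFinP.
    - apply: emeasurable_funD; apply: measurable_funeM => //.
      by apply/measurable_EFinP; exact: measurable_funTS.
    - by move=> z Ez; rewrite -!EFinM -EFinD lee_fin; apply: young_weight => //; exact: f0.
  have mw'E : measurable_fun E (fun z => (w' z)%:E).
    by apply/measurable_EFinP; exact: measurable_funTS.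
  have w'E z : E z -> (0 <= (w' z)%:E)%E by move=> _; rewrite lee_fin ltW.
  have lp : 0 <= l `^ (- (q - 1)^-1) by exact: powR_ge0.
  rewrite (ge0_integralD _ mE _ _ _ (measurable_funeM _ mw'E)); last 3 first.
  - by move=> z Ez; rewrite mule_ge0 ?lee_fin ?(ltW l0)//; exact: fq0.
  - exact: measurable_funeM.
  - by move=> z Ez; rewrite mule_ge0 ?lee_fin//; exact: w'E.
  rewrite (ge0_integralZl_EFin _ mE fq0 mfq (ltW l0)) EI.
  rewrite (ge0_integralZl_EFin _ mE w'E mw'E lp) EFinD !EFinM leeD2l//.
  apply: lee_wpmul2l; rewrite ?lee_fin// -ES.
  have mw'B : measurable_fun (open_disc c r `&` @unit_disc R) (fun z => (w' z)%:E).
    by apply/measurable_EFinP; exact: measurable_funTS.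
  by apply: (ge0_subset_integral _ mE mB mw'B) => // z _; rewrite lee_fin ltW.
have le2 : a `^ q <= 2 `^ q * (S `^ (q - 1) * I).
  have h1 : a / 2 <= l * I by lra.
  have lX : l * a `^ (q - 1) = 2 `^ (q - 1) * S `^ (q - 1).
    rewrite /l -powRM ?(ltW Sa) ?(ltW a0)// divfK ?gt_eqF// powRM//; exact: ltW.
  have ap : 0 < a `^ (q - 1) by exact: powR_gt0.
  have q0 : 0 < q by exact: lt_trans ltr01 q1.
  have h2 : a `^ (q - 1) * (a / 2) <= 2 `^ (q - 1) * S `^ (q - 1) * I.
    rewrite -lX (_ : l * a `^ (q - 1) * I = a `^ (q - 1) * (l * I)); last by ring.
    exact: ler_wpM2l (ltW ap) _ _ h1.
  rewrite -(mulr_powRB1 (ltW a0) q0) -(@mulr_powRB1 _ 2 q)//.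
  have -> : a * a `^ (q - 1) = 2 * (a `^ (q - 1) * (a / 2)) by field.
  rewrite -!mulrA ler_pM2l//; apply: (le_trans h2).
  by rewrite -!mulrA.
rewrite -!EFinM lee_fin powRM ?(ltW a0) ?invr_ge0 ?(ltW b0)//.
have bq : 0 < b `^ q by rewrite powR_gt0.
have -> : b^-1 `^ q = (b `^ q)^-1 by rewrite -(powR_inv1 (ltW b0)) -powRrM mulN1r powRN.
rewrite mulrAC ler_pdivrMr//.
apply: (le_trans (ler_wpM2r (ltW M0) le2)).
have := ler_wpM2l (mulr_ge0 (powR_ge0 2 q) I0) MS.
set A := 2 `^ q; set B := S `^ _; set B' := b `^ q => h.
have -> : A * (B * I) * M = A * I * (M * B) by ring.
by apply: (le_trans h); rewrite le_eqVlt; apply/orP; left; apply/eqP; ring.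
Qed.

End BekolleBonami.

(** * Oscillation of the conjugate function *)

Section Oscillation.
Variable R : realType.
Implicit Types (f g u v w : R * R -> R) (c z : R * R).

(** Up to order and sign the partial derivatives of [v] are those of [u]. The square used by
    [harmonic_gradient] with radius [rho / 8] has half-side [rho / 4], hence lies within [rho / 2]
    of [c]; this is the factor 8. *)
Lemma conjugate_gradient : exists2 N : R, 0 < N & forall D u v c (rho U : R),
  open D -> cr_on D u v -> 0 < rho -> (forall z, modulus (z - c) <= rho -> D z) ->
  (forall z, modulus (z - c) <= rho / 2 -> `|u z| <= U) ->
  `|partial_x v c| <= N * U / rho /\ `|partial_y v c| <= N * U / rho.
Proof.
exists (1280 * 8); first by apply: mulr_gt0; rewrite ltr0n.
move=> D u v c rho U oD uv rho0 KD uU.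
have r0 : 0 < rho / 8 by rewrite divr_gt0.
have box z : rect (c.1 - 2 * (rho / 8)) (c.1 + 2 * (rho / 8))
    (c.2 - 2 * (rho / 8)) (c.2 + 2 * (rho / 8)) z -> modulus (z - c) <= rho / 2.
  by move=> /box_in_disc h; apply: (le_trans h); lra.
have boxD : rect (c.1 - 2 * (rho / 8)) (c.1 + 2 * (rho / 8))
    (c.2 - 2 * (rho / 8)) (c.2 + 2 * (rho / 8)) `<=` D.
  by move=> z /box h; apply: KD; apply: (le_trans h); lra.
have [h1 h2] := harmonic_gradient oD uv r0 boxD (fun z Bz => uU z (box z Bz)).
have Dc : D c by apply: KD; rewrite subrr modulus0 ltW.
have [_ _ CR] := uv; have [e1 e2] := CR _ Dc.
have E : 1280 * 8 * U / rho = 1280 * U / (rho / 8) by field; rewrite gt_eqF.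
rewrite E; split; last by rewrite -e1.
by rewrite -normrN -e2.
Qed.

Lemma open_ball_unit_disc r : r <= 1 -> open_disc 0 r `<=` @unit_disc R.
Proof. by move=> r1 z; rewrite /open_disc /unit_disc/= subr0 => /lt_le_trans; exact. Qed.

Lemma modulus_segment (y y' c : R * R) (r t : R) : 0 <= t <= 1 ->
  modulus (y - c) <= r -> modulus (y' - c) <= r ->
  modulus (y + t *: (y' - y) - c) <= r.
Proof.
move=> /andP[t0 t1] h h'.
have -> : y + t *: (y' - y) - c = (1 - t) *: (y - c) + t *: (y' - c).
  case: y y' c {h h'} => [a b] [a' b'] [e f].
  by congr pair => /=; rewrite /GRing.scale/=; ring.
apply: (le_trans (modulusD _ _)); rewrite !modulusZ ger0_norm ?subr_ge0// ger0_norm//.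
have -> : r = (1 - t) * r + t * r by ring.
by apply: lerD; rewrite ler_wpM2l// subr_ge0.
Qed.

(** A disc with the boundary layer of depth [t / 8] removed: the region over which [|u|^p w] is
    charged. The cut makes these regions overlap boundedly across generations. *)
Definition whitney_disc c (t : R) : set (measurableTypeR R * measurableTypeR R) :=
  open_disc c (11 * t) `&` open_disc 0 (1 - t / 8).

(** Discs of radius [t / 8] about the points of the segment from [z] to [z'] stay in the Whitney
    region, which explains the margins from [10 t] to [11 t] and from [t / 4] to [t / 8]. Depth
    [t / 4] admits the centres of the next generation, at depth [3 t / 8]. The constant is chosen
    before [w], [u] and [v]. *)
Lemma oscillation (p q C : R) : 0 < p -> 1 < q -> 0 < C -> exists2 K, 0 < K &
  forall w u v c (t : R) z z',
  measurable_fun ([set: measurableTypeR R * measurableTypeR R]) w ->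
  (forall z, 0 < w z) ->
  (forall c r, touches_circle c r ->
  (disc_average (open_disc c r) w *
    disc_average (open_disc c r) (fun z => w z `^ (- (q - 1)^-1))%R `^ (q - 1) <= C%:E)%E) ->
  cr_on (@unit_disc R) u v -> 0 < t <= 1 -> touches_circle c (11 * t) ->
  modulus (z - c) <= 10 * t -> modulus (z' - c) <= 10 * t ->
  modulus z <= 1 - t / 4 -> modulus z' <= 1 - t / 4 ->
  ((`|v z' - v z| `^ p)%:E *
     \int[area R]_(y in open_disc c (11 * t)%R `&` @unit_disc R) (w y)%:E <=
   K%:E * \int[area R]_(y in whitney_disc c t) (`|u y| `^ p * w y)%:E)%E.
Proof.
move=> p0 q1 C0; pose s := p / q.
have q0 : 0 < q by lra.
have s0 : 0 < s by rewrite divr_gt0.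
have [A A0 HA] := @local_sup_bound R s s0.
have [N N0 HN] := conjugate_gradient.
(* The 8 comes from [rho = t / 8], and [40 t] bounds the sum of the coordinate differences of two
   points at distance at most [20 t]. In [B] the 64 comes from [rho^2], the rest from the area bound
   for radius [11 t]. *)
pose L := N * (8 * 40); have L0 : 0 < L by rewrite !mulr_gt0.
pose B := A * (64 * (4 * (11 * 11))); have B0 : 0 < B by rewrite !mulr_gt0.
exists (L `^ p * B `^ q * (2 `^ q * C)).
  by rewrite !mulr_gt0// powR_gt0.
move=> w u v c t z z' mw w0 BB uv /andP[t0 t1] tc zc z'c zt z't.
have oD := @open_unit_disc R.
have [cu cv] := cr_continuous oD uv; have [Cu Cv CR] := uv.
pose E := whitney_disc c t.
have mE : measurable E.
  by apply: measurableI; exact: measurable_open_disc.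
have r1 : 1 - t / 8 <= 1 by lra.
have ED : E `<=` @unit_disc R by move=> y [_ /(open_ball_unit_disc r1)].
have mus := measurable_norm_powR s oD cu.
have mD := @measurable_unit_disc R.
have musE : measurable_fun E (fun y => `|u y| `^ s) by exact: measurable_funS mus.
have musEE : measurable_fun E (fun y => (`|u y| `^ s)%:E) by exact/measurable_EFinP.
have KD : [set y : R * R | modulus (y - 0) <= 1 - t / 8] `<=` @unit_disc R.
  by move=> y /=; rewrite subr0 /unit_disc/= => h; lra.
have [M M0 HM] := compact_continuous_bounded cu KD (@compact_disc R 0 _).
(* Finiteness holds because the region stays away from the circle, where [u] is bounded. *)
have fin : (\int[area R]_(y in E) (`|u y| `^ s)%:E < +oo)%E.
  apply: (@le_lt_trans _ _ (\int[area R]_(y in E) (M `^ s)%:E)%E).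
    apply: ge0_le_integral => //.
    - move=> y [_ yE]; rewrite lee_fin; apply: ge0_ler_powR; rewrite ?nnegrE ?(ltW s0)//.
      by apply: HM; exact: ltW.
  rewrite (integral_cst _ mE) lte_mul_pinfty ?lee_fin ?powR_ge0//.
  have t11 : 0 < 11 * t by rewrite mulr_gt0.
  have h := area_disc_le c t11; apply: le_lt_trans (le_lt_trans h (ltry _)).
  by apply: le_measure; rewrite ?inE//; [exact: measurable_open_disc|move=> y []].
have int0 : (0 <= \int[area R]_(y in E) (`|u y| `^ s)%:E)%E.
  by apply: integral_ge0 => y _; rewrite lee_fin powR_ge0.
case Ea : (\int[area R]_(y in E) (`|u y| `^ s)%:E)%E fin int0 => [a||]//= _ a0.
rewrite lee_fin in a0.
pose rho := t / 8; have rho0 : 0 < rho by rewrite divr_gt0.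
(* The bound for [|u|] near every point of the segment, obtained from [local_sup_bound]; its p-th
   power is a q-th power of [a] because [p / s = q]. *)
pose U := (A * a / rho ^+ 2) `^ s^-1.
have rho2 : 0 < rho ^+ 2 by rewrite exprn_gt0.
have seg x : 0 <= x <= 1 -> let y := z + x *: (z' - z) in
    [/\ unit_disc y, `|partial_x v y| <= N * U / rho & `|partial_y v y| <= N * U / rho].
  move=> x01 /=; set y := z + _.
  have yc : modulus (y - c) <= 10 * t by exact: modulus_segment.
  have yt : modulus y <= 1 - t / 4.
    by have := @modulus_segment z z' 0 (1 - t / 4) x x01; rewrite !subr0; apply.
  have near y' : modulus (y' - y) <= rho -> modulus y' <= 1 - t / 8.
    move=> h; rewrite -[y'](subrK y); apply: (le_trans (modulusD _ _)).
    by rewrite /rho in h; lra.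
  have yD y' : modulus (y' - y) <= rho -> unit_disc y'.
    by move=> /near h; rewrite /unit_disc/=; lra.
  have yE : open_disc y rho `<=` E.
    move=> y' y'y; split.
      rewrite /open_disc/=; apply: (le_lt_trans (modulus_dist y' c y)).
      by have : modulus (y' - y) < rho by []; rewrite /rho; lra.
    rewrite /open_disc/= subr0 -[y'](subrK y); apply: (le_lt_trans (modulusD _ _)).
    by have : modulus (y' - y) < rho by []; rewrite /rho; lra.
  have uU y' : modulus (y' - y) <= rho / 2 -> `|u y'| <= U.
    move=> h; have := HA _ u v y rho y' oD uv rho0 yD h.
    have le1 : (\int[area R]_(z in open_disc y rho) (`|u z| `^ s)%:E <= a%:E)%E.
      by rewrite -Ea; apply: (ge0_subset_integral _ (measurable_open_disc _ _) mE musEE).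
    have AE : (0 <= A%:E)%E by rewrite lee_fin ltW.
    move=> h1; have := le_trans h1 (lee_wpmul2l AE le1).
    rewrite -EFinM lee_fin -ler_pdivlMl// => h2.
    have : (`|u y'| `^ s) `^ s^-1 <= U.
      apply: ge0_ler_powR; rewrite ?nnegrE ?powR_ge0 ?invr_ge0 ?(ltW s0)//.
        by rewrite divr_ge0 ?(ltW rho2)// mulr_ge0// ltW.
      by rewrite mulrC.
    by rewrite -powRrM divff ?gt_eqF// powRr1.
  have [h1 h2] := HN _ u v y rho U oD uv rho0 yD uU.
  by split => //; apply: yD; rewrite subrr modulus0 ltW.
have U0 : 0 <= U by exact: powR_ge0.
have osc : `|v z' - v z| <= L * U.
  apply: (le_trans (C1_dist_le oD Cv seg)).
  have m1 := abs1_le_modulus (z' - z); have m2 := abs2_le_modulus (z' - z).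
  have m3 := modulus_dist z' z c; rewrite (modulusB c z) in m3.
  apply: (@le_trans _ _ (N * U / rho * (40 * t))).
    have NU0 : 0 <= N * U / rho by rewrite divr_ge0 ?(ltW rho0)// mulr_ge0// ltW.
    apply: (ler_wpM2l NU0).
    by move: m1 m2 => /= m1 m2; lra.
  suff -> : N * U / rho * (40 * t) = L * U by exact: lexx.
  have tn : t != 0 by rewrite gt_eqF.
  by move: (U) => U'; rewrite /L /rho; field.
have t11 : 0 < 11 * t by rewrite mulr_gt0.
have /andP[b1 b2] := fine_area_disc c t11.
have := BB_hoelder q1 C0 mw w0 BB tc mE _ musE _ a0.
set b := fine _ in b1 b2 * => H.
have b0 : 0 < b by apply: lt_le_trans b1; rewrite exprn_gt0.
have {H} : (((a / b) `^ q)%:E *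
   \int[area R]_(z in open_disc c (11 * t)%R `&` unit_disc (R:=R)) (w z)%:E <=
   (2 `^ q * C)%:E * \int[area R]_(z in E) (`|u z| `^ p * w z)%:E)%E.
  have -> : (\int[area R]_(z in E) (`|u z| `^ p * w z)%:E =
     \int[area R]_(z in E) ((`|u z| `^ s) `^ q * w z)%:E)%E.
    by apply: eq_integral => y _; rewrite -powRrM /s divfK// gt_eqF.
  apply: H; last by rewrite Ea.
  - by move=> y Ey; split; [case: Ey|exact: ED].
  - by move=> y _; exact: powR_ge0.
have osc2 : `|v z' - v z| `^ p <= L `^ p * B `^ q * (a / b) `^ q.
  apply: (@le_trans _ _ ((L * U) `^ p)).
    apply: ge0_ler_powR; rewrite ?nnegrE ?(ltW p0)//.
    by rewrite mulr_ge0// ltW.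
  rewrite powRM ?(ltW L0)// -mulrA ler_wpM2l ?powR_ge0//.
  rewrite /U -powRrM -powRM ?(ltW B0) ?divr_ge0 ?(ltW b0)//.
  have -> : s^-1 * p = q by rewrite /s; field; rewrite !gt_eqF.
  have ab0 : 0 <= a / b by rewrite divr_ge0// ltW.
  apply: ge0_ler_powR; rewrite ?nnegrE ?(ltW q0)//.
  - by rewrite divr_ge0 ?(ltW rho2)// mulr_ge0// ltW.
  - by rewrite mulr_ge0// ltW.
  rewrite ler_pdivrMr// /B -!mulrA ler_pM2l// [a in leLHS](_ : a = a / b * b); last first.
    by rewrite divfK// gt_eqF.
  have -> : 64 * (4 * (11 * (11 * (a * (b^-1 * rho ^+ 2))))) = a / b * (4 * (11 * t) ^+ 2).
    by rewrite /rho; field; rewrite gt_eqF.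
  by rewrite ler_wpM2l.
move=> H.
have w_ge0 : (0 <= \int[area R]_(y in open_disc c (11 * t)%R `&` unit_disc (R:=R)) (w y)%:E)%E.
  by apply: integral_ge0 => y _; rewrite lee_fin ltW.
apply: (@le_trans _ _ ((L `^ p * B `^ q * (a / b) `^ q)%:E *
   \int[area R]_(y in open_disc c (11 * t)%R `&` unit_disc (R:=R)) (w y)%:E)%E).
  by apply: lee_wpmul2r => //; rewrite lee_fin.
rewrite EFinM -muleA (EFinM (L `^ p * B `^ q)) -[leRHS]muleA.
apply: lee_wpmul2l H.
by rewrite lee_fin mulr_ge0// powR_ge0.
Qed.

End Oscillation.

(** * Summation lemmas *)

(** All members of [P] lie in the window of length [k] that starts at the least one. *)
Lemma count_close (P : pred nat) (k n : nat) :
  (forall i j, P i -> P j -> (i <= j)%N -> (j < i + k)%N) ->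
  (\sum_(0 <= i < n) P i <= k)%N.
Proof.
move=> H; have -> : (\sum_(0 <= i < n) P i = count P (index_iota 0 n))%N.
  by rewrite -sum1_count [RHS]big_mkcond; apply: eq_bigr => i _; case: (P i).
rewrite -size_filter.
have [/hasP[j _ Pj]|hn] := boolP (has P (index_iota 0 n)); last first.
  by move: hn; rewrite has_count -leqNgt leqn0 size_filter => /eqP ->.
have exP : exists i, P i by exists j.
have := uniq_leq_size (s1 := seq.filter P (index_iota 0 n)) (s2 := iota (ex_minn exP) k).
rewrite size_iota; apply; first by rewrite filter_uniq// iota_uniq.
move=> i; rewrite mem_filter mem_iota => /andP[Pi _].
case: ex_minnP => i0 Pi0 /(_ i Pi) i0i; rewrite i0i/=.
exact: H.
Qed.

Lemma sum_nat_double (V : zmodType) (F : nat -> V) n :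
  \sum_(0 <= i < n.*2) F i = \sum_(0 <= i < n) (F i.*2 + F i.*2.+1).
Proof.
elim: n => [|n IH]; first by rewrite !big_geq.
by rewrite doubleS !big_nat_recr//= IH addrA.
Qed.

Section Generic.
Variable R : realType.

(** With [(1 + d)^p = 1 + e], either [|y - x| <= d |x|], or [|x|] is less than [|y - x| / d]. A
    leading factor arbitrarily close to 1 is what the geometric decay can afford, and the argument
    covers [p < 1]. *)
Lemma powR_almost_add (p e : R) : 0 < p -> 0 < e -> exists2 K, 0 < K &
  forall x y : R, `|y| `^ p <= (1 + e) * `|x| `^ p + K * `|y - x| `^ p.
Proof.
move=> p0 e0; pose d := (1 + e) `^ p^-1 - 1.
have e1 : 1 < 1 + e by lra.
have d1 : 1 < (1 + e) `^ p^-1.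
  have := @gt0_ltr_powR R p^-1; rewrite invr_gt0 => /(_ p0 1 (1 + e)).
  by rewrite !nnegrE ler01 powR1; apply => //; lra.
have d0 : 0 < d by rewrite subr_gt0.
have dE : (1 + d) `^ p = 1 + e.
  by rewrite /d addrC subrK -powRrM mulVf ?gt_eqF// powRr1//; lra.
exists ((1 + d^-1) `^ p); first by rewrite powR_gt0// ltr_pwDl ?invr_ge0 ?ltW.
move=> x y.
have yx : `|y| <= `|x| + `|y - x|.
  by rewrite -[y in leLHS](subrK x) addrC; exact: ler_normD.
have di : 0 <= d^-1 by rewrite invr_ge0 ltW.
have [h|h] := leP `|y - x| (d * `|x|).
  apply: (@le_trans _ _ (((1 + d) * `|x|) `^ p)).
    apply: ge0_ler_powR; rewrite ?nnegrE ?(ltW p0)//; first by rewrite mulr_ge0//; lra.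
    by apply: (le_trans yx); rewrite mulrDl mul1r lerD2l.
  rewrite powRM//; last by lra.
  by rewrite dE lerDl mulr_ge0// powR_ge0.
apply: (@le_trans _ _ (((1 + d^-1) * `|y - x|) `^ p)).
  apply: ge0_ler_powR; rewrite ?nnegrE ?(ltW p0)//; first by rewrite mulr_ge0// addr_ge0.
  apply: (le_trans yx); rewrite mulrDl mul1r addrC lerD2l.
  by rewrite ler_pdivlMl// ltW.
rewrite powRM// ?addr_ge0// lerDr mulr_ge0// ?powR_ge0//; lra.
Qed.

Lemma geometric_sum_bound (E G : nat -> R) (r : R) n :
  0 <= r < 1 -> (forall m, 0 <= E m) -> (forall m, E m.+1 <= r * E m + G m) ->
  (1 - r) * \sum_(0 <= m < n) E m <= E 0%N + \sum_(0 <= m < n) G m.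
Proof.
move=> /andP[r0 r1] E0 EG.
(* Keeping [E n] on the left makes the induction close. *)
suff : (1 - r) * \sum_(0 <= m < n) E m + E n <= E 0%N + \sum_(0 <= m < n) G m.
  by apply: le_trans; rewrite lerDl.
elim: n => [|n IH]; first by rewrite !big_geq// mulr0 addr0 add0r.
by rewrite !big_nat_recr//=; have := EG n; move: IH; lra.
Qed.

Section SumIntegral.
Context d (T : measurableType d).
Variable mu : {measure set T -> \bar R}.
Variables (D : set T) (h : T -> R).
Hypothesis mD : measurable D.
Hypothesis mh : measurable_fun D h.
Hypothesis h0 : forall z, D z -> 0 <= h z.

Lemma sum_integral (I : Type) (s : seq I) (V : I -> set T) :
  (forall k, measurable (V k)) -> (forall k, V k `<=` D) ->
  (\sum_(k <- s) \int[mu]_(z in V k) (h z)%:E =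
   \int[mu]_(z in D) (h z * \sum_(k <- s) \1_(V k) z)%:E)%E.
Proof.
move=> mV VD.
pose f k z := (h z * \1_(V k) z)%:E.
have mf k : measurable_fun D (f k).
  by apply/measurable_EFinP; apply: measurable_funM.
have f0 k z : D z -> (0 <= f k z)%E by move=> Dz; rewrite lee_fin mulr_ge0// h0.
transitivity (\sum_(k <- s) \int[mu]_(z in D) f k z)%E.
  apply: eq_bigr => k _.
  rewrite -{1}(setIidr (VD k)) integral_mkcondr; apply: eq_integral => z _.
  rewrite patchE /f indicE; case: ifPn => _; first by rewrite mulr1.
  by rewrite mulr0.
rewrite -ge0_integral_sum//; apply: eq_integral => z _.
by rewrite /f sumEFin big_distrr.
Qed.

Lemma sum_integral_le (I : Type) (s : seq I) (V : I -> set T) (N : R) :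
  (forall k, measurable (V k)) -> (forall k, V k `<=` D) -> 0 <= N ->
  (forall z, D z -> \sum_(k <- s) \1_(V k) z <= N) ->
  (\sum_(k <- s) \int[mu]_(z in V k) (h z)%:E <= N%:E * \int[mu]_(z in D) (h z)%:E)%E.
Proof.
move=> mV VD N0 HN; rewrite sum_integral//.
have mhE : measurable_fun D (fun z => (h z)%:E) by exact/measurable_EFinP.
have hE z : D z -> (0 <= (h z)%:E)%E by move=> Dz; rewrite lee_fin h0.
rewrite -(ge0_integralZl_EFin mu mD hE mhE N0).
apply: ge0_le_integral => //.
- move=> z Dz; rewrite lee_fin mulr_ge0 ?h0// sumr_ge0//.
- by apply/measurable_EFinP; apply: measurable_funM => //; apply: measurable_sum => k; exact: measurable_indic.
- by apply: measurable_funeM.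
- by move=> z Dz; rewrite -EFinM lee_fin mulrC ler_wpM2r ?h0// HN.
Qed.

Lemma integral_cover_le (I : eqType) (s : seq I) (V : I -> set T) (A : set T) :
  (forall k, measurable (V k)) -> (forall k, V k `<=` D) -> measurable A -> A `<=` D ->
  (forall z, A z -> exists2 k, k \in s & V k z) ->
  (\int[mu]_(z in A) (h z)%:E <= \sum_(k <- s) \int[mu]_(z in V k) (h z)%:E)%E.
Proof.
move=> mV VD mA AD AV; rewrite sum_integral//.
have mS : measurable_fun D (fun z => (h z * \sum_(k <- s) \1_(V k) z)%:E).
  by apply/measurable_EFinP; apply: measurable_funM => //; apply: measurable_sum => k; exact: measurable_indic.
have S0 z : D z -> (0 <= (h z * \sum_(k <- s) \1_(V k) z)%:E)%E.
  by move=> Dz; rewrite lee_fin mulr_ge0 ?h0// sumr_ge0.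
apply: le_trans (ge0_subset_integral mu mA mD mS S0 AD).
apply: ge0_le_integral => //.
- by move=> z /AD Dz; rewrite lee_fin h0.
- by apply/measurable_EFinP; exact: measurable_funS mh.
- exact: measurable_funS mS.
move=> z Az; have hz := h0 (AD _ Az); rewrite lee_fin -[leLHS]mulr1 ler_wpM2l//.
have [k ks Vkz] := AV z Az.
by rewrite (big_rem k ks)/= indicE mem_set// lerDl sumr_ge0.
Qed.

End SumIntegral.
End Generic.

(** * Carleson boxes *)

Section Geometry.
Variable R : realType.
Implicit Types (c z e : R * R).

(* Coordinates in the frame [(e, i e)], where [e] is a unit vector. *)
Definition along e z : R := e.1 * z.1 + e.2 * z.2.
Definition across e z : R := e.1 * z.2 - e.2 * z.1.

Lemma sqr_frame e z : modulus e = 1 ->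
  along e z ^+ 2 + across e z ^+ 2 = z.1 ^+ 2 + z.2 ^+ 2.
Proof.
move=> e1; have := sqr_modulus e; rewrite e1 expr1n => e2.
rewrite -[RHS]mul1r e2 /along /across; ring.
Qed.

Lemma modulus_frame e z : modulus e = 1 ->
  modulus z = Num.sqrt (along e z ^+ 2 + across e z ^+ 2).
Proof. by move=> e1; rewrite sqr_frame. Qed.

Lemma sqr_modulus_frame e z : modulus e = 1 ->
  modulus z ^+ 2 = along e z ^+ 2 + across e z ^+ 2.
Proof. by move=> e1; rewrite sqr_frame// sqr_modulus. Qed.

Lemma alongB e z c : along e (z - c) = along e z - along e c.
Proof. by rewrite /along /=; ring. Qed.

Lemma acrossB e z c : across e (z - c) = across e z - across e c.
Proof. by rewrite /across /=; ring. Qed.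

Lemma along_le e z : modulus e = 1 -> `|along e z| <= modulus z.
Proof.
move=> e1; rewrite -(ler_pXn2r (_ : (0 < 2)%N)) ?nnegrE ?modulus_ge0//.
by rewrite real_normK ?num_real// (sqr_modulus_frame _ e1) lerDl sqr_ge0.
Qed.

Lemma across_le e z : modulus e = 1 -> `|across e z| <= modulus z.
Proof.
move=> e1; rewrite -(ler_pXn2r (_ : (0 < 2)%N)) ?nnegrE ?modulus_ge0//.
by rewrite real_normK ?num_real// (sqr_modulus_frame _ e1) lerDr sqr_ge0.
Qed.

Lemma modulus_le_frame e z : modulus e = 1 ->
  modulus z <= `|along e z| + `|across e z|.
Proof.
move=> e1; rewrite -(ler_pXn2r (_ : (0 < 2)%N)) ?nnegrE ?modulus_ge0 ?addr_ge0//.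
rewrite (sqr_modulus_frame _ e1) [in leRHS]sqrrD !real_normK ?num_real//.
by rewrite lerD2r lerDl mulrn_wge0// mulr_ge0.
Qed.

(* The point at height [y] above the axis [e], at distance [r] from 0. *)
Definition frame_point e (r y : R) : R * R :=
  let x := Num.sqrt (r ^+ 2 - y ^+ 2) in
  (e.1 * x - e.2 * y, e.2 * x + e.1 * y).

Lemma along_frame_point e r y : modulus e = 1 ->
  along e (frame_point e r y) = Num.sqrt (r ^+ 2 - y ^+ 2).
Proof.
move=> e1; have := sqr_modulus e; rewrite e1 expr1n => e2.
by rewrite -[RHS]mul1r e2 /along /frame_point/=; ring.
Qed.

Lemma across_frame_point e r y : modulus e = 1 ->
  across e (frame_point e r y) = y.
Proof.
move=> e1; have := sqr_modulus e; rewrite e1 expr1n => e2.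
by rewrite -[RHS]mul1r e2 /across /frame_point/=; ring.
Qed.

Lemma modulus_frame_point e r y : modulus e = 1 -> 0 <= r -> `|y| <= r ->
  modulus (frame_point e r y) = r.
Proof.
move=> e1 r0 yr; rewrite (modulus_frame _ e1) along_frame_point// across_frame_point//.
rewrite sqr_sqrtr ?subrK ?sqrtr_sqr ?ger0_norm//.
by rewrite subr_ge0 -[leLHS]real_normK ?num_real// ler_pXn2r ?nnegrE.
Qed.

(* [carleson_box e t y] lies over the arc at heights [[y, y + t[] and reaches
   depth [t]; [top_half e t y] is its part at depth more than [t / 2]. *)
Definition carleson_box e (t y : R) : set (measurableTypeR R * measurableTypeR R) :=
  [set z | [/\ modulus z < 1, 1 - t <= modulus z, 0 < along e z,
     y <= across e z & across e z < y + t]].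

Definition top_half e (t y : R) : set (measurableTypeR R * measurableTypeR R) :=
  carleson_box e t y `&` [set z | modulus z < 1 - t / 2].

(** The middle of the top half: depth [3 t / 4] is halfway between [t / 2] and [t]. *)
Definition center e (t y : R) : R * R := frame_point e (1 - 3 / 4 * t) (y + t / 2).

Section Box.
Variables (e : R * R) (t y : R).
Hypothesis e1 : modulus e = 1.
Hypothesis t0 : 0 < t.
Hypothesis t8 : t <= 1 / 8.
Hypothesis y1 : - (3 / 4) <= y.
Hypothesis y2 : y + t <= 3 / 4.

Lemma modulus_center : modulus (center e t y) = 1 - 3 / 4 * t.
Proof.
have [h1 h2 h3 h4] := And4 t0 t8 y1 y2.
by apply: modulus_frame_point => //; [lra|rewrite ler_norml; apply/andP; split; lra].
Qed.

Lemma across_center : across e (center e t y) = y + t / 2.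
Proof. exact: across_frame_point. Qed.

(** The modulus is at least [29 / 32] and the height at most [3 / 4]. Staying away from 0 allows the
    division in [box_near_center]. *)
Lemma along_center : 2 / 5 <= along e (center e t y).
Proof.
have [h1 h2 h3 h4] := And4 t0 t8 y1 y2.
rewrite /center along_frame_point// -[leLHS]ger0_norm// -sqrtr_sqr ler_wsqrtr//.
have a1 : (29 / 32) ^+ 2 <= (1 - 3 / 4 * t) ^+ 2.
  by rewrite ler_pXn2r ?nnegrE//; lra.
have a2 : (y + t / 2) ^+ 2 <= (3 / 4) ^+ 2.
  rewrite -real_normK ?num_real// ler_pXn2r ?nnegrE//.
  by rewrite ler_norml; apply/andP; split; lra.
by move: a1 a2; rewrite !expr_div_n; lra.
Qed.

(** Modulus and height vary by [O(t)] over the box; the coordinate along [e] is recovered from the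
    difference of squares [(X - X') (X + X')], which is at most [3 t] while [X + X' >= 2 / 5].
    Adding the height difference gives [10 t] with room to spare. *)
Lemma box_near_center z : carleson_box e t y z -> modulus (z - center e t y) <= 10 * t.
Proof.
have [h1 h2 h3 h4] := And4 t0 t8 y1 y2.
case=> z1 z2 zx zy1 zy2.
have hA := along_center; have hB := across_center; have hM := modulus_center.
set c := center e t y in hA hB hM *.
apply: (le_trans (modulus_le_frame _ e1)); rewrite alongB acrossB hB.
have acr : `|across e z - (y + t / 2)| <= t by rewrite ler_norml; apply/andP; split; lra.
suff alo : `|along e z - along e c| <= 9 * t by lra.
have s1 := sqr_modulus_frame z e1; have s2 := sqr_modulus_frame c e1.
rewrite hM hB in s2.
set X := along e z in zx s1 *; set X' := along e c in hA s2 *; set Y := across e z in zy1 zy2 s1 acr *.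
set r := modulus z in z1 z2 s1.
have E : (X - X') * (X + X') = (r - (1 - 3 / 4 * t)) * (r + (1 - 3 / 4 * t)) -
    (Y - (y + t / 2)) * (Y + (y + t / 2)).
  have -> : (X - X') * (X + X') = X ^+ 2 - X' ^+ 2 by ring.
  have -> : X ^+ 2 = r ^+ 2 - Y ^+ 2 by rewrite s1; ring.
  have -> : X' ^+ 2 = (1 - 3 / 4 * t) ^+ 2 - (y + t / 2) ^+ 2 by rewrite s2; ring.
  by ring.
have b1 : `|(r - (1 - 3 / 4 * t)) * (r + (1 - 3 / 4 * t))| <= 3 / 4 * t * 2.
  rewrite normrM ler_pM//; first by rewrite ler_norml; apply/andP; split; lra.
  by rewrite ler_norml; apply/andP; split; lra.
have b2 : `|(Y - (y + t / 2)) * (Y + (y + t / 2))| <= t * (3 / 2).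
  rewrite normrM ler_pM//; by rewrite ler_norml; apply/andP; split; lra.
have b3 : `|(X - X') * (X + X')| <= 3 * t.
  by rewrite E; apply: (le_trans (ler_normB _ _)); lra.
have XX : 2 / 5 <= `|X + X'| by rewrite ger0_norm; lra.
have : `|X - X'| * (2 / 5) <= 3 * t.
  by apply: le_trans b3; rewrite normrM ler_wpM2l.
lra.
Qed.

Lemma disc_in_top z : modulus (z - center e t y) < t / 8 -> top_half e t y z.
Proof.
have [h1 h2 h3 h4] := And4 t0 t8 y1 y2.
move=> zc; have hA := along_center; have hB := across_center; have hM := modulus_center.
set c := center e t y in zc hA hB hM *.
have d1 := le_lt_trans (modulus_diff z c) zc; rewrite hM in d1.
have d2 := le_lt_trans (along_le (z - c) e1) zc; rewrite alongB in d2.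
have d3 := le_lt_trans (across_le (z - c) e1) zc; rewrite acrossB hB in d3.
move: d1 d2 d3; rewrite !ltr_norml => /andP[? ?] /andP[? ?] /andP[? ?].
by split => /=; [split|]; lra.
Qed.

Lemma touches_center : touches_circle (center e t y) (11 * t).
Proof.
have [h1 h2 h3 h4] := And4 t0 t8 y1 y2.
have hM := modulus_center; set c := center e t y in hM *.
split; first lra.
have m0 : 0 < 1 - 3 / 4 * t by lra.
exists ((1 - 3 / 4 * t)^-1 *: c); split.
  apply: subset_closure; rewrite /open_disc/=.
  have -> : (1 - 3 / 4 * t)^-1 *: c - c = ((1 - 3 / 4 * t)^-1 - 1) *: c.
    by rewrite scalerBl scale1r.
  rewrite modulusZ hM -[X in _ * X](gtr0_norm m0) -normrM mulrBl mulVf ?gt_eqF// mul1r.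
  by rewrite ger0_norm; lra.
by rewrite /unit_circle/= modulusZ hM gtr0_norm ?invr_gt0// mulVf// gt_eqF.
Qed.

End Box.

Lemma box_child1 e (t y : R) z : 0 < t -> carleson_box e (t / 2) y z -> carleson_box e t y z.
Proof. by move=> t0 [z1 z2 zx zy1 zy2]; split => //; lra. Qed.

Lemma box_child2 e (t y : R) z : 0 < t ->
  carleson_box e (t / 2) (y + t / 2) z -> carleson_box e t y z.
Proof. by move=> t0 [z1 z2 zx zy1 zy2]; split => //; lra. Qed.

Lemma child_not_top e (t y y' : R) z : carleson_box e (t / 2) y' z -> ~ top_half e t y z.
Proof. by move=> [_ h _ _ _] [_ /=]; lra. Qed.

Lemma continuous_along e : continuous (along e).
Proof.
move=> z; apply: cvgD; apply: cvgM; try exact: cvg_cst; [exact: cvg_fst|exact: cvg_snd].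
Qed.

Lemma continuous_across e : continuous (across e).
Proof.
move=> z; apply: cvgB; apply: cvgM; try exact: cvg_cst; [exact: cvg_snd|exact: cvg_fst].
Qed.

Lemma continuous_measurable_plane (f : R * R -> R) : continuous f ->
  measurable_fun ([set: measurableTypeR R * measurableTypeR R]) f.
Proof.
by move=> cf; apply: (@continuous_on_measurable R setT); [exact: openT|move=> z _; exact: cf].
Qed.

Lemma measurable_carleson_box e t y : measurable (carleson_box e t y).
Proof.
have mm := continuous_measurable_plane (@continuous_modulus R).
have ma := continuous_measurable_plane (@continuous_along e).
have mc := continuous_measurable_plane (@continuous_across e).
have -> : carleson_box e t y =
   ((@modulus R) @^-1` `[1 - t, 1[%classic) `&`
     ((along e @^-1` `]0, +oo[%classic) `&` (across e @^-1` `[y, y + t[%classic)).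
  apply/seteqP; split => z /=; rewrite !in_itv/= ?andbT.
    by case=> h1 h2 h3 h4 h5; split; [apply/andP|split; [|apply/andP]].
  by case=> /andP[h1 h2] [h3 /andP[h4 h5]].
have pre (f : measurableTypeR R * measurableTypeR R -> R) (A : set (measurableTypeR R)) :
    measurable_fun setT f -> measurable A -> measurable (f @^-1` A).
  by move=> mf mA; rewrite -[_ @^-1` _]setTI; exact: mf.
by apply: measurableI; [|apply: measurableI]; apply: pre.
Qed.

Lemma measurable_modulus_lt (r : R) : measurable
  ([set z | modulus z < r] : set (measurableTypeR R * measurableTypeR R)).
Proof.
have := measurable_open_disc (0 : R * R) r; rewrite /open_disc.
by under eq_set do rewrite subr0.
Qed.

Lemma measurable_top_half e t y : measurable (top_half e t y).
Proof.
by apply: measurableI; [exact: measurable_carleson_box|exact: measurable_modulus_lt].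
Qed.

(** The four closed quarter-planes about the half-axes cover the plane; this takes the place of an
    angular coordinate. *)
Lemma frame_cover z : exists2 e, e \in [:: (1, 0); (0, 1); (-1, 0); (0, -1)] &
  `|across e z| <= along e z.
Proof.
case: z => x y.
have [h|h] := leP `|y| `|x|.
  have [x0|x0] := leP 0 x.
    exists (1, 0); first by rewrite inE eqxx.
    by rewrite /across /along/= !mul1r !mul0r subr0 addr0 -(ger0_norm x0).
  exists (-1, 0); first by rewrite !inE eqxx ?orbT.
  rewrite /across /along/= !mulN1r !mul0r subr0 addr0 normrN.
  by rewrite (le_trans h)// ltr0_norm.
have [y0|y0] := leP 0 y.
  exists (0, 1); first by rewrite !inE eqxx ?orbT.
  rewrite /across /along/= !mul1r !mul0r sub0r add0r normrN.
  by rewrite (le_trans (ltW h))// ger0_norm.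
exists (0, -1); first by rewrite !inE eqxx ?orbT.
rewrite /across /along/= !mulN1r !mul0r opprK !add0r.
by rewrite (le_trans (ltW h))// ltr0_norm.
Qed.

Lemma modulus_frames e : e \in [:: (1, 0); (0, 1); (-1, 0); (0, -1) : R * R] -> modulus e = 1.
Proof.
by rewrite !inE => /or4P[] /eqP ->; rewrite /modulus/= ?sqrrN expr1n expr0n/= ?addr0 ?add0r sqrtr1.
Qed.

End Geometry.

(** * Dyadic generations: covering and overlap *)

Section Scales.
Variable R : realType.
Implicit Types (c z e : R * R).

(* Generation [m] has [cells m] boxes of size [scale m]; their heights
   [height m i] partition the interval [[-3/4, 3/4[]. *)
Definition scale (m : nat) : R := (8 * 2 ^+ m)^-1.
Definition cells (m : nat) : nat := (12 * 2 ^ m)%N.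
Definition height (m i : nat) : R := - (3 / 4) + i%:R * scale m.

Lemma scale_gt0 m : 0 < scale m.
Proof. by rewrite invr_gt0 mulr_gt0// exprn_gt0. Qed.

Lemma scale0 : scale 0 = 1 / 8.
Proof. by rewrite /scale expr0 mulr1 div1r. Qed.

Lemma scaleS m : scale m.+1 = scale m / 2.
Proof. by rewrite /scale exprS; field; rewrite expf_neq0. Qed.

Lemma scaleD m k : scale (m + k) = scale m / 2 ^+ k.
Proof. by rewrite /scale exprD; field; rewrite !expf_neq0. Qed.

Lemma scale_le m k : (m <= k)%N -> scale k <= scale m.
Proof.
move=> mk; rewrite -(subnKC mk) scaleD ler_pdivrMr ?exprn_gt0//.
by rewrite ler_peMr ?(ltW (scale_gt0 _))// exprn_ege1// ler1n.
Qed.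

Lemma scale_le8 m : scale m <= 1 / 8.
Proof. by rewrite -scale0; exact: scale_le. Qed.

Lemma cells_scale m : (cells m)%:R * scale m = 3 / 2.
Proof. by rewrite /cells natrM natrX /scale; field; rewrite expf_neq0. Qed.

Lemma cellsS m : cells m.+1 = (cells m).*2.
Proof. by rewrite /cells expnS mulnCA mul2n. Qed.

Lemma height_double m i : height m.+1 i.*2 = height m i.
Proof. by rewrite /height scaleS -mul2n natrM; field. Qed.

Lemma height_doubleS m i : height m.+1 i.*2.+1 = height m i + scale m / 2.
Proof. by rewrite /height scaleS -mul2n -(natr1 (2 * i)%N) natrM; field. Qed.

Lemma height_bounds m i : (i < cells m)%N ->
  - (3 / 4) <= height m i /\ height m i + scale m <= 3 / 4.
Proof.
move=> im; have s0 := scale_gt0 m; split.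
  by rewrite /height lerDl mulr_ge0// ltW.
have : (i.+1)%:R * scale m <= (cells m)%:R * scale m.
  by rewrite ler_pM2r// ler_nat.
by rewrite cells_scale /height -(natr1 i) mulrDl mul1r; lra.
Qed.

Lemma nat_bracket (n : nat) (x : R) : 0 <= x < n%:R ->
  exists2 i, (i < n)%N & i%:R <= x < i.+1%:R.
Proof.
elim: n => [|n IH] /andP[x0 xn]; first by move: xn; rewrite ltNge x0.
have [h|h] := ltP x n%:R.
  have [|i i_n ix] := IH; first by rewrite x0.
  by exists i => //; exact: ltnW.
by exists n => //; rewrite h.
Qed.

Lemma scale_bracket (M : nat) (d : R) : scale M < d <= scale 0 ->
  exists2 m, (m < M)%N & scale m.+1 < d <= scale m.
Proof.
elim: M => [|M IH] /andP[d1 d2]; first by move: d1; rewrite ltNge d2.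
have [h|h] := ltP (scale M) d.
  have [|m mM md] := IH; first by rewrite h.
  by exists m => //; exact: ltnW.
by exists M => //; rewrite d1.
Qed.

Lemma box_cover (M : nat) z : 7 / 8 <= modulus z -> modulus z < 1 - scale M ->
  exists e m i, [/\ e \in [:: (1, 0); (0, 1); (-1, 0); (0, -1)],
    (m < M)%N, (i < cells m)%N & top_half e (scale m) (height m i) z].
Proof.
move=> z7 zM; have [e eF acr] := frame_cover z.
have e1 := modulus_frames eF.
have hs := sqr_modulus_frame z e1.
have z1 : modulus z < 1 by have := scale_gt0 M; lra.
have al0 : 0 < along e z.
  rewrite lt_neqAle (le_trans _ acr)// andbT eq_sym; apply/eqP => a0.
  move: acr hs; rewrite a0 normr_le0 => /eqP ->; rewrite expr0n/= addr0 => /eqP.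
  by rewrite sqrf_eq0 => /eqP h; move: z7; rewrite h; lra.
(* Twice the squared height is at most the squared modulus, and [1 / 2 < (3 / 4)^2]. *)
have ac : `|across e z| < 3 / 4.
  rewrite -(ltr_pXn2r (_ : (0 < 2)%N)) ?nnegrE//.
  have h1 : `|across e z| ^+ 2 <= along e z ^+ 2 by rewrite ler_pXn2r ?nnegrE ?(ltW al0).
  have h2 : modulus z ^+ 2 < 1 by rewrite expr_lt1 ?modulus_ge0.
  move: h1; rewrite hs in h2; rewrite real_normK ?num_real// expr_div_n; lra.
have [|m mM /andP[m1 m2]] := @scale_bracket M (1 - modulus z).
  by rewrite scale0; apply/andP; split; lra.
have s0 := scale_gt0 m.
move: ac; rewrite ltr_norml => /andP[ac1 ac2].
have [|i im /andP[i1 i2]] := @nat_bracket (cells m) ((across e z + 3 / 4) / scale m).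
  rewrite divr_ge0 ?(ltW s0)//=; last by lra.
  by rewrite ltr_pdivrMr// cells_scale; lra.
exists e, m, i; split => //.
move: i1 i2; rewrite ler_pdivlMr// ltr_pdivrMr// -(natr1 i) mulrDl mul1r => i1 i2.
rewrite scaleS in m1.
by split; [split => //; rewrite ?/height; lra|rewrite /=; lra].
Qed.

(** Within one generation the height of [z] is less than [11 t] from the middle height, so fewer
    than 22 steps separate two hits. Across generations the depth of [z] lies between [t / 8] and
    [12 t], so two scales differ by a factor below 96, and [96 < 2^7]. *)
Lemma whitney_overlap (M : nat) e z : modulus e = 1 ->
  \sum_(0 <= m < M) \sum_(0 <= i < cells m)
    \1_(whitney_disc (center e (scale m) (height m i)) (scale m)) z <= (22 * 7)%:R :> R.
Proof.
move=> e1.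
pose P1 (m i : nat) := `|across e z - (height m i + scale m / 2)| < 11 * scale m.
pose P2 (m : nat) := scale m / 8 < 1 - modulus z < 12 * scale m.
have step1 m i : (i < cells m)%N ->
   \1_(whitney_disc (center e (scale m) (height m i)) (scale m)) z <= (P1 m i * P2 m)%:R :> R.
  move=> im; have [y1 y2] := height_bounds im.
  have s0 := scale_gt0 m; have s8 := scale_le8 m.
  rewrite indicE; have [/set_mem[zc z0]|_] := boolP (z \in _); last by rewrite ler0n.
  have zc' : modulus (z - center e (scale m) (height m i)) < 11 * scale m by exact: zc.
  have z0' : modulus z < 1 - scale m / 8 by move: z0; rewrite /open_disc/= subr0.
  have hP1 : P1 m i.
    rewrite /P1; have := across_le (z - center e (scale m) (height m i)) e1.
    by rewrite acrossB across_center// => /le_lt_trans; apply.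
  have hP2 : P2 m.
    have := le_lt_trans (modulus_diff z (center e (scale m) (height m i))) zc'.
    rewrite modulus_center// ltr_norml => /andP[h1 h2].
    by rewrite /P2; apply/andP; split; lra.
  by rewrite hP1 hP2.
apply: (@le_trans _ _ (\sum_(0 <= m < M) (22 * P2 m)%:R)).
  rewrite big_nat_cond [leRHS]big_nat_cond; apply: ler_sum => m _.
  apply: (@le_trans _ _ (\sum_(0 <= i < cells m) (P1 m i * P2 m)%:R)).
    rewrite big_nat_cond [leRHS]big_nat_cond; apply: ler_sum => i /andP[/andP[_ im] _].
    exact: step1.
  rewrite -natr_sum ler_nat -big_distrl/= leq_mul2r; apply/orP; right.
  apply: count_close => i j Pi Pj ij.
  have s0 := scale_gt0 m.
  move: Pi Pj; rewrite /P1 /height !ltr_norml => /andP[a1 a2] /andP[b1 b2].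
  have : (j%:R - i%:R) * scale m < 22%:R * scale m :> R by rewrite mulrBl; lra.
  by rewrite ltr_pM2r// ltrBlDr -natrD ltr_nat addnC.
rewrite -natr_sum ler_nat -big_distrr/= leq_mul2l; apply/orP; right.
apply: count_close => i j /andP[a1 a2] /andP[b1 b2] ij.
rewrite ltnNge; apply/negP => ij7.
have := scale_le ij7; rewrite scaleD.
have s0 := scale_gt0 i.
have -> : (2 : R) ^+ 7 = 2 * (8 * 8) by ring.
lra.
Qed.

End Scales.

(** * The weighted norm of the conjugate function *)

Section Core.
Variable R : realType.
Variables (p q C : R) (w : R * R -> R).
Hypothesis p0 : 0 < p.
Hypothesis q1 : 1 < q.
Hypothesis C0 : 0 < C.
Hypothesis mw : measurable_fun
  ([set: measurableTypeR R * measurableTypeR R]) w.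
Hypothesis w0 : forall z, 0 < w z.
Hypothesis BB : forall c r, touches_circle c r ->
  (disc_average (open_disc c r) w *
    disc_average (open_disc c r) (fun z => w z `^ (- (q - 1)^-1))%R `^ (q - 1) <= C%:E)%E.

Local Notation D := (@unit_disc R).
Local Notation plane_set := (set (measurableTypeR R * measurableTypeR R)).

Definition wmass (A : plane_set) : R := fine (\int[area R]_(z in A) (w z)%:E)%E.

Lemma touches_origin (r : R) : 1 < r -> touches_circle 0 r.
Proof.
move=> r1; split; first exact: lt_trans ltr01 r1.
exists (1, 0); split.
  by apply: subset_closure; rewrite /open_disc/= subr0 /modulus/= expr1n expr0n/= addr0 sqrtr1.
by rewrite /unit_circle/= /modulus/= expr1n expr0n/= addr0 sqrtr1.
Qed.

Lemma discI_unit (r : R) : 1 < r -> open_disc 0 r `&` D = D.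
Proof.
move=> r1; apply/setIidr => z; rewrite /unit_disc /open_disc/= subr0 => h.
exact: lt_trans h r1.
Qed.

Lemma wE (z : R * R) : (0 <= (w z)%:E)%E. Proof. by rewrite lee_fin ltW. Qed.

Lemma measurable_wE (A : plane_set) : measurable_fun A (fun z => (w z)%:E).
Proof. by apply/measurable_EFinP; exact: measurable_funTS. Qed.

(** The Bekolle-Bonami condition on the disc of radius 2 about 0, which contains the whole unit
    disc, makes the total mass finite. *)
Lemma integral_w_lty (A : plane_set) : measurable A -> A `<=` D ->
  (\int[area R]_(z in A) (w z)%:E < +oo)%E.
Proof.
move=> mA AD; have mD := @measurable_unit_disc R.
have h := ge0_subset_integral (area R) mA mD (@measurable_wE D) (fun z _ => wE z) AD.
apply: (le_lt_trans h).
have r1 : 1 < 2 :> R by lra.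
have pos : (0 < area R (open_disc 0%R 2%R `&` D))%E.
  rewrite (discI_unit r1) unit_discE.
  by apply: lt_le_trans (area_disc_ge 0 ltr01); rewrite lte_fin expr1n.
have [M [S [_ _ + _ _]]] := BB_dual q1 mw w0 BB (touches_origin r1) pos.
by rewrite (discI_unit r1) => ->; rewrite ltry.
Qed.

Lemma wmassE (A : plane_set) : measurable A -> A `<=` D ->
  (\int[area R]_(z in A) (w z)%:E = (wmass A)%:E)%E.
Proof.
move=> mA AD; rewrite /wmass fineK// ge0_fin_numE ?integral_w_lty//.
by apply: integral_ge0 => z _; exact: wE.
Qed.

Lemma wmass_ge0 (A : plane_set) : 0 <= wmass A.
Proof. by apply: fine_ge0; apply: integral_ge0 => z _; exact: wE. Qed.

Lemma wmass_le (A B : plane_set) : measurable A -> measurable B -> A `<=` B -> B `<=` D ->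
  wmass A <= wmass B.
Proof.
move=> mA mB AB BD; rewrite -lee_fin -!wmassE//; last exact: subset_trans BD.
exact: (ge0_subset_integral (area R) mA mB (@measurable_wE B) (fun z _ => wE z) AB).
Qed.

Lemma wmass_gt0 (A : plane_set) : measurable A -> A `<=` D -> (0 < area R A)%E -> 0 < wmass A.
Proof.
move=> mA AD A0; rewrite -lte_fin -wmassE//.
by apply: integral_pos_gt0 => //; exact: measurable_funTS.
Qed.

Lemma carleson_box_disc e (t y : R) : carleson_box e t y `<=` D.
Proof. by move=> z []. Qed.

Lemma top_half_box e (t y : R) : top_half e t y `<=` carleson_box e t y.
Proof. by move=> z []. Qed.

Definition good_cell (e : R * R) (t y : R) :=
  [/\ modulus e = 1, 0 < t, t <= 1 / 8, - (3 / 4) <= y & y + t <= 3 / 4].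

Local Notation bdisc e t y := (open_disc (center e t y) (11 * t) `&` D).

Lemma box_bdisc e (t y : R) : good_cell e t y -> carleson_box e t y `<=` bdisc e t y.
Proof.
case=> e1 t0 t8 y1 y2 z Qz; split; last by case: Qz.
by rewrite /open_disc/=; apply: le_lt_trans (box_near_center e1 t0 t8 y1 y2 Qz) _; lra.
Qed.

(* The Bekolle-Bonami condition tested on a small disc inside the top half. *)
Lemma mass_top_half : exists2 C1, 1 < C1 & forall e (t y : R), good_cell e t y ->
  0 < wmass (bdisc e t y) /\ wmass (bdisc e t y) <= C1 * wmass (top_half e t y).
Proof.
have q0 : 0 < q by exact: lt_trans ltr01 q1.
(* The quotient of the area bound [4 (11 t)^2] of the large disc by the bound [(t / 8)^2] of the
   small one. *)
pose k : R := (8 * 8) * (4 * (11 * 11)); have k0 : 0 < k by rewrite !mulr_gt0.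
pose C1 := k `^ q * (2 `^ q * C).
have C10 : 0 < C1 by rewrite !mulr_gt0// powR_gt0.
(* Enlarged beyond 1 so that [1 - 1 / C1] is a positive proportion later on. *)
exists (1 + C1); first by rewrite ltrDl.
move=> e t y gc; have [e1 t0 t8 y1 y2] := gc.
have mW := measurable_top_half e t y.
have WD : top_half e t y `<=` D by apply: subset_trans (@carleson_box_disc e t y); exact: top_half_box.
have mB := measurable_discI (center e t y) (11 * t).
have BD : bdisc e t y `<=` D by move=> z [].
have ts : 0 < t / 8 by rewrite divr_gt0.
have mE := measurable_open_disc (center e t y) (t / 8).
have EW : open_disc (center e t y) (t / 8) `<=` top_half e t y.
  by move=> z; exact: disc_in_top.
have EB : open_disc (center e t y) (t / 8) `<=` bdisc e t y.
  by apply: subset_trans (box_bdisc gc); apply: subset_trans (@top_half_box e t y).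
have ED : open_disc (center e t y) (t / 8) `<=` D by apply: subset_trans BD.
have aE := area_disc_ge (center e t y) ts.
have aB : (0 < area R (bdisc e t y))%E.
  apply: (@lt_le_trans _ _ ((t / 8) ^+ 2)%:E); first by rewrite lte_fin exprn_gt0.
  by apply: (le_trans aE); apply: le_measure; rewrite ?inE.
have B0 : 0 < wmass (bdisc e t y) by exact: wmass_gt0.
split => //.
apply: (@le_trans _ _ (C1 * wmass (top_half e t y))); last first.
  by rewrite ler_wpM2r ?wmass_ge0// lerDr.
have t11 : 0 < 11 * t by rewrite mulr_gt0.
have /andP[b1 b2] := fine_area_disc (center e t y) t11.
have one : 1 `^ q = 1 :> R by rewrite powR1.
have aE1 : (((t / 8) ^+ 2)%:E <=
    \int[area R]_(z in open_disc (center e t y) (t / 8)%R) (1 : R)%:E)%E.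
  by rewrite integral_cst// mul1e.
have mone : measurable_fun (open_disc (center e t y) (t / 8) : plane_set)
    (fun=> 1 : R) by exact: measurable_cst.
have := BB_hoelder q1 C0 mw w0 BB (touches_center e1 t0 t8 y1 y2) mE EB mone
  (fun _ _ => ler01) (sqr_ge0 _) aE1.
have -> : (\int[area R]_(z in open_disc (center e t y) (t / 8)%R) ((1 : R) `^ q * w z)%:E =
    \int[area R]_(z in open_disc (center e t y) (t / 8)%R) (w z)%:E)%E.
  by apply: eq_integral => z _; rewrite one mul1r.
rewrite (wmassE mB BD) (wmassE mE ED) -!EFinM lee_fin.
set b := fine _ in b1 b2 * => h.
have b0 : 0 < b by apply: lt_le_trans b1; rewrite exprn_gt0.
have le1 : 1 <= k `^ q * ((t / 8) ^+ 2 / b) `^ q.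
  have c0 : 0 <= (t / 8) ^+ 2 / b by rewrite divr_ge0 ?sqr_ge0// ltW.
  rewrite -powRM ?(ltW k0)// -[leLHS]one.
  apply: ge0_ler_powR; rewrite ?nnegrE ?(ltW q0)//; first by rewrite mulr_ge0// ltW.
  rewrite mulrA ler_pdivlMr// mul1r; apply: (le_trans b2).
  by rewrite le_eqVlt; apply/orP; left; apply/eqP; rewrite /k; field.
have le2 : 2 `^ q * C * wmass (open_disc (center e t y) (t / 8)) <=
    2 `^ q * C * wmass (top_half e t y).
  by rewrite ler_wpM2l ?mulr_ge0 ?powR_ge0 ?(ltW C0)// wmass_le.
rewrite -[leLHS]mul1r; apply: (le_trans (ler_wpM2r (ltW B0) le1)).
rewrite -mulrA /C1 -[leRHS]mulrA ler_wpM2l ?powR_ge0//.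
exact: le_trans h le2.
Qed.

(** The top half and the two child boxes are disjoint parts of the parent, so their three indicators
    add up to at most 1. *)
Lemma mass_children e (t y : R) : 0 < t ->
  wmass (top_half e t y) + (wmass (carleson_box e (t / 2) y) +
    wmass (carleson_box e (t / 2) (y + t / 2))) <= wmass (carleson_box e t y).
Proof.
move=> t0.
pose V (k : nat) : plane_set := match k with
  | 0 => top_half e t y | 1 => carleson_box e (t / 2) y
  | _ => carleson_box e (t / 2) (y + t / 2) end.
have mV k : measurable (V k).
  case: k => [|[|k]]; [exact: measurable_top_half|exact: measurable_carleson_box|].
  exact: measurable_carleson_box.
have VQ k : V k `<=` carleson_box e t y.
  case: k => [|[|k]] z; [exact: top_half_box|exact: box_child1|exact: box_child2].
have mQ := measurable_carleson_box e t y.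
have QD := @carleson_box_disc e t y.
have := @sum_integral_le R _ _ (area R) (carleson_box e t y) w mQ
  (measurable_funTS mw) (fun z _ => ltW (w0 z)) nat [:: 0; 1; 2]%N V 1 mV VQ ler01.
rewrite mul1e !big_cons big_nil adde0/=.
rewrite !wmassE//; try exact: measurable_carleson_box; try exact: measurable_top_half;
  try (by move=> z []); try (by move=> z [[]]).
rewrite -!EFinD lee_fin; apply => z _.
rewrite !big_cons big_nil addr0 !indicE /=.
have [h0|h0] := boolP (z \in top_half e t y).
  have n1 : (z \in carleson_box e (t / 2) y) = false.
    by apply/negbTE; rewrite notin_setE => /child_not_top; apply; exact/set_mem/h0.
  have n2 : (z \in carleson_box e (t / 2) (y + t / 2)) = false.
    by apply/negbTE; rewrite notin_setE => /child_not_top; apply; exact/set_mem/h0.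
  by rewrite n1 n2 /= !addr0.
have [h1|h1] := boolP (z \in carleson_box e (t / 2) y); last first.
  by rewrite /= !add0r lern1 leq_b1.
have n2 : (z \in carleson_box e (t / 2) (y + t / 2)) = false.
  apply/negbTE; rewrite notin_setE => -[_ _ _ a _].
  by move/set_mem: h1 => -[_ _ _ _]; rewrite ltNge a.
by rewrite n2 /= add0r addr0.
Qed.

(** * Summation over the generations for one conjugate pair *)

Section Conjugate.
Variables (u v : R * R -> R) (K C1 : R).
Hypothesis uv : cr_on D u v.
Hypothesis v0 : v 0 = 0.
Hypothesis K0 : 0 < K.
Hypothesis C11 : 1 < C1.
Hypothesis osc : forall c (t : R) z z', 0 < t <= 1 -> touches_circle c (11 * t) ->
  modulus (z - c) <= 10 * t -> modulus (z' - c) <= 10 * t ->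
  modulus z <= 1 - t / 4 -> modulus z' <= 1 - t / 4 ->
  ((`|v z' - v z| `^ p)%:E *
     \int[area R]_(y in open_disc c (11 * t)%R `&` D) (w y)%:E <=
   K%:E * \int[area R]_(y in whitney_disc c t) (`|u y| `^ p * w y)%:E)%E.
Hypothesis mass_top : forall e (t y : R), good_cell e t y ->
  0 < wmass (bdisc e t y) /\ wmass (bdisc e t y) <= C1 * wmass (top_half e t y).
Hypothesis ufin : (\int[area R]_(z in D) (`|u z| `^ p * w z)%:E < +oo)%E.

Definition umass (A : plane_set) : R :=
  fine (\int[area R]_(z in A) (`|u z| `^ p * w z)%:E)%E.

Lemma measurable_powR_w (f : R * R -> R) (A : plane_set) : {in D, continuous f} ->
  A `<=` D -> measurable A -> measurable_fun A (fun z => `|f z| `^ p * w z).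
Proof.
move=> cf AD mA; apply: measurable_funM; last exact: measurable_funTS.
have mD := @measurable_unit_disc R.
exact: measurable_funS mD AD (measurable_norm_powR p (@open_unit_disc R) cf).
Qed.

Lemma powR_w_ge0 (f : R * R -> R) z : 0 <= `|f z| `^ p * w z.
Proof. by rewrite mulr_ge0 ?powR_ge0// ltW. Qed.

Lemma umassE (A : plane_set) : measurable A -> A `<=` D ->
  (\int[area R]_(z in A) (`|u z| `^ p * w z)%:E = (umass A)%:E)%E.
Proof.
move=> mA AD; have mD := @measurable_unit_disc R.
have [cu _] := cr_continuous (@open_unit_disc R) uv.
have h := ge0_subset_integral (area R) mA mD
  (proj2 (measurable_EFinP _ _) (measurable_powR_w cu (@subset_refl _ D) mD))
  (fun z _ => powR_w_ge0 u z) AD.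
rewrite /umass fineK// ge0_fin_numE ?(le_lt_trans h)//.
by apply: integral_ge0 => z _; rewrite lee_fin powR_w_ge0.
Qed.

Lemma umass_ge0 (A : plane_set) : 0 <= umass A.
Proof. by apply: fine_ge0; apply: integral_ge0 => z _; rewrite lee_fin powR_w_ge0. Qed.

Lemma measurable_whitney_disc c (t : R) : measurable (whitney_disc c t).
Proof. by apply: measurableI; exact: measurable_open_disc. Qed.

Lemma whitney_disc_sub c (t : R) : 0 < t -> whitney_disc c t `<=` D.
Proof. by move=> t0 z [_]; rewrite /unit_disc /open_disc/= subr0; lra. Qed.

Lemma cell_osc e (t y : R) z : good_cell e t y ->
  modulus (z - center e t y) <= 10 * t -> modulus z <= 1 - t / 4 ->
  `|v z - v (center e t y)| `^ p * wmass (bdisc e t y) <=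
    K * umass (whitney_disc (center e t y) t).
Proof.
move=> gc zc zt; have [e1 t0 t8 y1 y2] := gc.
have mB := measurable_discI (center e t y) (11 * t).
have BD : bdisc e t y `<=` D by move=> ? [].
have h1 : 0 < t <= 1 by apply/andP; split => //; lra.
have h2 : modulus (center e t y - center e t y) <= 10 * t.
  by rewrite subrr modulus0 mulr_ge0// ltW.
have h3 : modulus (center e t y) <= 1 - t / 4 by rewrite modulus_center//; lra.
have := osc h1 (touches_center e1 t0 t8 y1 y2) h2 zc h3 zt.
rewrite (wmassE mB BD) umassE -?EFinM ?lee_fin//; first exact: measurable_whitney_disc.
exact: whitney_disc_sub.
Qed.

(** On the top half [|v|^p] is compared with its value at the centre; dividing the oscillation bound
    by the positive mass of the disc makes it a pointwise constant, and integrating against [w]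
    restores at most that mass. *)
Lemma cell_integral (K2 : R) e (t y : R) : 0 <= K2 ->
  (forall x x' : R, `|x'| `^ p <= 2 * `|x| `^ p + K2 * `|x' - x| `^ p) -> good_cell e t y ->
  (\int[area R]_(z in top_half e t y) (`|v z| `^ p * w z)%:E <=
   (2 * (`|v (center e t y)| `^ p * wmass (carleson_box e t y)) +
     K2 * (K * umass (whitney_disc (center e t y) t)))%:E)%E.
Proof.
move=> K20 HK2 gc; have [e1 t0 t8 y1 y2] := gc.
have [_ cv] := cr_continuous (@open_unit_disc R) uv.
have [B0 _] := mass_top gc.
set c := center e t y; set B := wmass _ in B0; set W := top_half e t y.
set g := umass _; set Q := carleson_box e t y.
have mW : measurable W := measurable_top_half e t y.
have mQ : measurable Q := measurable_carleson_box e t y.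
have QD : Q `<=` D := @carleson_box_disc e t y.
have WQ : W `<=` Q := @top_half_box e t y.
have WD : W `<=` D by exact: subset_trans QD.
pose M := 2 * `|v c| `^ p + K2 * (K * g / B).
have M0 : 0 <= M.
  by rewrite addr_ge0 ?mulr_ge0 ?powR_ge0 ?invr_ge0 ?umass_ge0 ?(ltW K0) ?(ltW B0).
have mB := measurable_discI c (11 * t).
apply: (@le_trans _ _ (\int[area R]_(z in W) (M%:E * (w z)%:E))%E).
  apply: ge0_le_integral => //.
  - by move=> z _; rewrite lee_fin powR_w_ge0.
  - by apply/measurable_EFinP; exact: measurable_powR_w.
  - by apply: measurable_funeM; exact: measurable_wE.
  - move=> z Wz; rewrite -EFinM lee_fin ler_wpM2r ?(ltW (w0 z))//.
    apply: (le_trans (HK2 (v c) (v z))); rewrite /M lerD2l ler_wpM2l//.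
    rewrite ler_pdivlMr//; apply: cell_osc => //.
      by apply: box_near_center => //; exact: WQ.
    by have [_ /= ] := Wz; lra.
rewrite (ge0_integralZl_EFin (area R) mW (fun z _ => wE z) (@measurable_wE W) M0).
rewrite (wmassE mW WD) -EFinM lee_fin /M mulrDl; apply: lerD.
  by rewrite -mulrA !ler_wpM2l ?powR_ge0// wmass_le.
have WB : wmass W <= B.
  have BD : bdisc e t y `<=` D by move=> ? [].
  by apply: (wmass_le mW mB _ BD); exact: subset_trans (box_bdisc gc).
rewrite -(mulrA K2); apply: (ler_wpM2l K20).
rewrite mulrAC ler_pdivrMr//.
by rewrite ler_wpM2l// mulr_ge0 ?umass_ge0// ltW.
Qed.

Lemma good_child1 e (t y : R) : good_cell e t y -> good_cell e (t / 2) y.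
Proof. by case=> e1 t0 t8 y1 y2; split => //; lra. Qed.

Lemma good_child2 e (t y : R) : good_cell e t y -> good_cell e (t / 2) (y + t / 2).
Proof. by case=> e1 t0 t8 y1 y2; split => //; lra. Qed.

Lemma center_in_box e (t y : R) : good_cell e t y -> carleson_box e t y (center e t y).
Proof.
case=> e1 t0 t8 y1 y2; apply: top_half_box; apply: disc_in_top => //.
by rewrite subrr modulus0 divr_gt0.
Qed.

(** Both child centres lie in the parent box, so the oscillation estimate of the parent compares [v]
    there with [v] at the parent centre. Each child has at most the mass of the disc, so its error
    is at most [K3] times the oscillation bound. *)
Lemma cell_children (K3 eps : R) e (t y : R) : 0 <= K3 -> 0 <= eps ->
  (forall x x' : R, `|x'| `^ p <= (1 + eps) * `|x| `^ p + K3 * `|x' - x| `^ p) ->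
  good_cell e t y ->
  `|v (center e (t / 2) y)| `^ p * wmass (carleson_box e (t / 2) y) +
  `|v (center e (t / 2) (y + t / 2))| `^ p * wmass (carleson_box e (t / 2) (y + t / 2)) <=
  (1 + eps) * (1 - C1^-1) * (`|v (center e t y)| `^ p * wmass (carleson_box e t y)) +
     2 * K3 * K * umass (whitney_disc (center e t y) t).
Proof.
move=> K30 eps0 HK3 gc; have [e1 t0 t8 y1 y2] := gc.
have gc1 := good_child1 gc; have gc2 := good_child2 gc.
have [B0 BW] := mass_top gc; have mch := @mass_children e t y t0.
have C1pos : 0 < C1 by exact: lt_trans ltr01 C11.
have mB := measurable_discI (center e t y) (11 * t).
have BD : bdisc e t y `<=` D by move=> z [].
have QB := box_bdisc gc.
have mQ := measurable_carleson_box e t y.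
have le_child (y' : R) : carleson_box e (t / 2) y' `<=` carleson_box e t y ->
    wmass (carleson_box e (t / 2) y') <= wmass (bdisc e t y).
  move=> h; apply: wmass_le => //; first exact: measurable_carleson_box.
  by apply: subset_trans QB.
have l1 := le_child y (fun z => @box_child1 _ e t y z t0).
have l2 := le_child (y + t / 2) (fun z => @box_child2 _ e t y z t0).
have o_child (y' : R) : good_cell e (t / 2) y' ->
    carleson_box e t y (center e (t / 2) y') ->
    `|v (center e (t / 2) y') - v (center e t y)| `^ p * wmass (bdisc e t y) <=
    K * umass (whitney_disc (center e t y) t).
  move=> gc' Qc; apply: cell_osc => //; first exact: box_near_center.
  by case: gc' => ? ? ? ? ?; rewrite modulus_center//; lra.
have o1 := o_child y gc1 (box_child1 t0 (center_in_box gc1)).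
have o2 := o_child (y + t / 2) gc2 (box_child2 t0 (center_in_box gc2)).
have le_QB : wmass (carleson_box e t y) <= wmass (bdisc e t y) by exact: wmass_le.
have p1 := HK3 (v (center e t y)) (v (center e (t / 2) y)).
have p2 := HK3 (v (center e t y)) (v (center e (t / 2) (y + t / 2))).
have m1 := wmass_ge0 (carleson_box e (t / 2) y).
have m2 := wmass_ge0 (carleson_box e (t / 2) (y + t / 2)).
have a0 : 0 <= `|v (center e t y)| `^ p by exact: powR_ge0.
have d1 : 0 <= `|v (center e (t / 2) y) - v (center e t y)| `^ p by exact: powR_ge0.
have d2 : 0 <= `|v (center e (t / 2) (y + t / 2)) - v (center e t y)| `^ p by exact: powR_ge0.
move: p1 p2 m1 m2 a0 d1 d2 l1 l2 o1 o2 mch le_QB BW.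
set A := `|v (center e t y)| `^ p; set A1 := `|v (center e (t / 2) y)| `^ p.
set A2 := `|v (center e (t / 2) (y + t / 2))| `^ p.
set D1 := `|_ - _| `^ p; set D2 := `|v (center e (t / 2) (y + t / 2)) - _| `^ p.
set M1 := wmass (carleson_box e (t / 2) y); set M2 := wmass (carleson_box e (t / 2) _).
set Q := wmass (carleson_box e t y); set W := wmass (top_half e t y).
set B := wmass _; set G := umass _.
move=> p1 p2 m1 m2 a0 d1 d2 l1 l2 o1 o2 mch QB' BW.
have q1' : A1 * M1 <= (1 + eps) * A * M1 + K3 * (K * G).
  apply: (le_trans (ler_wpM2r m1 p1)); rewrite mulrDl lerD2l -mulrA ler_wpM2l//.
  by apply: le_trans o1; rewrite ler_wpM2l.
have q2' : A2 * M2 <= (1 + eps) * A * M2 + K3 * (K * G).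
  apply: (le_trans (ler_wpM2r m2 p2)); rewrite mulrDl lerD2l -mulrA ler_wpM2l//.
  by apply: le_trans o2; rewrite ler_wpM2l.
(* The box is contained in the disc, so its top half has at least the proportion [1 / C1] of its
   mass, and the children share the rest. *)
have q3 : M1 + M2 <= (1 - C1^-1) * Q.
  have : C1^-1 * Q <= W by rewrite ler_pdivrMl//; exact: le_trans BW.
  by move: mch; lra.
have q4 : (1 + eps) * A * (M1 + M2) <= (1 + eps) * A * ((1 - C1^-1) * Q).
  by rewrite ler_wpM2l// mulr_ge0// addr_ge0.
apply: (le_trans (lerD q1' q2')).
have -> : (1 + eps) * A * M1 + K3 * (K * G) + ((1 + eps) * A * M2 + K3 * (K * G)) =
  (1 + eps) * A * (M1 + M2) + 2 * K3 * K * G by ring.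
have -> : (1 + eps) * (1 - C1^-1) * (A * Q) = (1 + eps) * A * ((1 - C1^-1) * Q) by ring.
by rewrite lerD2r.
Qed.

Lemma whitney_disc_umass c (t : R) : 0 < t -> umass (whitney_disc c t) <= umass D.
Proof.
move=> t0; have [cu _] := cr_continuous (@open_unit_disc R) uv.
have mD := @measurable_unit_disc R; have mV := measurable_whitney_disc c t.
rewrite -lee_fin -!umassE//; last exact: whitney_disc_sub.
apply: (ge0_subset_integral (area R) mV mD _ _ (whitney_disc_sub t0)).
  by apply/measurable_EFinP; exact: measurable_powR_w.
by move=> z _; rewrite lee_fin powR_w_ge0.
Qed.

(** The oscillation estimate about 0 at [t = 1 / 8]: [10 t] and [11 t] exceed 1, so the disc
    contains the unit disc, and [1 - t / 4] is [1 - 1 / 32]. The normalisation [v 0 = 0] turns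
    oscillation into size. *)
Lemma base_bound z : modulus z <= 1 - 1 / 32 -> `|v z| `^ p * wmass D <= K * umass D.
Proof.
move=> z32; have t8 : 0 < 1 / 8 :> R by rewrite divr_gt0.
have r1 : 1 < 11 * (1 / 8) :> R by lra.
have mV := measurable_whitney_disc 0 (1 / 8); have VD := @whitney_disc_sub 0 (1 / 8) t8.
have := @osc 0 (1 / 8) 0 z; rewrite v0 subr0 (discI_unit r1).
rewrite (wmassE (@measurable_unit_disc R) (@subset_refl _ _)) (umassE mV VD).
rewrite -!EFinM lee_fin !subr0 modulus0 => H.
apply: (@le_trans _ _ (K * umass (whitney_disc 0 (1 / 8)))).
  have l8 : (1 / 8 : R) <= 1 by lra.
  have a1 : 0 < (1 / 8 : R) <= 1 by rewrite t8 l8.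
  have a3 : 0 <= 10 * (1 / 8) :> R by lra.
  have a4 : modulus z <= 10 * (1 / 8) by lra.
  have a5 : 0 <= 1 - 1 / 8 / 4 :> R by lra.
  have a6 : modulus z <= 1 - 1 / 8 / 4 by lra.
  exact: (H a1 (touches_origin r1) a3 a4 a5 a6).
by apply: ler_wpM2l (ltW K0) _ _ _; exact: whitney_disc_umass.
Qed.

(** A discrete version of the integral of [|v|^p w] over the boxes of generation [m], using full
    boxes so that the masses of parent and children can be compared. *)
Definition genE e (m : nat) : R := \sum_(0 <= i < cells m)
  `|v (center e (scale R m) (height R m i))| `^ p *
    wmass (carleson_box e (scale R m) (height R m i)).

Definition genG e (m : nat) : R := \sum_(0 <= i < cells m)
  umass (whitney_disc (center e (scale R m) (height R m i)) (scale R m)).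

Lemma genE_ge0 e m : 0 <= genE e m.
Proof. by apply: sumr_ge0 => i _; rewrite mulr_ge0 ?powR_ge0// wmass_ge0. Qed.

Lemma good_scale e m i : modulus e = 1 -> (i < cells m)%N ->
  good_cell e (scale R m) (height R m i).
Proof.
move=> e1 im; have [y1 y2] := height_bounds R im.
by split => //; [exact: scale_gt0|exact: scale_le8].
Qed.

Lemma genE_step (K3 eps : R) e m : modulus e = 1 -> 0 <= K3 -> 0 <= eps ->
  (forall x x' : R, `|x'| `^ p <= (1 + eps) * `|x| `^ p + K3 * `|x' - x| `^ p) ->
  genE e m.+1 <= (1 + eps) * (1 - C1^-1) * genE e m + 2 * K3 * K * genG e m.
Proof.
move=> e1 K30 eps0 HK3; rewrite /genE /genG cellsS sum_nat_double !big_distrr -big_split/=.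
rewrite big_nat_cond [leRHS]big_nat_cond; apply: ler_sum => i /andP[/andP[_ im] _].
rewrite !height_double !height_doubleS scaleS.
exact: cell_children (good_scale e1 im).
Qed.

Lemma genG_total e M : modulus e = 1 ->
  \sum_(0 <= m < M) genG e m <= (22 * 7)%:R * umass D.
Proof.
move=> e1; have [cu _] := cr_continuous (@open_unit_disc R) uv.
have mD := @measurable_unit_disc R.
pose V (k : nat * nat) : plane_set :=
  whitney_disc (center e (scale R k.1) (height R k.1 k.2)) (scale R k.1).
have mV k : measurable (V k) by exact: measurable_whitney_disc.
have VD k : V k `<=` D by apply: whitney_disc_sub; exact: scale_gt0.
pose s := [seq (m, i) | m <- index_iota 0 M, i <- index_iota 0 (cells m)].
have := @sum_integral_le R _ _ (area R) D _ mD
  (measurable_powR_w cu (@subset_refl _ D) mD) (fun z _ => powR_w_ge0 u z)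
  _ s V (22 * 7)%:R mV VD (ler0n _ _).
rewrite (umassE mD (@subset_refl _ D)) -EFinM.
have -> : (\sum_(k <- s) \int[area R]_(z in V k) (`|u z| `^ p * w z)%:E =
   (\sum_(0 <= m < M) genG e m)%:E)%E.
  rewrite big_allpairs_dep -sumEFin; apply: eq_bigr => m _.
  rewrite /genG -sumEFin; apply: eq_bigr => i _.
  by rewrite (umassE (mV (m, i)) (VD (m, i))).
rewrite lee_fin; apply => z _.
by rewrite big_allpairs_dep; exact: whitney_overlap.
Qed.

(** The twelve centres of generation 0 have depth [3 / 32], within reach of [base_bound]. *)
Lemma genE0 e : modulus e = 1 -> genE e 0 <= 12 * (K * umass D).
Proof.
move=> e1; rewrite /genE.
have -> : 12 * (K * umass D) = \sum_(0 <= i < cells 0) (K * umass D).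
  by rewrite sumr_const_nat subn0 /cells expn0 muln1 mulr_natl.
rewrite big_nat_cond [leRHS]big_nat_cond; apply: ler_sum => i /andP[/andP[_ im] _].
have [_ s0 s8 y1 y2] := good_scale e1 im.
have mQ := measurable_carleson_box e (scale R 0) (height R 0 i).
have QD := @carleson_box_disc e (scale R 0) (height R 0 i).
apply: (@le_trans _ _ (`|v (center e (scale R 0) (height R 0 i))| `^ p * wmass D)).
  by apply: (ler_wpM2l (powR_ge0 _ _)); apply: wmass_le => //; exact: measurable_unit_disc.
by apply: base_bound; rewrite modulus_center// scale0; lra.
Qed.

(** With [eps = 1 / C1] the ratio between generations is [1 - 1 / C1^2], which accounts for the
    factor on the left. The right side does not depend on [M]. *)
Lemma genE_total (K3 : R) e M : modulus e = 1 -> 0 <= K3 ->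
  (forall x x' : R, `|x'| `^ p <= (1 + C1^-1) * `|x| `^ p + K3 * `|x' - x| `^ p) ->
  C1^-1 ^+ 2 * \sum_(0 <= m < M) genE e m <=
    (12 * K + 2 * K3 * K * (22 * 7)%:R) * umass D.
Proof.
move=> e1 K30 HK3; have C1pos : 0 < C1 by exact: lt_trans ltr01 C11.
have c0 : 0 <= C1^-1 by rewrite invr_ge0 ltW.
have c1 : C1^-1 < 1 by rewrite invf_lt1.
have r01 : 0 <= (1 + C1^-1) * (1 - C1^-1) < 1.
  have c2 : 0 < C1^-1 * C1^-1 by rewrite mulr_gt0 ?invr_gt0.
  apply/andP; split; first by rewrite mulr_ge0//; lra.
  by rewrite mulrDl mul1r mulrBr mulr1; lra.
have := @geometric_sum_bound R (genE e) (fun m => 2 * K3 * K * genG e m) _ M r01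
  (genE_ge0 e) (fun m => genE_step m e1 K30 c0 HK3).
have -> : 1 - (1 + C1^-1) * (1 - C1^-1) = C1^-1 ^+ 2 by ring.
move=> h; apply: (le_trans h); rewrite [leRHS]mulrDl -[X in _ <= X + _]mulrA.
apply: lerD; first exact: genE0.
rewrite -big_distrr/= -[leRHS]mulrA; apply: ler_wpM2l; last exact: genG_total.
by rewrite !mulr_ge0// ltW.
Qed.

Lemma frame_total (K2 K3 : R) e M : modulus e = 1 -> 0 <= K2 -> 0 <= K3 ->
  (forall x x' : R, `|x'| `^ p <= 2 * `|x| `^ p + K2 * `|x' - x| `^ p) ->
  (forall x x' : R, `|x'| `^ p <= (1 + C1^-1) * `|x| `^ p + K3 * `|x' - x| `^ p) ->
  (\sum_(0 <= m < M) \sum_(0 <= i < cells m)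
     \int[area R]_(z in top_half e (scale R m) (height R m i)) (`|v z| `^ p * w z)%:E <=
   ((2 * (C1 ^+ 2 * (12 * K + 2 * K3 * K * (22 * 7)%:R)) + K2 * (K * (22 * 7)%:R))
     * umass D)%:E)%E.
Proof.
move=> e1 K20 K30 HK2 HK3; have C1pos : 0 < C1 by exact: lt_trans ltr01 C11.
apply: (@le_trans _ _ (\sum_(0 <= m < M) (2 * genE e m + K2 * (K * genG e m)))%:E).
  rewrite -sumEFin; apply: lee_sum => m _.
  have -> : 2 * genE e m + K2 * (K * genG e m) = \sum_(0 <= i < cells m)
    (2 * (`|v (center e (scale R m) (height R m i))| `^ p *
        wmass (carleson_box e (scale R m) (height R m i))) +
     K2 * (K * umass (whitney_disc (center e (scale R m) (height R m i)) (scale R m)))).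
    by rewrite big_split/= -!big_distrr.
  rewrite -sumEFin big_nat_cond [leRHS]big_nat_cond.
  apply: lee_sum => i /andP[/andP[_ im] _].
  exact: cell_integral K20 HK2 (good_scale e1 im).
rewrite lee_fin big_split/= -!big_distrr/= [leRHS]mulrDl; apply: lerD.
  rewrite -mulrA ler_wpM2l//.
  have h := genE_total M e1 K30 HK3.
  rewrite -mulrA; rewrite exprVn ler_pdivrMl ?exprn_gt0// in h.
rewrite -!mulrA ler_wpM2l// ler_wpM2l ?(ltW K0)//; exact: genG_total.
Qed.

(** The disc is exhausted by the sets [F M]. On each, the points of modulus below [31 / 32] are
    handled by [base_bound], and the others lie in top halves of the first [M] generations in one of
    the four frames. *)
Lemma conjugate_total (K2 K3 : R) : 0 <= K2 -> 0 <= K3 ->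
  (forall x x' : R, `|x'| `^ p <= 2 * `|x| `^ p + K2 * `|x' - x| `^ p) ->
  (forall x x' : R, `|x'| `^ p <= (1 + C1^-1) * `|x| `^ p + K3 * `|x' - x| `^ p) ->
  (\int[area R]_(z in D) (`|v z| `^ p * w z)%:E <=
   ((K + 4 * (2 * (C1 ^+ 2 * (12 * K + 2 * K3 * K * (22 * 7)%:R)) + K2 * (K * (22 * 7)%:R)))
     * umass D)%:E)%E.
Proof.
move=> K20 K30 HK2 HK3.
have [_ cv] := cr_continuous (@open_unit_disc R) uv.
have mD := @measurable_unit_disc R.
set Kf := 2 * _ + _.
pose F (M : nat) : plane_set := [set z | modulus z < 1 - scale R M].
have mF M : measurable (F M) by exact: measurable_modulus_lt.
have FD M : F M `<=` D.
  by move=> z; rewrite /F /unit_disc/=; have := scale_gt0 R M; lra.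
have DF : \bigcup_M F M = D.
  apply/seteqP; split => [z [M _ /FD]//|z Dz].
  have d0 : 0 < 1 - modulus z by rewrite subr_gt0.
  have [k hk] : exists k : nat, (1 - modulus z)^-1 < k%:R.
    exists (Num.truncn (1 - modulus z)^-1).+1; exact: truncnS_gt.
  exists k => //; rewrite /F/=.
  have : scale R k < 1 - modulus z.
    rewrite /scale -[ltRHS]invrK ltf_pV2 ?posrE ?invr_gt0 ?mulr_gt0 ?exprn_gt0//.
    apply: (lt_le_trans hk); apply: (@le_trans _ _ (2 ^+ k)).
      by rewrite -natrX ler_nat ltnW// ltn_expl.
    by rewrite ler_peMl ?exprn_ge0//; lra.
  lra.
pose h z := `|v z| `^ p * w z.
have mh : measurable_fun D h by exact: measurable_powR_w.
have h0 z : D z -> 0 <= h z by move=> _; exact: powR_w_ge0.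
pose I0 : plane_set := [set z | modulus z < 1 - 1 / 32].
have mI0 : measurable I0 by exact: measurable_modulus_lt.
have I0D : I0 `<=` D by move=> z; rewrite /I0 /unit_disc/=; lra.
have wD : 0 < wmass D.
  apply: wmass_gt0 => //; rewrite unit_discE.
  by apply: lt_le_trans (area_disc_ge 0 ltr01); rewrite lte_fin expr1n.
have inner : (\int[area R]_(z in I0) (h z)%:E <= (K * umass D)%:E)%E.
  have M0 : 0 <= K * umass D / wmass D.
    by rewrite divr_ge0 ?(ltW wD)// mulr_ge0 ?umass_ge0// ltW.
  apply: (@le_trans _ _ (\int[area R]_(z in I0) ((K * umass D / wmass D)%:E * (w z)%:E))%E).
    apply: ge0_le_integral => //.
    - by move=> z _; rewrite lee_fin; exact: powR_w_ge0.
    - by apply/measurable_EFinP; exact: measurable_funS mh.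
    - by apply: measurable_funeM; exact: measurable_wE.
    - move=> z zI; rewrite -EFinM lee_fin ler_wpM2r ?(ltW (w0 z))//.
      by rewrite ler_pdivlMr//; apply: base_bound; exact: ltW.
  rewrite (ge0_integralZl_EFin (area R) mI0 (fun z _ => wE z) (@measurable_wE I0) M0).
  rewrite (wmassE mI0 I0D) -EFinM lee_fin mulrAC ler_pdivrMr//.
  by rewrite ler_wpM2l ?mulr_ge0 ?umass_ge0 ?(ltW K0)// wmass_le.
have FM M : (\int[area R]_(z in F M) (h z)%:E <= ((K + 4 * Kf) * umass D)%:E)%E.
  (* The index [None] stands for the inner disc, [Some] for a frame with a cell. *)
  pose V (k : option ((R * R) * (nat * nat))) : plane_set :=
    if k is Some (e, (m, i)) then top_half e (scale R m) (height R m i) else I0.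
  have mV k : measurable (V k).
    by case: k => [[e [m i]]|]//; exact: measurable_top_half.
  have VD k : V k `<=` D by case: k => [[e [m i]]|]// z [[]].
  pose fr : seq (R * R) := [:: (1, 0); (0, 1); (-1, 0); (0, -1)].
  pose s := None :: map Some [seq (e, k) | e <- fr,
     k <- [seq (m, i) | m <- index_iota 0 M, i <- index_iota 0 (cells m)]].
  have cover z : F M z -> exists2 k, k \in s & V k z.
    move=> Fz; have [z1|z1] := ltP (modulus z) (1 - 1 / 32).
      by exists None; rewrite ?mem_head.
    have [|e [m [i [eF mM im Vz]]]] := @box_cover R M z _ Fz; first by lra.
    exists (Some (e, (m, i))) => //.
    rewrite in_cons; apply/orP; right; rewrite mem_map; last by move=> ? ? [].
    apply/allpairsPdep; exists e, (m, i); split => //.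
    by apply/allpairsPdep; exists m, i; rewrite !mem_index_iota.
  apply: (le_trans (integral_cover_le (area R) mD mh h0 mV VD (mF M) (FD M) cover)).
  rewrite big_cons big_map big_allpairs_dep mulrDl EFinD.
  apply: leeD; first exact: inner.
  have -> : (4 * Kf * umass D)%:E = (\sum_(e <- fr) (Kf * umass D)%:E)%E.
    by rewrite /fr !big_cons big_nil adde0 -!EFinD; congr EFin; ring.
  rewrite big_seq_cond [leRHS]big_seq_cond; apply: lee_sum => e /andP[/modulus_frames e1 _].
  by rewrite big_allpairs_dep; exact: (frame_total M e1 K20 K30 HK2 HK3).
have mhE : measurable_fun D (fun z => (h z)%:E) by exact/measurable_EFinP.
have ndF : nondecreasing_seq F.
  move=> m n mn; apply/subsetPset => z; rewrite /F/=.
  by have := scale_le R mn; lra.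
have cvg := @ge0_nondecreasing_set_cvg_integral _ _ R F (fun z => (h z)%:E) (area R) ndF mF
  (fun M => measurable_funS mD (FD M) mhE) (fun M z Fz => h0 z (FD M z Fz)).
rewrite DF in cvg.
rewrite -(cvg_lim _ cvg)//; apply: lime_le; first by apply/cvg_ex; eexists; exact: cvg.
by apply: nearW => M; exact: FM.
Qed.

End Conjugate.

Theorem conjugate_bound : exists2 A : R, 0 < A & forall u v,
  cr_on D u v -> v 0 = 0 ->
  (\int[area R]_(z in D) (`|v z| `^ p * w z)%:E <=
    A%:E * \int[area R]_(z in D) (`|u z| `^ p * w z)%:E)%E.
Proof.
have [K K0 HK] := oscillation p0 q1 C0.
have [C1 C11 HC1] := mass_top_half.
have C1pos : 0 < C1 by exact: lt_trans ltr01 C11.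
(* Passing from centres to top halves happens once per cell and tolerates a factor 2; the passage
   between generations is iterated and needs [1 + 1 / C1]. *)
have [K2 K20 HK2] := powR_almost_add p0 (ltr01 : 0 < 1 :> R).
have Ci : 0 < C1^-1 by rewrite invr_gt0.
have [K3 K30 HK3] := powR_almost_add p0 Ci.
pose A := K + 4 * (2 * (C1 ^+ 2 * (12 * K + 2 * K3 * K * (22 * 7)%:R)) + K2 * (K * (22 * 7)%:R)).
have n0 : 0 <= (22 * 7)%:R :> R by rewrite ler0n.
have A0 : 0 < A.
  rewrite /A ltr_pwDl// !(mulr_ge0, addr_ge0)//; try exact: ltW.
exists A => // u v uv v0.
have I0 : (0 <= \int[area R]_(z in D) (`|u z| `^ p * w z)%:E)%E.
  by apply: integral_ge0 => z _; rewrite lee_fin powR_w_ge0.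
(* An infinite right side is trivial since [A > 0]; otherwise all integrals of [|u|^p w] are real
   numbers. *)
have [ufin|] := ltP (\int[area R]_(z in D) (`|u z| `^ p * w z)%:E)%E +oo%E; last first.
  by rewrite leye_eq => /eqP ->; rewrite gt0_muley ?leey// lte_fin.
have osc (c : R * R) (t : R) z z' t1 tc h1 h2 h3 h4 :=
  HK w u v c t z z' mw w0 BB uv t1 tc h1 h2 h3 h4.
have HK2' (x x' : R) : `|x'| `^ p <= 2 * `|x| `^ p + K2 * `|x' - x| `^ p.
  exact: HK2.
have := conjugate_total uv v0 K0 C11 osc HC1 ufin (ltW K20) (ltW K30) HK2' HK3.
by rewrite EFinM (umassE uv ufin (@measurable_unit_disc R) (@subset_refl _ D)).
Qed.

End Core.

Lemma harmonic_conjugate_cr (R : realType) (u v : R * R -> R) :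
  harmonic_on (@unit_disc R) u -> harmonic_conjugate u v ->
  cr_on (@unit_disc R) u v /\ v 0 = 0.
Proof.
move=> [Cu _ _ _] [[Cv _ _ _] v0 uv]; split => //; split => // -[x y] Dz.
exact: (cauchy_riemann Cu Cv uv Dz).
Qed.

Theorem theorem3p2 (R : realType) (p : R) (w : R * R -> R)
  (p_gt0 : 0 < p)
  (w_weight : weight w)
  (w_BB : exists2 q : R, 1 < q & bekolle_bonami q w)
  (shifts_bounded : exists eta0 : R, 0 < eta0 < 1 /\
    forall eta : R, 0 < eta < eta0 ->
      bounded_operator (weighted_norm p w) (harmonic_on (@unit_disc R))
        (fun u g => g = radial_shift eta u) /\
      bounded_operator (weighted_norm p w) (harmonic_on (@unit_disc R))
        (fun u g => g = angular_shift eta u)) :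
  bounded_operator (weighted_norm p w) (harmonic_on (@unit_disc R))
    (@harmonic_conjugate R).
Proof.
have [mw w_ge0 w_gt0] := w_weight; have [q q1 [C C0 BB]] := w_BB.
have [N [w' [mN N0 mw' w'0 ww']]] :=
  borel_version (@measurable_unit_disc R) mw w_gt0.
(* Disc averages and norms do not see the null set [N], so the condition passes to [w'], also for
   the negative power. *)
have avgE (B : set (R * R)) (f g : R * R -> R) :
    (forall z, unit_disc z -> 0 <= f z) -> (forall z, unit_disc z -> 0 <= g z) ->
    (forall z, unit_disc z -> ~ N z -> f z = g z) -> disc_average B f = disc_average B g.
  move=> f0 g0 fg; congr (_ * _)%E.
  apply: (eq_integral_off_null mN N0) => z [_ Dz]; rewrite ?lee_fin; [exact: f0|exact: g0|].
  by move=> Nz; rewrite fg.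
have BB' c r : touches_circle c r ->
    (disc_average (open_disc c r) w' *
     disc_average (open_disc c r) (fun z => w' z `^ (- (q - 1)^-1))%R `^ (q - 1) <= C%:E)%E.
  move=> [r0 tc]; have := BB c r r0 tc.
  rewrite (avgE _ w w' w_ge0 (fun z _ => ltW (w'0 z)) ww').
  rewrite (avgE _ (fun z => w z `^ (- (q - 1)^-1)) (fun z => w' z `^ (- (q - 1)^-1)))//.
  - by move=> z _; exact: powR_ge0.
  - by move=> z _; exact: powR_ge0.
  - by move=> z Dz Nz; rewrite ww'.
have normE f : weighted_norm p w f =
    ((\int[area R]_(z in @unit_disc R) (`|f z| `^ p * w' z)%:E) `^ p^-1)%E.
  congr (_ `^ _)%E; apply: (eq_integral_off_null mN N0) => z Dz.
  - by rewrite lee_fin mulr_ge0 ?powR_ge0 ?w_ge0.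
  - by rewrite lee_fin mulr_ge0 ?powR_ge0 ?(ltW (w'0 z)).
  - by move=> Nz; rewrite ww'.
have [A A0 HA] := conjugate_bound p_gt0 q1 C0 mw' w'0 BB'.
have pi0 : 0 < p^-1 by rewrite invr_gt0.
have Ap : 0 < A `^ p^-1 by exact: powR_gt0.
(* The integral inequality with constant [A] becomes, after the power [1 / p], a norm inequality
   with constant [A^(1 / p)]. *)
move=> D D0; exists (D / A `^ p^-1) => [|u v hu huv]; first exact: divr_gt0.
have [uv v0] := harmonic_conjugate_cr hu huv.
have int_ge0 f : (0 <= \int[area R]_(z in @unit_disc R) (`|f z| `^ p * w' z)%:E)%E.
  by apply: integral_ge0 => z _; rewrite lee_fin mulr_ge0 ?powR_ge0// ltW.
rewrite !normE => nu.
apply: (@le_trans _ _ ((A%:E * \int[area R]_(z in @unit_disc R)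
   (`|u z| `^ p * w' z)%:E) `^ p^-1)%E).
  apply: gt0_ler_poweR; rewrite ?(ltW pi0)//; last exact: HA.
  - by rewrite in_itv/= int_ge0 leey.
  - by rewrite in_itv/= leey andbT mule_ge0 ?lee_fin ?(ltW A0).
rewrite poweRM ?lee_fin ?(ltW A0)// poweR_EFin.
apply: (@le_trans _ _ ((A `^ p^-1)%:E * (D / A `^ p^-1)%:E)%E).
  by apply: lee_wpmul2l; rewrite ?lee_fin ?(ltW Ap).
by rewrite -EFinM lee_fin mulrC divfK// gt_eqF.
Qed.
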